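(* Assume that the kernel sequence $q$ satisfies the spectral hypotheses (S1)–(S5) on the Banach space $\mathcal B$. Let $\alpha$ be a continuous linear functional on $\mathcal B$ and let $f\in\mathcal B$. Put $U_f^\alpha(k)=\sum_{n\ge0}\alpha(q_k^{(n)}f)$, $k\in\mathbb N^d$. If $K\subset\mathbb R^d$ is compact and $$\mathcal W_a(K)=\left\{k\in\mathbb N^d:\frac{k-am}{\sqrt a}\in K\right\},$$ then $$\sup_{k\in\mathcal W_a(K)}\left|a^{(d-1)/2}U_f^\alpha(k)-\alpha(\mathbf 1)\pi(f)\,\phi^\perp_{m,\Gamma}\left(\frac{k-am}{\sqrt a}\right)\right|\xrightarrow[a\to\infty]{}0.$$
   Context: Notation: $\mathbb N=\{0,1,2,\dots\}$, $d\ge1$; $0_d$ is the zero vector; $r\leq_dk$ means coordinatewise $\le$; $|z|_1=\sum_j|z_j|$; $\mathbf 1$ is the constant function one. $(\mathsf X,\mathcal X)$ is a standard Borel space and $q=(q_k)_{k\in\mathbb N^d}$ is a family of non-negative kernels on $\mathsf X$ with $\sum_kq_k(x,\mathsf X)=1$ for all $x$. Convolution powers: $q^{(0)}_k=I$ (identity kernel) if $k=0_d$ and $0$ otherwise; $q^{(n)}_k(x,A)=\sum_{r\leq_dk}\int q_r(x,dy)q^{(n-1)}_{k-r}(y,A)$. Kernels act on functions by $q_k^{(n)}f(x)=\int f(y)q_k^{(n)}(x,dy)$. For $z\in\mathbb C^d$ let $$Q_zf(x)=\sum_{k\in\mathbb N^d}e^{z\cdot k}\int_{\mathsf X}f(y)q_k(x,dy)$$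 whenever the sum is meaningful. Spectral hypotheses. There is a complex Banach space $\mathcal B$ of measurable functions on $\mathsf X$ such that: (S1) $\mathbf 1\in\mathcal B$, every finite measure $\alpha$ considered acts continuously on $\mathcal B$, and $Q_0$ acts boundedly on $\mathcal B$. (S2) $Q_0$ has a simple dominant eigenvalue equal to one: $Q_0=\Pi+N$, $\Pi f=\pi(f)\mathbf 1$ ($\pi$ being the invariant probability of $Q_0$), $\Pi N=N\Pi=0$, and there are $C<\infty$, $r<1$ with $\|N^n\|_{\mathcal B}\le Cr^n$ for all $n\ge0$. (S3) There is $\eta>0$ such that $z\mapsto Q_z$ is analytic as a bounded-operator-valued map on $\{z\in\mathbb C^d:|\operatorname{Re}z|_1<\eta\}$. (S4) For every $\delta>0$ there are $C<\infty$ and $r<1$ such that, for all sufficiently small $\zeta\in\mathbb R^d$, $$\sup_{\theta\in[-\pi,\pi]^d:\,|\theta|_1\ge\delta}\|Q^n_{\zeta+\mathrm i\theta}\|_{\mathcal B}\le Cr^n|\varrho(\zeta)|^n,\qquad n\ge0,$$ where $\varrho(z)$ denotes the analytic continuation near $z=0$ of the dominant eigenvalue of $Q_z$, with $\varrho(0)=1$. (S5) With $\Lambda(z)=\log\varrho(z)$, $\Lambda(0)=0$, one has as $z\to0$ in the strip: $\Lambda(z)=m^Tz+\frac12z^T\Gamma z+o(|z|_1^2)$, where $m\in(0,\infty)^d$ and $\Gamma$ is symmetric positive definite. Transverse density. $\Pi_{m,\Gamma}=\Gamma^{-1}-\dfrac{\Gamma^{-1}mm^T\Gamma^{-1}}{m^T\Gamma^{-1}m}$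 and, for $w\in\mathbb R^d$, $$\phi^\perp_{m,\Gamma}(w)=(2\pi)^{-(d-1)/2}\det(\Gamma)^{-1/2}(m^T\Gamma^{-1}m)^{-1/2}\exp\left\{-\tfrac12w^T\Pi_{m,\Gamma}w\right\},$$ with the convention $\phi^\perp_{m,\Gamma}=1/m$ when $d=1$. *)

(* Defs.v *)
From HB Require Import structures.
From mathcomp Require Import all_boot all_order all_algebra.
From mathcomp Require Import finmap complex.
From mathcomp Require Import all_classical all_reals all_analysis.
From mathcomp.analysis.showcase Require Import summability.
Set Implicit Arguments.
Unset Strict Implicit.
Unset Printing Implicit Defensive.
Import Order.TTheory GRing.Theory Num.Theory.
Import numFieldTopology.Exports numFieldNormedType.Exports.
Local Open Scope classical_set_scope.
Local Open Scope ring_scope.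
Local Open Scope complex_scope.

(* The norm topology on R[i], as numFieldNormedType provides it for an abstract
   numFieldType. *)
HB.instance Definition _ (R : realType) :=
  PseudoPointedMetric.copy R[i] R[i]^o.
HB.instance Definition _ (R : realType) := NormedModule.copy R[i] R[i]^o.

Notation multi d := {ffun 'I_d -> nat}.

Definition multi0 {d : nat} : multi d := [ffun=> 0%N].
Definition multi_le {d : nat} (r k : multi d) : bool := [forall i, (r i <= k i)%N].
Definition multi_sub {d : nat} (k r : multi d) : multi d := [ffun i => (k i - r i)%N].

Definition standard_borel (R : realType) (disp : measure_display)
    (X : measurableType disp) : Prop :=
  exists T : completePseudoMetricType R,
    [/\ hausdorff_space T,
        exists2 D : set T, countable D & dense D &
        exists2 h : X -> T, bijective h &
          forall A : set T, <<s @open T >> A <-> measurable (h @^-1` A)].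

Definition cexp (R : realType) (z : R[i]) : R[i] :=
  (expR (complex.Re z))%:C * (cos (complex.Im z) +i* sin (complex.Im z)).

(* `|z| lives in R[i]; this is the same modulus as an element of R. *)
Definition cabs (R : realType) (z : R[i]) : R := complex.Re `|z|.

(* Principal branch, argument in ]-pi, pi]. *)
Definition clog (R : realType) (z : R[i]) : R[i] :=
  let t := acos (complex.Re z / cabs z) in
  ln (cabs z) +i* (if 0 <= complex.Im z then t else - t).

Definition cmeasurable (R : realType) (disp : measure_display)
    (X : measurableType disp) (f : X -> R[i]) : Prop :=
  measurable_fun setT (fun x => complex.Re (f x)) /\
  measurable_fun setT (fun x => complex.Im (f x)).

Definition cintegrable (R : realType) (disp : measure_display)
    (X : measurableType disp) (mu : set X -> \bar R) (f : X -> R[i]) : Prop :=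
  mu.-integrable setT (fun x => (complex.Re (f x))%:E) /\
  mu.-integrable setT (fun x => (complex.Im (f x))%:E).

Definition cintegral (R : realType) (disp : measure_display)
    (X : measurableType disp) (mu : set X -> \bar R) (f : X -> R[i]) : R[i] :=
  fine (\int[mu]_x (complex.Re (f x))%:E) +i*
  fine (\int[mu]_x (complex.Im (f x))%:E).

Fixpoint convpow (R : realType) (disp : measure_display)
    (X : measurableType disp) (d : nat) (q : multi d -> R.-ker X ~> X)
    (n : nat) (k : multi d) (x : X) (A : set X) : \bar R :=
  if n is n'.+1 then
    (\sum_(r \in [set r | multi_le r k])
       \int[q r x]_y convpow q n' (multi_sub k r) y A)%E
  else if k == multi0 then \d_x A else 0%E.


Definition conv_apply (R : realType) (disp : measure_display)
    (X : measurableType disp) (d : nat) (q : multi d -> R.-ker X ~> X)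
    (n : nat) (k : multi d) (f : X -> R[i]) : X -> R[i] :=
  fun x => cintegral (convpow q n k x) f.

Definition invariant_probability (R : realType) (disp : measure_display)
    (X : measurableType disp) (d : nat) (q : multi d -> R.-ker X ~> X)
    (nu : probability X R) : Prop :=
  forall A, measurable A ->
    (\int[nu]_x (\esum_(k in [set: multi d]) q k x A) = nu A)%E.

Definition cdot (R : realType) (d : nat) (z : 'cV[R[i]]_d) (k : multi d) : R[i] :=
  \sum_i z i 0 * (k i)%:R.

Definition cmonomial (R : realType) (d : nat) (h : 'cV[R[i]]_d) (j : multi d) : R[i] :=
  \prod_i h i 0 ^+ j i.

Definition norm1 (R : realType) (d : nat) (x : 'cV[R]_d) : R := \sum_i `|x i 0|.

Definition cnorm1 (R : realType) (d : nat) (z : 'cV[R[i]]_d) : R :=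
  \sum_i cabs (z i 0).

Definition rvec (R : realType) (d : nat) (x : 'cV[R]_d) : 'cV[R[i]]_d :=
  map_mx (real_complex R) x.

Definition cvec (R : realType) (d : nat) (x y : 'cV[R]_d) : 'cV[R[i]]_d :=
  \col_i (x i 0 +i* y i 0).

Definition strip (R : realType) (d : nat) (eta : R) : set 'cV[R[i]]_d :=
  [set z | \sum_i `|complex.Re (z i 0)| < eta].

Definition Qterm (R : realType) (disp : measure_display)
    (X : measurableType disp) (d : nat) (q : multi d -> R.-ker X ~> X)
    (z : 'cV[R[i]]_d) (f : X -> R[i]) (x : X) (k : multi d) : R[i] :=
  cexp (cdot z k) * cintegral (q k x) f.

(* Sums over N^d are unconditional: limits along the net of finite subsets. *)
Definition Qfun (R : realType) (disp : measure_display)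
    (X : measurableType disp) (d : nat) (q : multi d -> R.-ker X ~> X)
    (z : 'cV[R[i]]_d) (f : X -> R[i]) (x : X) : R[i] :=
  lim (partial_sum (Qterm q z f x) @ totally).

Definition Qmeaningful (R : realType) (disp : measure_display)
    (X : measurableType disp) (d : nat) (q : multi d -> R.-ker X ~> X)
    (z : 'cV[R[i]]_d) (f : X -> R[i]) (x : X) : Prop :=
  (forall k, cintegrable (q k x) f) /\
  cvg (partial_sum (Qterm q z f x) @ totally).

(* A Banach space of measurable functions on X: an abstract Banach space B and
   the injection ev sending an element of B to the function it is. *)
Definition function_space (R : realType) (disp : measure_display)
    (X : measurableType disp) (B : completeNormedModType R[i])
    (ev : B -> X -> R[i]) : Prop :=
  [/\ forall (a : R[i]) f g x, ev (a *: f + g) x = a * ev f x + ev g x,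
      injective ev &
      forall f, cmeasurable (ev f)].

Definition belongs (R : realType) (disp : measure_display)
    (X : measurableType disp) (B : completeNormedModType R[i])
    (ev : B -> X -> R[i]) (g : X -> R[i]) : Prop :=
  exists b, ev b = g.

(* The element of B that is the function g; used only when g belongs to B. *)
Definition elt (R : realType) (disp : measure_display)
    (X : measurableType disp) (B : completeNormedModType R[i])
    (ev : B -> X -> R[i]) (g : X -> R[i]) : B :=
  xget 0 [set b | ev b = g].

Definition Qop (R : realType) (disp : measure_display)
    (X : measurableType disp) (B : completeNormedModType R[i])
    (ev : B -> X -> R[i]) (d : nat) (q : multi d -> R.-ker X ~> X)
    (z : 'cV[R[i]]_d) (f : B) : B :=
  elt ev (Qfun q z (ev f)).

(* The operator norm of T is at most c. *)
Definition op_le (R : realType) (B : completeNormedModType R[i])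
    (T : B -> B) (c : R) : Prop :=
  forall f, `|T f| <= c%:C * `|f|.

Definition bounded_operator (R : realType) (B : completeNormedModType R[i])
    (T : B -> B) : Prop :=
  linear T /\ exists c, op_le T c.

Definition Q_acts_boundedly (R : realType) (disp : measure_display)
    (X : measurableType disp) (B : completeNormedModType R[i])
    (ev : B -> X -> R[i]) (d : nat) (q : multi d -> R.-ker X ~> X)
    (z : 'cV[R[i]]_d) : Prop :=
  [/\ forall f x, Qmeaningful q z (ev f) x,
      forall f, belongs ev (Qfun q z (ev f)) &
      bounded_operator (Qop ev q z)].

Definition acts_continuously (R : realType) (disp : measure_display)
    (X : measurableType disp) (B : completeNormedModType R[i])
    (ev : B -> X -> R[i]) (mu : set X -> \bar R) : Prop :=
  (forall f, cintegrable mu (ev f)) /\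
  continuous (fun f : B => cintegral mu (ev f)).

(* The measures against which elements of B get integrated: nu and the
   measures q_k^(n)(x, .), among them the Dirac masses (n = 0, k = 0). *)
Definition considered_measures (R : realType) (disp : measure_display)
    (X : measurableType disp) (d : nat) (q : multi d -> R.-ker X ~> X)
    (nu : probability X R) : set (set X -> \bar R) :=
  [set mu : set X -> \bar R | mu = nu :> (set X -> \bar R) \/ exists n k x, mu = convpow q n k x].

(* F is the sum of a power series in a polydisc around z0, where bound v c
   says that v has norm at most c. *)
Definition analytic_at (R : realType) (d : nat) (V : lmodType R[i])
    (bound : V -> R -> Prop) (F : 'cV[R[i]]_d -> V) (z0 : 'cV[R[i]]_d) : Prop :=
  exists (s : R) (A : multi d -> V),
    [/\ 0 < s,
        forall j, exists c, bound (A j) c &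
        forall h : 'cV[R[i]]_d, (forall i, cabs (h i 0) < s) ->
        forall e : R, 0 < e ->
        \forall J \near totally,
          bound (F (z0 + h) - partial_sum (fun j => cmonomial h j *: A j) J) e].

Definition op_analytic_at (R : realType) (d : nat)
    (B : completeNormedModType R[i]) (F : 'cV[R[i]]_d -> B -> B)
    (z0 : 'cV[R[i]]_d) : Prop :=
  @analytic_at R d (B -> B) (fun T c => linear T /\ op_le T c) F z0.

Definition scalar_analytic_at (R : realType) (d : nat)
    (F : 'cV[R[i]]_d -> R[i]) (z0 : 'cV[R[i]]_d) : Prop :=
  @analytic_at R d R[i]^o (fun v c => cabs v <= c) F z0.

(* l is a simple dominant eigenvalue of T: T = l P + N with P a projection of
   rank one, P N = N P = 0 and N^n = O((r |l|)^n) for some r < 1. *)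
Definition simple_dominant_eigenvalue (R : realType)
    (B : completeNormedModType R[i]) (T : B -> B) (l : R[i]) : Prop :=
  exists P N : B -> B,
    [/\ bounded_operator P /\ bounded_operator N,
        exists2 v : B, v != 0 & P v = v /\ forall f, exists c : R[i], P f = c *: v,
        forall f, T f = l *: P f + N f,
        forall f, P (N f) = 0 /\ N (P f) = 0 &
        exists C r : R, 0 <= r < 1 /\
          forall n, op_le (iter n N) (C * (r * cabs l) ^+ n)].

Definition S1 (R : realType) (disp : measure_display)
    (X : measurableType disp) (B : completeNormedModType R[i])
    (ev : B -> X -> R[i]) (d : nat) (q : multi d -> R.-ker X ~> X)
    (nu : probability X R) : Prop :=
  [/\ belongs ev (cst 1),
      forall mu, considered_measures q nu mu -> acts_continuously ev mu &
      Q_acts_boundedly ev q 0].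

Definition S2 (R : realType) (disp : measure_display)
    (X : measurableType disp) (B : completeNormedModType R[i])
    (ev : B -> X -> R[i]) (d : nat) (q : multi d -> R.-ker X ~> X)
    (nu : probability X R) : Prop :=
  let Pi := fun f : B => cintegral nu (ev f) *: elt ev (cst 1) in
  exists N : B -> B,
    [/\ bounded_operator N,
        forall f, Qop ev q 0 f = Pi f + N f,
        forall f, Pi (N f) = 0 /\ N (Pi f) = 0 &
        exists C r : R, 0 <= r < 1 /\
          forall n, op_le (iter n N) (C * r ^+ n)].

Definition S3 (R : realType) (disp : measure_display)
    (X : measurableType disp) (B : completeNormedModType R[i])
    (ev : B -> X -> R[i]) (d : nat) (q : multi d -> R.-ker X ~> X) : Prop :=
  exists2 eta : R, 0 < eta &
    forall z, strip eta z ->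
      Q_acts_boundedly ev q z /\ op_analytic_at (Qop ev q) z.

Definition eigenvalue_continuation (R : realType) (disp : measure_display)
    (X : measurableType disp) (B : completeNormedModType R[i])
    (ev : B -> X -> R[i]) (d : nat) (q : multi d -> R.-ker X ~> X)
    (rho : 'cV[R[i]]_d -> R[i]) : Prop :=
  [/\ rho 0 = 1,
      scalar_analytic_at rho 0 &
      \forall z \near (0 : 'cV[R[i]]_d),
        simple_dominant_eigenvalue (Qop ev q z) (rho z)].

Definition S4 (R : realType) (disp : measure_display)
    (X : measurableType disp) (B : completeNormedModType R[i])
    (ev : B -> X -> R[i]) (d : nat) (q : multi d -> R.-ker X ~> X)
    (rho : 'cV[R[i]]_d -> R[i]) : Prop :=
  forall delta : R, 0 < delta ->
    exists C r : R, 0 <= r < 1 /\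
      \forall zeta \near (0 : 'cV[R]_d),
      forall theta : 'cV[R]_d,
        (forall i, - pi <= theta i 0 <= pi) -> delta <= norm1 theta ->
      forall n, op_le (iter n (Qop ev q (cvec zeta theta)))
                      (C * r ^+ n * cabs (rho (rvec zeta)) ^+ n).

Definition S5 (R : realType) (d : nat) (rho : 'cV[R[i]]_d -> R[i])
    (m : 'cV[R]_d) (Gamma : 'M[R]_d) : Prop :=
  let Lambda := fun z => clog (rho z) in
  [/\ Lambda 0 = 0,
      (fun z => Lambda z -
         (((rvec m)^T *m z) 0 0 +
          2^-1 * (z^T *m map_mx (real_complex R) Gamma *m z) 0 0))
        =o_ (nbhs (0 : 'cV[R[i]]_d)) (fun z => (cnorm1 z ^+ 2)%:C),
      forall i, 0 < m i 0,
      Gamma^T = Gamma &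
      forall v : 'cV[R]_d, v != 0 -> 0 < (v^T *m Gamma *m v) 0 0].

Definition transverse_form (R : realType) (d : nat) (m : 'cV[R]_d)
    (Gamma : 'M[R]_d) : 'M[R]_d :=
  invmx Gamma - ((m^T *m invmx Gamma *m m) 0 0)^-1 *:
                (invmx Gamma *m m *m m^T *m invmx Gamma).

(* For d = 1 the form vanishes and the value is 1 / m. *)
Definition transverse_density (R : realType) (d : nat) (m : 'cV[R]_d)
    (Gamma : 'M[R]_d) (w : 'cV[R]_d) : R :=
  (2 * pi) `^ (- (d.-1%:R / 2)) * (\det Gamma) `^ (- 2^-1) *
  ((m^T *m invmx Gamma *m m) 0 0) `^ (- 2^-1) *
  expR (- 2^-1 * (w^T *m transverse_form m Gamma *m w) 0 0).

Definition rescaled (R : realType) (d : nat) (m : 'cV[R]_d) (a : R)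
    (k : multi d) : 'cV[R]_d :=
  \col_i (((k i)%:R - a * m i 0) / Num.sqrt a).

Definition window (R : realType) (d : nat) (m : 'cV[R]_d) (K : set 'cV[R]_d)
    (a : R) : set (multi d) :=
  [set k | K (rescaled m a k)].

Definition green_term (R : realType) (disp : measure_display)
    (X : measurableType disp) (B : completeNormedModType R[i])
    (ev : B -> X -> R[i]) (d : nat) (q : multi d -> R.-ker X ~> X)
    (alpha : B -> R[i]) (f : B) (k : multi d) (n : nat) : R[i] :=
  alpha (elt ev (conv_apply q n k (ev f))).

Definition green (R : realType) (disp : measure_display)
    (X : measurableType disp) (B : completeNormedModType R[i])
    (ev : B -> X -> R[i]) (d : nat) (q : multi d -> R.-ker X ~> X)
    (alpha : B -> R[i]) (f : B) (k : multi d) : R[i] :=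
  limn (series (green_term ev q alpha f k)).

(* Main.v *)
Require Import Defs.
From HB Require Import structures.
From mathcomp Require Import all_boot all_order all_algebra.
From mathcomp Require Import finmap complex.
From mathcomp Require Import all_classical all_reals all_analysis.
From mathcomp Require Import measurable_realfun.
From mathcomp Require Import ring lra.
From mathcomp.analysis.showcase Require Import summability.
Set Implicit Arguments.
Unset Strict Implicit.
Unset Printing Implicit Defensive.
Import Order.TTheory GRing.Theory Num.Theory.
Import numFieldTopology.Exports numFieldNormedType.Exports.
Local Open Scope classical_set_scope.
Local Open Scope ring_scope.
Local Open Scope complex_scope.

(* Write c_n(k) = alpha (q_k^(n) f).  Averaging over a finite grid of the torus
   isolates Fourier coefficients exactly, so that, for every small real tilt zeta,
   c_n(k) is the limit of the grid averages of
   e^(-(zeta + i theta).k) alpha (Q_(zeta + i theta)^n f).  Near theta = 0 a rank one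
   perturbation argument gives Q_z^n f = rho(z)^n (pi(f) 1 + o(1) f) + O(r^n), and away
   from 0 (S4) makes Q_z^n exponentially negligible.  At zeta = 0 this is a local limit
   theorem: n^(d/2) c_n(k) is uniformly close to alpha(1) pi(f) times the Gaussian density
   at (k - n m) / sqrt n.  At zeta = -/+ 1 / sqrt a it gives
   a^(d/2) |c_n(k)| <= C e^(-kappa |n - a| / sqrt a) on the window.  In the sum over n only
   the n with |n - a| = O(sqrt a) therefore matter; there the Gaussian is, up to the factor
   exp (-w^T Pi w / 2), a Gaussian in (n - a) / sqrt a after completing the square, and its
   Riemann sum produces the transverse density.

   All integrals over R^d are replaced by sums over grids, so the d-dimensional Gaussian
   integral is reached by iterating a one-dimensional Riemann sum. *)

(** Only the operators Q_z are given on B, while the Green function involves q_k^(n) f. That these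
    functions belong to B is already a consequence of Fourier inversion: grid averages of Q_(zeta +
    i theta) f converge in B by completeness, and evaluation at a point, being integration against a
    Dirac mass, identifies the limit.

    Analyticity and the spectral splitting come with constants that may depend on z. Uniformity over
    the torus is recovered from compactness, and uniformity of the splitting near 0 by perturbing a
    high power of Q_z, which at z = 0 is close to the projection onto constants.

    A tilt of order 1 / sqrt a is as large as possible while its quadratic cost n |zeta|^2 stays
    bounded for n of order a; its linear gain is a multiple of |n - a| / sqrt a. The gap between the
    power d/2 of the local limit theorem and (d - 1)/2 is the mesh 1 / sqrt a of the Riemann sum in
    n.

    The Gaussian Fourier integral calls for a contour shift into C^d. On grids this becomes a
    telescoping argument whose errors are Taylor remainders and boundary terms. *)

Section RealNorm.
Variable R : realType.
Implicit Types (V : normedModType R[i]) (z w : R[i]).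

(** Norms over [R[i]] take values in [R[i]]. The real part loses nothing, by [rnormE], and brings
    all estimates into the ordered field [R]. *)
Definition rnorm V (v : V) : R := complex.Re `|v|.

Lemma rnormE V (v : V) : `|v| = (rnorm v)%:C.
Proof. by have := ger0_Im (normr_ge0 v); rewrite /rnorm; case: `|v| => a b /= ->. Qed.

Lemma cabsE z : `|z| = (cabs z)%:C.
Proof. by have := ger0_Im (normr_ge0 z); rewrite /cabs; case: `|z| => a b /= ->. Qed.

Lemma rnorm_cabs z : rnorm (z : R[i]^o) = cabs z. Proof. by []. Qed.

Lemma rnorm_ge0 V (v : V) : 0 <= rnorm v.
Proof. by rewrite -lecR -rnormE normr_ge0. Qed.

Lemma rnorm0 V : rnorm (0 : V) = 0.
Proof. by rewrite /rnorm normr0. Qed.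

Lemma rnorm0_eq0 V (v : V) : rnorm v = 0 -> v = 0.
Proof. by move=> h; apply/eqP; rewrite -normr_eq0 rnormE h. Qed.

Lemma rnormN V (v : V) : rnorm (- v) = rnorm v.
Proof. by rewrite /rnorm normrN. Qed.

Lemma ler_rnormD V (u v : V) : rnorm (u + v) <= rnorm u + rnorm v.
Proof. by rewrite -lecR rmorphD /= -!rnormE ler_normD. Qed.

Lemma ler_rnormB V (u v : V) : rnorm (u - v) <= rnorm u + rnorm v.
Proof. by rewrite -(rnormN v) ler_rnormD. Qed.

Lemma rnorm_distC V (u v : V) : rnorm (u - v) = rnorm (v - u).
Proof. by rewrite -rnormN opprB. Qed.

Lemma ler_rnorm_dist V (u v w : V) : rnorm (u - w) <= rnorm (u - v) + rnorm (v - w).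
Proof. by rewrite -(subrKA v) ler_rnormD. Qed.

Lemma rnormZ V (a : R[i]) (v : V) : rnorm (a *: v) = cabs a * rnorm v.
Proof.
by apply: complexI; rewrite rmorphM /= -rnormE -cabsE -rnormE normrZ.
Qed.

Lemma ler_rnorm_sum V (I : Type) (r : seq I) (P : pred I) (F : I -> V) :
  rnorm (\sum_(i <- r | P i) F i) <= \sum_(i <- r | P i) rnorm (F i).
Proof.
elim/big_ind2 : _ => //; first by rewrite rnorm0.
by move=> x a y b hx hy; rewrite (le_trans (ler_rnormD _ _))// lerD.
Qed.

Lemma cabs_ge0 z : 0 <= cabs z. Proof. exact: (rnorm_ge0 (z : R[i]^o)). Qed.
Lemma cabs0 : cabs (0 : R[i]) = 0. Proof. exact: (@rnorm0 R[i]^o). Qed.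
Lemma cabs0_eq0 z : cabs z = 0 -> z = 0. Proof. exact: (@rnorm0_eq0 R[i]^o). Qed.
Lemma cabsN z : cabs (- z) = cabs z. Proof. exact: (@rnormN R[i]^o). Qed.
Lemma ler_cabsD z w : cabs (z + w) <= cabs z + cabs w.
Proof. exact: (@ler_rnormD R[i]^o). Qed.
Lemma ler_cabsB z w : cabs (z - w) <= cabs z + cabs w.
Proof. exact: (@ler_rnormB R[i]^o). Qed.
Lemma cabs_distC z w : cabs (z - w) = cabs (w - z).
Proof. exact: (@rnorm_distC R[i]^o). Qed.
Lemma ler_cabs_dist z u w : cabs (z - w) <= cabs (z - u) + cabs (u - w).
Proof. exact: (@ler_rnorm_dist R[i]^o). Qed.
Lemma cabsM z w : cabs (z * w) = cabs z * cabs w.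
Proof. exact: (@rnormZ R[i]^o). Qed.
Lemma ler_cabs_sum (I : Type) (r : seq I) (P : pred I) (F : I -> R[i]) :
  cabs (\sum_(i <- r | P i) F i) <= \sum_(i <- r | P i) cabs (F i).
Proof. exact: (@ler_rnorm_sum R[i]^o). Qed.
Lemma cabs1 : cabs (1 : R[i]) = 1. Proof. by rewrite /cabs normr1. Qed.
Lemma cabsX z n : cabs (z ^+ n) = cabs z ^+ n.
Proof. by elim: n => [|n IH]; rewrite ?expr0 ?cabs1// !exprS cabsM IH. Qed.
Lemma cabs_real (x : R) : cabs x%:C = `|x|.
Proof. by apply: complexI; rewrite -cabsE normc_def /= expr0n /= addr0 sqrtr_sqr. Qed.
Lemma cabs_nat n : cabs (n%:R : R[i]) = n%:R.
Proof. by rewrite -(rmorph_nat (real_complex R)) cabs_real ger0_norm. Qed.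
Lemma cabs_prod (I : Type) (r : seq I) (P : pred I) (F : I -> R[i]) :
  cabs (\prod_(i <- r | P i) F i) = \prod_(i <- r | P i) cabs (F i).
Proof. by rewrite (big_morph _ cabsM cabs1). Qed.
Lemma cabsV z : cabs z^-1 = (cabs z)^-1.
Proof. by apply: complexI; rewrite -cabsE normfV cabsE fmorphV. Qed.
Lemma cabs_normE z : cabs z = Num.sqrt (complex.Re z ^+ 2 + complex.Im z ^+ 2).
Proof. by case: z => a b; apply: complexI; rewrite -cabsE normc_def. Qed.
Lemma cabs_sqr z : cabs z ^+ 2 = complex.Re z ^+ 2 + complex.Im z ^+ 2.
Proof. by rewrite cabs_normE sqr_sqrtr// addr_ge0// sqr_ge0. Qed.
Lemma cabs_Re z : `|complex.Re z| <= cabs z.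
Proof.
rewrite cabs_normE -sqrtr_sqr ler_sqrt ?addr_ge0 ?sqr_ge0//.
by rewrite lerDl sqr_ge0.
Qed.
Lemma cabs_Im z : `|complex.Im z| <= cabs z.
Proof.
rewrite cabs_normE -sqrtr_sqr ler_sqrt ?addr_ge0 ?sqr_ge0//.
by rewrite lerDr sqr_ge0.
Qed.
Lemma cabs_le_ReIm z : cabs z <= `|complex.Re z| + `|complex.Im z|.
Proof.
rewrite -[leRHS]ger0_norm ?addr_ge0// cabs_normE -sqrtr_sqr ler_sqrt ?sqr_ge0//.
rewrite sqrrD !real_normK ?num_real// addrAC lerDl.
by rewrite mulrn_wge0// mulr_ge0.
Qed.

Lemma op_leP (B : completeNormedModType R[i]) (T : B -> B) (c : R) :
  op_le T c <-> forall f, rnorm (T f) <= c * rnorm f.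
Proof.
by split=> h f; have := h f; rewrite !rnormE -rmorphM /= lecR.
Qed.

Lemma cexpD z w : cexp (z + w) = cexp z * cexp w.
Proof.
rewrite /cexp; case: z => a b; case: w => c d /=.
by rewrite expRD cosD sinD; apply/eqP; rewrite eq_complex /=; apply/andP; split;
  apply/eqP; ring.
Qed.

Lemma cexp0 : cexp (0 : R[i]) = 1.
Proof. by rewrite /cexp /= expR0 cos0 sin0 mul1r. Qed.

Lemma cabs_cexp z : cabs (cexp z) = expR (complex.Re z).
Proof.
rewrite /cexp cabsM cabs_real ger0_norm ?expR_ge0// cabs_normE /= cos2Dsin2.
by rewrite sqrtr1 mulr1.
Qed.

Lemma cexp_neq0 z : cexp z != 0.
Proof.
apply/eqP => h; have := cabs_cexp z; rewrite h cabs0 => e.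
by have := expR_gt0 (complex.Re z); rewrite -e ltxx.
Qed.

Lemma cexpN z : cexp (- z) = (cexp z)^-1.
Proof.
by apply: (mulfI (cexp_neq0 z)); rewrite -cexpD subrr cexp0 mulfV// cexp_neq0.
Qed.

Lemma cexpMn z n : cexp (z *+ n) = cexp z ^+ n.
Proof. by elim: n => [|n IH]; rewrite ?mulr0n ?cexp0 ?expr0// mulrS exprS cexpD IH. Qed.

Lemma cexp_sum (I : Type) (r : seq I) (P : pred I) (F : I -> R[i]) :
  cexp (\sum_(i <- r | P i) F i) = \prod_(i <- r | P i) cexp (F i).
Proof. by rewrite (big_morph _ cexpD cexp0). Qed.

Lemma cexp_real (x : R) : cexp x%:C = (expR x)%:C.
Proof. by rewrite /cexp /= cos0 sin0 mulr1. Qed.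

End RealNorm.

Ltac pos := repeat first
  [ done | (apply: ltW; assumption) | exact: expR_ge0 | exact: expR_gt0 | exact: cabs_ge0
  | exact: rnorm_ge0 | exact: sqr_ge0 | exact: pi_gt0 | exact: pi_ge0
  | apply: mulr_ge0 | apply: mulr_gt0 | apply: divr_ge0 | apply: divr_gt0
  | apply: exprn_ge0 | apply: exprn_gt0 | rewrite invr_ge0 | rewrite invr_gt0
  | lra | apply: addr_ge0 | apply: addr_gt0 ].

(** * Finite grid sums in several variables *)

Section GridSum.
Variable R : realType.

(** The recursion peels off the first coordinate, so that d-dimensional statements are reached by
    induction from one-dimensional sums, in step with the block decomposition of quadratic forms in
    [spd_ind]. *)
Fixpoint gridsum (V : nmodType) (s : seq R) (d : nat) : ('cV[R]_d -> V) -> V :=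
  if d is d'.+1 return ('cV[R]_d -> V) -> V
  then fun F => \sum_(t <- s) @gridsum V s d' (fun u => F (col_mx t%:M u))
  else fun F => F 0.

Lemma col_mx_forall (P : R -> Prop) d t (u : 'cV[R]_d) :
  P t -> (forall i, P (u i 0)) -> forall i, P ((col_mx t%:M u : 'cV[R]_d.+1) i 0).
Proof.
move=> Pt Pu i; rewrite [X in P X]mxE; case: splitP => j _; last exact: Pu.
by rewrite mxE (ord1 j) eqxx mulr1n.
Qed.

Lemma eq_gridsum (V : nmodType) s d (F G : 'cV[R]_d -> V) :
  (forall u : 'cV[R]_d, (forall i, u i 0 \in s) -> F u = G u) -> gridsum s F = gridsum s G.
Proof.
elim: d F G => [|d IH] F G FG /=; first by apply: FG => -[].
rewrite !big_seq; apply: eq_bigr => t ts; apply: IH => u us.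
by apply: FG; exact: (@col_mx_forall (fun x => x \in s)).
Qed.

Lemma ler_gridsum s d (F G : 'cV[R]_d -> R) :
  (forall u : 'cV[R]_d, (forall i, u i 0 \in s) -> F u <= G u) -> gridsum s F <= gridsum s G.
Proof.
elim: d F G => [|d IH] F G FG /=; first by apply: FG => -[].
rewrite !big_seq; apply: ler_sum => t ts; apply: IH => u us.
by apply: FG; exact: (@col_mx_forall (fun x => x \in s)).
Qed.

Lemma raddf_gridsum (V W : nmodType) (phi : {additive V -> W}) s d (F : 'cV[R]_d -> V) :
  phi (gridsum s F) = gridsum s (phi \o F).
Proof.
elim: d F => [//|d IH] F /=; rewrite raddf_sum; apply: eq_bigr => t _.
by rewrite IH.
Qed.

Lemma gridsumD (V : nmodType) s d (F G : 'cV[R]_d -> V) :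
  gridsum s (fun u => F u + G u) = gridsum s F + gridsum s G.
Proof.
elim: d F G => [//|d IH] F G /=; rewrite -big_split; apply: eq_bigr => t _.
by rewrite IH.
Qed.

Lemma gridsum0 (V : nmodType) s d : gridsum s (fun _ : 'cV[R]_d => 0 : V) = 0.
Proof. by elim: d => [//|d IH] /=; rewrite big1. Qed.

Lemma gridsum_sum (V : nmodType) (I : Type) (r : seq I) (P : pred I) s d
    (F : I -> 'cV[R]_d -> V) :
  gridsum s (fun u => \sum_(i <- r | P i) F i u) = \sum_(i <- r | P i) gridsum s (F i).
Proof.
elim: r => [|i r IH].
  by rewrite big_nil -[RHS](gridsum0 V s d); apply: eq_gridsum => u _; rewrite big_nil.
rewrite big_cons -IH; case: ifP => Pi.
  by rewrite -gridsumD; apply: eq_gridsum => u _; rewrite big_cons Pi.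
by apply: eq_gridsum => u _; rewrite big_cons Pi.
Qed.

Lemma gridsumN (V : zmodType) s d (F : 'cV[R]_d -> V) :
  gridsum s (fun u => - F u) = - gridsum s F.
Proof. by rewrite (raddf_gridsum (-%R)). Qed.

Lemma gridsumB (V : zmodType) s d (F G : 'cV[R]_d -> V) :
  gridsum s (fun u => F u - G u) = gridsum s F - gridsum s G.
Proof. by rewrite gridsumD gridsumN. Qed.

Lemma gridsumZ (K : pzRingType) (V : lmodType K) (a : K) s d (F : 'cV[R]_d -> V) :
  gridsum s (fun u => a *: F u) = a *: gridsum s F.
Proof. by rewrite (raddf_gridsum ( *:%R a)). Qed.

Lemma gridsumMl (K : pzRingType) (a : K) s d (F : 'cV[R]_d -> K) :
  gridsum s (fun u => a * F u) = a * gridsum s F.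
Proof. exact: (@gridsumZ K K^o). Qed.

Lemma rnorm_gridsum (V : normedModType R[i]) s d (F : 'cV[R]_d -> V) :
  rnorm (gridsum s F) <= gridsum s (fun u => rnorm (F u)).
Proof.
elim: d F => [//|d IH] F /=; rewrite (le_trans (ler_rnorm_sum _ _ _))//.
by apply: ler_sum => t _; apply: IH.
Qed.

Lemma cabs_gridsum s d (F : 'cV[R]_d -> R[i]) :
  cabs (gridsum s F) <= gridsum s (fun u => cabs (F u)).
Proof. exact: (@rnorm_gridsum R[i]^o). Qed.

Lemma gridsum_prod (K : comPzRingType) s d (g : 'I_d -> R -> K) :
  gridsum s (fun u => \prod_i g i (u i 0)) = \prod_i \sum_(t <- s) g i t.
Proof.
elim: d g => [|d IH] g /=; first by rewrite !big_ord0.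
rewrite big_ord_recl mulr_suml; apply: eq_bigr => t _.
rewrite -IH -gridsumMl; apply: eq_gridsum => u _.
rewrite big_ord_recl; congr (g _ _ * _).
  by rewrite mxE; case: splitP => // j _; rewrite mxE (ord1 j) eqxx mulr1n.
apply: eq_bigr => i _; congr (g _ _); rewrite mxE; case: splitP.
  by case=> -[].
by move=> k /= [] /ord_inj ->.
Qed.

Lemma gridsum_const (K : pzRingType) s d (c : K) :
  gridsum s (fun _ : 'cV[R]_d => c) = (size s)%:R ^+ d * c.
Proof.
elim: d => [|d IH] /=; first by rewrite mul1r.
rewrite (eq_bigr (fun=> (size s)%:R ^+ d * c)); last by move=> t _; exact: IH.
by rewrite big_const_seq count_predT iter_addr_0 exprS -mulrA mulr_natl.
Qed.

Lemma gridsum_map (V : nmodType) (a : R) s d (F : 'cV[R]_d -> V) :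
  gridsum [seq a * t | t <- s] F = gridsum s (fun u => F (a *: u)).
Proof.
elim: d F => [|d IH] F /=; first by rewrite scaler0.
rewrite big_map; apply: eq_bigr => t _; rewrite IH; apply: eq_gridsum => u _.
congr (F _); apply/colP => i; rewrite !mxE.
by case: splitP => j _; rewrite !mxE// mulrnAr.
Qed.

(** The grid is half open: with [h = pi / N%:R] its 2N points fill [-pi, pi) without repeating an
    endpoint, which makes the orthogonality of characters exact. *)
Definition grid (h : R) (N : nat) : seq R :=
  [seq h * (j%:R - N%:R) | j <- iota 0 (N + N)].

Lemma size_grid h N : size (grid h N) = (N + N)%N.
Proof. by rewrite size_map size_iota. Qed.

Lemma grid_scale (a h : R) N : [seq a * t | t <- grid h N] = grid (a * h) N.
Proof. by rewrite -map_comp; apply: eq_map => j /=; rewrite mulrA. Qed.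

Lemma sum_grid (V : nmodType) h N (F : R -> V) :
  \sum_(t <- grid h N) F t = \sum_(j < N + N) F (h * (j%:R - N%:R)).
Proof.
have -> : grid h N = [seq h * (j%:R - N%:R) | j <- index_iota 0 (N + N)].
  by rewrite /index_iota subn0.
by rewrite big_map big_mkord.
Qed.

Lemma gridP h N t : 0 <= h -> t \in grid h N -> - (h * N%:R) <= t < h * N%:R \/ h = 0.
Proof.
rewrite le_eqVlt => /predU1P[<-|h0]; first by right.
move=> /mapP[j]; rewrite mem_iota add0n => /andP[_ jN] ->; left; apply/andP; split.
  by rewrite -mulrN ler_pM2l// lerBrDr addNr ler0n.
by rewrite ltr_pM2l// ltrBlDr -natrD ltr_nat.
Qed.

Lemma grid_bound h N t : 0 <= h -> t \in grid h N -> `|t| <= h * N%:R.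
Proof.
move=> h0 tg; case: (gridP h0 tg) => [/andP[a b]|he].
  by rewrite ler_norml a ltW.
by case/mapP: tg => j _ ->; rewrite he !mul0r normr0.
Qed.

End GridSum.

(** * Gaussian Riemann sums *)

Section Taylor.
Variable R : realType.
Implicit Types (x y : R) (z w u : R[i]).

(** From exp (-x) >= 1 - x one gets exp x (1 - x) <= 1, hence exp x - 1 - x <= x^2 / (1 - x). *)
Lemma expR_sub1_le x : `|x| <= 2^-1 -> 0 <= expR x - 1 - x <= 2 * x ^+ 2.
Proof.
rewrite ler_norml => /andP[x1 x2]; apply/andP; split.
  by have := expR_ge1Dx x; lra.
have h := expR_ge1Dx (- x); rewrite expRN in h.
have e0 := expR_gt0 x.
have : expR x * (1 - x) <= 1.
  rewrite mulrC -ler_pdivlMr// div1r//.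
have -> : expR x - 1 - x = (expR x * (1 - x) - 1 + x ^+ 2) / (1 - x).
  by field; rewrite subr_eq0; apply/eqP => e; move: x2; rewrite -e; lra.
move=> k; rewrite ler_pdivrMr; last by lra.
by nra.
Qed.

Lemma sin_le_norm x : `|sin x| <= `|x|.
Proof.
have [c _] : exists2 c, c \in `[Num.min 0 x, Num.max 0 x]%R &
    sin (Num.max 0 x) - sin (Num.min 0 x) = cos c * (Num.max 0 x - Num.min 0 x).
  apply: (@MVT_segment _ sin cos); first by rewrite ge_min !le_max !lexx !orbT.
  by apply: continuous_subspaceT; exact: continuous_sin.
have hc := cos_max c.
rewrite /Num.max /Num.min; case: ltP => _ /=; rewrite sin0 ?(sub0r, subr0).
  by move=> ->; rewrite normrM ler_piMl.
by rewrite mulrN => /oppr_inj ->; rewrite normrM ler_piMl.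
Qed.

Lemma cos_sub1_le x : `|cos x - 1| <= x ^+ 2 / 2.
Proof.
have -> : cos x = 1 - 2 * sin (x / 2) ^+ 2.
  have {1}-> : x = (x / 2) *+ 2 by rewrite -[_ *+ 2]mulr_natr; field.
  by rewrite cos_mulr2n; have := cos2Dsin2 (x / 2); rewrite -mulr_natl; lra.
rewrite (_ : 1 - _ - 1 = - (2 * sin (x / 2) ^+ 2)); last by ring.
rewrite normrN ger0_norm; last by rewrite mulr_ge0// sqr_ge0.
have := sin_le_norm (x / 2); rewrite -ler_sqr ?nnegrE//.
rewrite !real_normK ?num_real// exprMn => h.
by apply: (@le_trans _ _ (2 * (x ^+ 2 * 2^-1 ^+ 2))); [lra|rewrite expr2; lra].
Qed.

Lemma sin_sub_le y : `|y| <= 2^-1 -> `|sin y - y| <= y ^+ 2 / 4.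
Proof.
move=> y2.
have [c hc] : exists2 c, c \in `[Num.min 0 y, Num.max 0 y]%R &
   (fun t => sin t - t) (Num.max 0 y) - (fun t => sin t - t) (Num.min 0 y) =
     (cos c - 1) * (Num.max 0 y - Num.min 0 y).
  apply: (@MVT_segment _ (fun t => sin t - t) (fun t => cos t - 1)).
  - by rewrite ge_min !le_max !lexx !orbT.
  - apply: continuous_subspaceT => t; apply: continuousB; last exact: cvg_id.
    exact: continuous_sin.
have h1 := cos_sub1_le c.
have h2 : `|c| <= `|y|.
  move: hc; rewrite in_itv /= ge_min le_max => /andP[].
  have [y0|y0] := leP 0 y; rewrite ?(ger0_norm y0) ?(ltr0_norm y0) ler_norml.
    move=> /orP[a|a] /orP[b|b]; apply/andP; split; lra.
  move=> /orP[a|a] /orP[b|b]; apply/andP; split; lra.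
have h3 : `|cos c - 1| * `|y| <= y ^+ 2 / 4.
  have c2 : c ^+ 2 <= y ^+ 2 by rewrite -(real_normK (num_real c)) -(real_normK (num_real y)) ler_sqr.
  have -> : y ^+ 2 = `|y| * `|y| by rewrite -expr2 real_normK// num_real.
  have A4 : `|cos c - 1| <= `|y| / 4.
    apply: (le_trans h1); move: c2; rewrite -(real_normK (num_real y)) => c2.
    have y0 := normr_ge0 y; nra.
  by rewrite mulrAC ler_wpM2r.
rewrite /Num.max /Num.min; case: ltP => _ /=; rewrite sin0 ?(sub0r, subr0) oppr0 ?addr0 ?sub0r.
  by rewrite subr0 => ->; rewrite normrM.
by rewrite mulrN => /oppr_inj ->; rewrite normrM.
Qed.

(** The real part of the remainder is at most 2 x^2 + y^2 and the imaginary part at most 2 x^2 + 2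
    y^2; the constant 5 leaves a margin. *)
Lemma cexp_taylor z : cabs z <= 2^-1 -> cabs (cexp z - 1 - z) <= 5 * cabs z ^+ 2.
Proof.
move=> z2; have x2 := le_trans (cabs_Re z) z2; have y2 := le_trans (cabs_Im z) z2.
rewrite cabs_sqr; apply: (le_trans (cabs_le_ReIm _)).
case: z z2 x2 y2 => x y /= z2 x2 y2.
rewrite /cexp /= !(mul0r, subr0, addr0, oppr0, mulr0).
have /andP[e1 e2] := expR_sub1_le x2.
have c1 := cos_sub1_le y; have s1 := sin_sub_le y2.
have e0 := expR_gt0 x.
have e4 : expR x <= 2 by move: x2; rewrite ler_norml => /andP[? ?]; nra.
have hA : `|expR x * cos y - 1 - x| <= 2 * x ^+ 2 + y ^+ 2.
  have -> : expR x * cos y - 1 - x = (expR x - 1 - x) + expR x * (cos y - 1) by ring.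
  apply: (le_trans (ler_normD _ _)); rewrite (ger0_norm e1) normrM (ger0_norm (ltW e0)).
  apply: lerD => //; have := sqr_ge0 y; have := normr_ge0 (cos y - 1); nra.
have hB : `|expR x * sin y - y| <= 2 * x ^+ 2 + 2 * y ^+ 2.
  have -> : expR x * sin y - y = expR x * (sin y - y) + (expR x - 1) * y by ring.
  apply: (le_trans (ler_normD _ _)); rewrite !normrM (ger0_norm (ltW e0)).
  have k1 : `|expR x - 1| <= 2 * `|x|.
    have : `|expR x - 1 - x| <= `|x|.
      rewrite ger0_norm//; apply: (le_trans e2).
      by rewrite -(real_normK (num_real x)); have := normr_ge0 x; nra.
    have := ler_normD (expR x - 1 - x) x; rewrite subrK; lra.
  have k2 : expR x * `|sin y - y| <= y ^+ 2 / 2.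
    have := normr_ge0 (sin y - y); have := sqr_ge0 y; nra.
  have k3 : `|expR x - 1| * `|y| <= 2 * (`|x| * `|y|).
    by rewrite mulrA ler_wpM2r.
  have : 2 * (`|x| * `|y|) <= x ^+ 2 + y ^+ 2.
    rewrite -(real_normK (num_real x)) -(real_normK (num_real y)).
    have := sqr_ge0 (`|x| - `|y|); rewrite sqrrB; lra.
  have := sqr_ge0 y; have := sqr_ge0 x; lra.
have := sqr_ge0 y; have := sqr_ge0 x; lra.
Qed.

End Taylor.

(** * One-dimensional Gaussian sums with a complex shift *)

Section Gauss1.
Variable R : realType.
Implicit Types (x y h S W : R) (z w u : R[i]).

Definition cgauss w : R[i] := cexp (- w ^+ 2).

Lemma cabs_cgauss_le w : cabs (cgauss w) <= expR (cabs w ^+ 2).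
Proof.
rewrite cabs_cexp ler_expR -cabsX -(cabsN (w ^+ 2)).
by rewrite (le_trans (ler_norm _))// cabs_Re.
Qed.

(** The quotient of the two Gaussians is exp v with v = -(2 w u + u^2). The smallness of [u] gives
    |v| <= 3 W |u| <= 1/2, so that [cexp_taylor] applies; 50 exceeds 5 * 9 + 1. *)
Lemma cgauss_taylor w u W : 1 <= W -> cabs w <= W -> 6 * W * cabs u <= 1 ->
  cabs (cgauss (w + u) - cgauss w + 2 * w * u * cgauss w) <=
  50 * W ^+ 2 * expR (W ^+ 2) * cabs u ^+ 2.
Proof.
move=> W1 wW u6; pose v := - (2 * w * u + u ^+ 2).
have u0 := cabs_ge0 u; have w0 := cabs_ge0 w.
have v3 : cabs v <= 3 * W * cabs u.
  rewrite cabsN (le_trans (ler_cabsD _ _))// cabsX !cabsM.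
  rewrite cabs_nat.
  nra.
have -> : cgauss (w + u) - cgauss w + 2 * w * u * cgauss w =
          cgauss w * ((cexp v - 1 - v) - u ^+ 2).
  have -> : cgauss (w + u) = cgauss w * cexp v.
    by rewrite -cexpD; congr cexp; rewrite /v; ring.
  by rewrite /v; ring.
rewrite cabsM.
have g1 : cabs (cgauss w) <= expR (W ^+ 2).
  by rewrite (le_trans (cabs_cgauss_le _))// ler_expR ler_sqr ?nnegrE//; lra.
have g0 := cabs_ge0 (cgauss w).
have h1 : cabs (cexp v - 1 - v - u ^+ 2) <= 50 * W ^+ 2 * cabs u ^+ 2.
  rewrite (le_trans (ler_cabsB _ _))// cabsX.
  have /cexp_taylor h : cabs v <= 2^-1 by lra.
  have v0 := cabs_ge0 v.
  have : cabs v ^+ 2 <= (3 * W * cabs u) ^+ 2 by rewrite ler_sqr ?nnegrE//; lra.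
  rewrite !exprMn => k.
  have : cabs u ^+ 2 <= W ^+ 2 * cabs u ^+ 2 by rewrite ler_peMl ?sqr_ge0// expr_ge1//; lra.
  have := sqr_ge0 (cabs u); have := mulr_ge0 (sqr_ge0 W) (sqr_ge0 (cabs u)); nra.
rewrite (le_trans (ler_pM g0 (cabs_ge0 _) g1 h1))//.
by rewrite le_eqVlt; apply/orP; left; apply/eqP; ring.
Qed.

Lemma cabs_cgauss_shift x w S : cabs w <= S -> S <= `|x| ->
  cabs (cgauss (x%:C + w)) <= expR (S ^+ 2 - (`|x| - S) ^+ 2).
Proof.
move=> wS Sx; rewrite cabs_cexp ler_expR.
have := cabs_Re w; have := cabs_Im w.
case: w wS => a b /= wS b1 a1.
rewrite expr2 /= ; rewrite add0r.
have bS : b ^+ 2 <= S ^+ 2.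
  have bS' := le_trans b1 wS.
  by rewrite -(real_normK (num_real b)) ler_sqr ?nnegrE// (le_trans _ bS').
have : (`|x| - S) ^+ 2 <= (x + a) ^+ 2.
  rewrite -(real_normK (num_real (x + a))) ler_sqr ?nnegrE ?subr_ge0//.
  have := lerB_normD x a; lra.
by rewrite -!expr2; lra.
Qed.

Lemma cgauss_grid_shift h N L w S H :
  0 < h -> (0 < L)%N -> cabs w <= S -> S <= h * N%:R -> h * N%:R <= H ->
  let W := H + S + 1 in 6 * W * h <= 1 -> 6 * W * S <= L%:R ->
  cabs (h%:C * \sum_(t <- grid h N) cgauss (t%:C + w) -
        h%:C * \sum_(t <- grid h N) cgauss t%:C) <=
  2 * S * expR (S ^+ 2 - (h * N%:R - S) ^+ 2) +
  2 * H * (50 * W ^+ 2 * expR (W ^+ 2)) * (S * h + S ^+ 2 / L%:R).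
Proof.
move=> h0 L0 wS SN NH W Wh WL; set K := 50 * W ^+ 2 * _; set E := expR _.
have S0 : 0 <= S := le_trans (cabs_ge0 w) wS.
have K0 : 0 <= K by rewrite /K; pos.
have Lr : 0 < L%:R :> R by rewrite ltr0n.
have LV : 0 <= L%:R^-1 :> R by rewrite invr_ge0.
pose x (l : nat) (j : nat) : R[i] := (h * (j%:R - N%:R))%:C + (l%:R / L%:R)%:C * w.
pose A l := \sum_(j < N + N) cgauss (x l j).
pose u : R[i] := (L%:R^-1)%:C * w.
have uS : cabs u <= S / L%:R.
  by rewrite cabsM cabs_real ger0_norm// [S / _]mulrC ler_wpM2l.
have lw (l : nat) : (l <= L)%N -> cabs ((l%:R / L%:R)%:C * w) <= S.
  move=> lL; rewrite cabsM cabs_real ger0_norm ?divr_ge0//.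
  rewrite -[leRHS]mul1r ler_pM ?divr_ge0 ?cabs_ge0//.
  by rewrite ler_pdivrMr// mul1r ler_nat.
have xW (l j : nat) : (l <= L)%N -> (j < N + N)%N -> cabs (x l j) <= W.
  move=> lL jN; rewrite (le_trans (ler_cabsD _ _))//.
  have : `|h * (j%:R - N%:R)| <= h * N%:R.
    apply: grid_bound; first exact: ltW.
    by apply/mapP; exists j => //; rewrite mem_iota.
  rewrite cabs_real; have := lw l lL; rewrite /W; lra.
have W1 : 1 <= W by rewrite /W; lra.
have step l : (l < L)%N -> cabs (h%:C * (A l.+1 - A l)) <=
    2 * (S / L%:R) * E + (N + N)%:R * (K * h * (S / L%:R) * (S / L%:R + h)).
  move=> lL.
  (* This is where holomorphy enters: the increment along [u] times [h] and the increment along [h]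
     times [u] have the same first-order term, so [e j] is of second order. The second increment
     telescopes over the grid. *)
  pose e j := h%:C * (cgauss (x l j + u) - cgauss (x l j)) -
              u * (cgauss (x l j + h%:C) - cgauss (x l j)).
  have -> : h%:C * (A l.+1 - A l) = u * (cgauss (x l (N + N)) - cgauss (x l 0)) +
             \sum_(j < N + N) e j.
    rewrite -sumrB -(@telescope_sumr _ 0 (N + N) (fun j => cgauss (x l j)))// big_mkord.
    rewrite !mulr_sumr -big_split; apply: eq_bigr => j _ /=; rewrite /e.
    have -> : x l.+1 j = x l j + u.
      by rewrite /x /u -addrA -mulrDl -rmorphD /= -natr1 mulrDl mul1r.
    have -> : x l j.+1 = x l j + h%:C.
      by rewrite /x addrAC -rmorphD /= -natr1; congr (_%:C + _); ring.
    by ring.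
  rewrite (le_trans (ler_cabsD _ _))// lerD//.
    rewrite cabsM.
    have hE s : `|s| = h * N%:R -> cabs (cgauss (s%:C + (l%:R / L%:R)%:C * w)) <= E.
      by move=> sN; rewrite /E -sN; apply: cabs_cgauss_shift; rewrite ?lw 1?ltnW// sN.
    have hN0 : 0 <= h * N%:R by rewrite mulr_ge0// ltW.
    have e1 : cabs (cgauss (x l (N + N))) <= E.
      by apply: hE; rewrite natrD addrK ger0_norm.
    have e2 : cabs (cgauss (x l 0)) <= E.
      by apply: hE; rewrite sub0r mulrN normrN ger0_norm.
    have := ler_cabsB (cgauss (x l (N + N))) (cgauss (x l 0)) => e3.
    rewrite [2 * _]mulrC -mulrA ler_pM ?cabs_ge0//; lra.
  rewrite (le_trans (ler_cabs_sum _ _ _))//.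
  rewrite -[X in X%:R * _]card_ord mulr_natl -sumr_const; apply: ler_sum => j _.
  have xj := xW l j (ltnW lL) (ltn_ord j).
  have t1 : cabs (cgauss (x l j + u) - cgauss (x l j) + 2 * x l j * u * cgauss (x l j)) <=
            K * (S / L%:R) ^+ 2.
    apply: le_trans (cgauss_taylor W1 xj _) _.
      rewrite (le_trans (ler_wpM2l _ uS))//; first lra.
      by rewrite mulrA ler_pdivrMr// mul1r.
    by rewrite ler_wpM2l// ler_sqr ?nnegrE ?cabs_ge0// divr_ge0// ltW.
  have hC : cabs h%:C = h by rewrite cabs_real gtr0_norm.
  have t2 : cabs (cgauss (x l j + h%:C) - cgauss (x l j) + 2 * x l j * h%:C * cgauss (x l j)) <=
            K * h ^+ 2.
    by apply: le_trans (cgauss_taylor W1 xj _) _; rewrite hC.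
  have -> : e j = h%:C * (cgauss (x l j + u) - cgauss (x l j) + 2 * x l j * u * cgauss (x l j)) -
      u * (cgauss (x l j + h%:C) - cgauss (x l j) + 2 * x l j * h%:C * cgauss (x l j)).
    by rewrite /e; ring.
  rewrite (le_trans (ler_cabsB _ _))// !cabsM hC.
  rewrite (_ : K * _ * _ * _ = h * (K * (S / L%:R) ^+ 2) + (S / L%:R) * (K * h ^+ 2)).
    by rewrite -(cabsM _ w); apply: lerD; [rewrite ler_pM2l | rewrite ler_pM ?cabs_ge0].
  by ring.
have -> : h%:C * \sum_(t <- grid h N) cgauss (t%:C + w) -
          h%:C * \sum_(t <- grid h N) cgauss t%:C = \sum_(l < L) h%:C * (A l.+1 - A l).
  rewrite -mulr_sumr -(big_mkord xpredT (fun l => A l.+1 - A l)) telescope_sumr// -mulrBr.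
  congr (_ * (_ - _)); rewrite sum_grid; apply: eq_bigr => j _; rewrite /x.
    by rewrite divff ?mul1r// gt_eqF.
  by rewrite mul0r mul0r addr0.
rewrite (le_trans (ler_cabs_sum _ _ _))//.
apply: (@le_trans _ _ (\sum_(l < L) (2 * (S / L%:R) * E +
   (N + N)%:R * (K * h * (S / L%:R) * (S / L%:R + h))))).
  by apply: ler_sum => l _; exact: step.
rewrite sumr_const card_ord -[_ *+ L]mulr_natl [leLHS]mulrDr lerD//.
  rewrite le_eqVlt; apply/orP; left; apply/eqP; field; exact: lt0r_neq0.
have -> : L%:R * ((N + N)%:R * (K * h * (S / L%:R) * (S / L%:R + h))) =
  2 * (h * N%:R) * K * (S * h + S ^+ 2 / L%:R).
  by rewrite natrD; field; exact: lt0r_neq0.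
rewrite ler_wpM2r//; first by rewrite addr_ge0// ?divr_ge0 ?sqr_ge0// mulr_ge0// ltW.
rewrite ler_wpM2r//.
by rewrite ler_pM2l.
Qed.

Lemma gauss_fun_integral_step h n : 0 < h ->
  h * gauss_fun (h * n.+1%:R) <=
  gauss_integral_proof.integral0_gauss (h * n.+1%:R) -
    gauss_integral_proof.integral0_gauss (h * n%:R) <=
  h * gauss_fun (h * n%:R).
Proof.
move=> h0; rewrite /gauss_integral_proof.integral0_gauss.
have hn0 : 0 <= h * n%:R by rewrite mulr_ge0// ltW.
have hnn : h * n%:R <= h * n.+1%:R by rewrite ler_pM2l// ler_nat.
have gi a b : (@lebesgue_measure R).-integrable `[a, b] (EFin \o gauss_fun).
  apply: continuous_compact_integrable; first exact: segment_compact.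
  by apply: continuous_subspaceT; exact: continuous_gauss_fun.
rewrite Rintegral_itvB//.
have mo : (@lebesgue_measure R) `]h * n%:R, h * n.+1%:R] = h%:E.
  rewrite lebesgue_measure_itv /= lte_fin ltr_pM2l// ltr_nat leqnn.
  by rewrite -EFinB -mulrBr -natr1 addrAC subrr add0r mulr1.
have cE c : c * h = (\int[@lebesgue_measure R]_(x in `]h * n%:R, h * n.+1%:R]) c)%R.
  by rewrite Rintegral_cst//; congr (_ * _); rewrite [LHS](_ : h = fine h%:E)//; congr fine; rewrite -mo.
have gi' : (@lebesgue_measure R).-integrable `]h * n%:R, h * n.+1%:R] (EFin \o gauss_fun).
  apply: integrableS (gi (h * n%:R) (h * n.+1%:R)) => //.
  by move=> x /=; rewrite !in_itv /= => /andP[/ltW -> ->].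
have ci c : (@lebesgue_measure R).-integrable `]h * n%:R, h * n.+1%:R] (EFin \o cst c).
  have cc a b : (@lebesgue_measure R).-integrable `[a, b] (EFin \o cst c).
    apply: continuous_compact_integrable; first exact: segment_compact.
    by apply: continuous_subspaceT => ?; exact: cvg_cst.
  apply: integrableS (cc (h * n%:R) (h * n.+1%:R)) => //.
  by move=> x /=; rewrite !in_itv /= => /andP[/ltW -> ->].
rewrite ![h * gauss_fun _]mulrC; apply/andP; split; rewrite cE; apply: le_Rintegral => //.
- exact: ci.
- move=> x /=; rewrite in_itv/= => /andP[x1 x2].
  by rewrite ler_expR lerN2 ler_sqr ?nnegrE// (le_trans hn0)// ltW.
- exact: ci.
- move=> x /=; rewrite in_itv/= => /andP[x1 x2].
by rewrite ler_expR lerN2 ler_sqr ?nnegrE// (ltW x1, le_trans hn0 (ltW x1)).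
Qed.

(** The negative half of the grid is a lower sum and the nonnegative half an upper sum for the
    integral over a half-line. They differ by at most [h] times the value 1 at the origin, which is
    the [h] in the error. *)
Lemma gauss_fun_grid eps : 0 < eps -> exists2 H0, 0 < H0 &
  forall h N, 0 < h -> H0 <= h * N%:R ->
  `|h * \sum_(t <- grid h N) gauss_fun t - Num.sqrt pi| <= eps + h.
Proof.
move=> eps0; pose I := @gauss_integral_proof.integral0_gauss R.
have I_ge0 x : 0 <= I x by exact: gauss_integral_proof.integral0_gauss_ge0.
have cI : I x @[x --> +oo] --> Num.sqrt pi / 2.
  have : Num.sqrt (I x ^+ 2) @[x --> +oo] --> Num.sqrt (pi / 4).
    apply: continuous_cvg; first exact: sqrt_continuous.
    exact: gauss_integral_proof.cvg_integral0_gauss_sqr.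
  rewrite sqrtrM ?pi_ge0// (_ : 4^-1 = 2^-1 ^+ 2); last by field.
  rewrite sqrtr_sqr ger0_norm//.
  by under eq_fun do rewrite sqrtr_sqr ger0_norm//.
have e2 : 0 < eps / 2 by rewrite divr_gt0.
have [M [_ hM]] := (cvgrPdist_le _ _).1 cI _ e2.
exists (`|M| + 1) => [|h N h0 HN]; first by rewrite ltr_wpDl.
have N0 : (0 < N)%N.
  rewrite lt0n; apply/eqP => N0; move: HN; rewrite N0 mulr0.
  by have := normr_ge0 M; lra.
have hI : `|Num.sqrt pi / 2 - I (h * N%:R)| <= eps / 2.
  by apply: hM; have := ler_norm M; lra.
have lo n : h * \sum_(j < n) gauss_fun (h * j.+1%:R) <= I (h * n%:R).
  elim: n => [|n IH]; first by rewrite big_ord0 mulr0.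
  rewrite big_ord_recr mulrDr /=.
  by have /andP[] := gauss_fun_integral_step n h0; rewrite -/I; lra.
have I0 : I 0 = 0 by rewrite /I /gauss_integral_proof.integral0_gauss set_itv1 Rintegral_set1.
have up n : I (h * n%:R) <= h * \sum_(j < n) gauss_fun (h * j%:R).
  elim: n => [|n IH]; first by rewrite big_ord0 mulr0 I0.
  rewrite big_ord_recr mulrDr /=.
  by have /andP[] := gauss_fun_integral_step n h0; rewrite -/I; lra.
have S1 := up N; have S2 := lo N.
have -> : \sum_(t <- grid h N) gauss_fun t =
  \sum_(j < N) gauss_fun (h * j.+1%:R) + \sum_(j < N) gauss_fun (h * j%:R).
  rewrite sum_grid big_split_ord /=; congr (_ + _).
    rewrite (reindex_inj rev_ord_inj) /=; apply: eq_bigr => j _.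
    by rewrite natrB// /gauss_fun; congr expR; ring.
  by apply: eq_bigr => j _; rewrite natrD addrAC subrr add0r.
have S3 : \sum_(j < N) gauss_fun (h * j%:R) <= 1 + \sum_(j < N) gauss_fun (h * j.+1%:R).
  case: N N0 {HN hI S1 S2} => // n _.
  rewrite big_ord_recl mulr0 big_ord_recr /=.
  by have := gauss_fun_ge0 (h * n.+1%:R); rewrite {2}/gauss_fun expr0n oppr0 expR0; lra.
have S4 : h * \sum_(j < N) gauss_fun (h * j%:R) <= h + h * \sum_(j < N) gauss_fun (h * j.+1%:R).
  by move: S3; rewrite -(ler_pM2l h0) mulrDr mulr1.
move: hI; rewrite !ler_norml => /andP[i1 i2]; rewrite mulrDr; apply/andP; split; lra.
Qed.

(** The order of the quantifiers matters. A large half-width [H0] kills the end terms of the contour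
    shift; the Taylor constant then grows like exp (W^2) with the width, so the mesh [h0] can be
    chosen only once an upper bound [H1] on the half-width is known. *)
Lemma cgauss_grid eps S : 0 < eps -> 0 <= S -> exists2 H0, 0 < H0 &
  forall H1, exists2 h0, 0 < h0 &
  forall h N, 0 < h -> h < h0 -> H0 <= h * N%:R -> h * N%:R <= H1 ->
  forall w, cabs w <= S ->
  cabs (h%:C * \sum_(t <- grid h N) cgauss (t%:C + w) - (Num.sqrt pi)%:C) <= eps.
Proof.
move=> eps0 S0; have e4 : 0 < eps / 4 by rewrite divr_gt0.
have [M M0 hM] := gauss_fun_grid e4.
(* With the distance of the ends from the shift at least [y], exp (- y^2) <= 1 / y makes the end
   terms at most eps / 4. *)
pose y := 1 + expR (S ^+ 2) * (8 * S) / eps.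
have y1 : 1 <= y by rewrite lerDl; pos.
exists (M + S + y) => [|H1]; first lra.
pose H : R := `|H1| + 1; pose W : R := H + S + 1; pose K : R := 50 * W ^+ 2 * expR (W ^+ 2).
have H0 : 0 < H by rewrite /H ltr_wpDl.
have W0 : 0 < W by rewrite /W; lra.
have K0 : 0 <= K by rewrite /K; pos.
pose D : R := 2 * H * K * (S + S ^+ 2) + 1.
have D1 : 1 <= D by rewrite lerDr; pos.
exists (Num.min (6 * W)^-1 (eps / 4 / D)).
  by rewrite lt_min; apply/andP; split; pos.
move=> h N h0; rewrite lt_min => /andP[h1 h2] HN NH w wS.
(* At least 1 / h steps, so that S / L is of the order of the mesh, and at least 6 W S steps, so
   that each step is small enough for the Taylor bound. *)
pose L := (Num.truncn (h^-1 + 6 * W * S)).+1.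
have hL : h^-1 + 6 * W * S < L%:R by rewrite /L truncnS_gt.
have hV : 0 < h^-1 by rewrite invr_gt0.
have WS : 0 <= 6 * W * S by pos.
have Lr : 0 < L%:R :> R by lra.
have NH' : h * N%:R <= H by rewrite /H; have := ler_norm H1; lra.
have Wh : 6 * W * h <= 1.
  by rewrite mulrC -ler_pdivlMr ?mulr_gt0// div1r ltW.
have key := @cgauss_grid_shift h N L w S H h0 (ltn0Sn _) wS _ NH' Wh _.
have {}key := key ltac:(lra) ltac:(rewrite -/W; lra).
have real : cabs (h%:C * \sum_(t <- grid h N) cgauss t%:C - (Num.sqrt pi)%:C) <= eps / 4 + h.
  rewrite (eq_bigr (fun t => (gauss_fun t)%:C)); last first.
    by move=> t _; rewrite /cgauss -rmorphXn -rmorphN /= cexp_real.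
  rewrite -rmorph_sum -rmorphM -rmorphB /= cabs_real; apply: hM => //; lra.
have hD : h <= eps / 4 / D by exact: ltW.
have hD' : h * D <= eps / 4 by rewrite -ler_pdivlMr//; lra.
have LV : L%:R^-1 <= h by rewrite invf_ple ?posrE//; lra.
have B2 : 2 * H * K * (S * h + S ^+ 2 / L%:R) <= h * D - h.
  have -> : h * D - h = 2 * H * K * (S * h + S ^+ 2 * h) by rewrite /D; ring.
  rewrite ler_wpM2l//; first by pos.
  by rewrite lerD2l ler_wpM2l ?sqr_ge0.
have B1 : 2 * S * expR (S ^+ 2 - (h * N%:R - S) ^+ 2) <= eps / 4.
  have yy : y <= (h * N%:R - S) ^+ 2.
    rewrite expr2 (le_trans (_ : y <= y * y))//; first by rewrite ler_peMr//; lra.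
    by apply: ler_pM; lra.
  apply: (@le_trans _ _ (2 * S * (expR (S ^+ 2) / y))).
    rewrite ler_wpM2l//; first by rewrite mulr_ge0.
    rewrite expRB ler_wpM2l ?expR_ge0// lef_pV2 ?posrE ?expR_gt0//; last lra.
    by have := expR_ge1Dx ((h * N%:R - S) ^+ 2); lra.
  rewrite mulrA ler_pdivrMr; last lra.
  rewrite /y mulrDr mulr1.
  have -> : eps / 4 * (expR (S ^+ 2) * (8 * S) / eps) = 2 * S * expR (S ^+ 2).
    by field; exact: lt0r_neq0.
  lra.
rewrite (le_trans (ler_cabs_dist _ (h%:C * \sum_(t <- grid h N) cgauss t%:C) _))//.
move: key; rewrite -/W -/K; lra.
Qed.

End Gauss1.

(** * Uniform bounds on exponential sums *)

Section ExpSum.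
Variable R : realType.
Implicit Types (h c k l : R).

Lemma mul_divD1_le (x e : R) : 0 <= x -> 0 <= e -> x * (e / (4 * (x + 1))) <= e / 4.
Proof.
move=> x0 e0; rewrite mulrA ler_pdivrMr; last lra.
have -> : e / 4 * (4 * (x + 1)) = e * (x + 1) by field.
nra.
Qed.

Lemma expRN_sub1_ge (x : R) : 0 <= x -> x * expR (- x) <= 1 - expR (- x).
Proof.
move=> x0; rewrite lerBrDr -[X in _ + X]mul1r -mulrDl expRN ler_pdivrMr ?expR_gt0//.
by rewrite mul1r addrC expR_ge1Dx.
Qed.

(** The function [G] is a primitive of k exp (- k |u|) with values in [-1, 1], so its increments
    along the grid telescope to at most 2, whatever the offset [c] and the length [n]. The factor
    exp k pays for the variation of the integrand over a step [h <= 1]. *)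
Lemma sum_expRN_le k h c n : 0 < k -> 0 < h -> h <= 1 ->
  h * \sum_(j < n) expR (- (k * `|h * j%:R + c|)) <= 2 * expR k / k.
Proof.
move=> k0 h0 h1.
pose G (u : R) := if 0 <= u then 1 - expR (- (k * u)) else expR (k * u) - 1.
have GB u : -1 <= G u <= 1.
  rewrite /G; case: ifP => u0.
    have := expR_gt0 (- (k * u)).
    have : expR (- (k * u)) <= 1 by rewrite expR_le1 oppr_le0; pos.
    by lra.
  have := expR_gt0 (k * u).
  have : expR (k * u) <= 1.
    by rewrite expR_le1 pmulr_rle0//; move/negbT: u0; rewrite -ltNge => /ltW.
  by lra.
have step u : k * h * expR (- k) * expR (- (k * `|u|)) <= G (u + h) - G u.
  have kh : expR (- k) <= expR (- (k * h)) by rewrite ler_expR lerN2; nra.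
  have e0 := expR_gt0 (- k); have eu := expR_gt0 (- (k * `|u|)).
  have kh0 : 0 < k * h by pos.
  rewrite /G; case: (leP 0 u) => u0.
    rewrite (_ : 0 <= u + h); last lra.
    rewrite ger0_norm// (_ : expR (- (k * (u + h))) = expR (- (k * u)) * expR (- (k * h))); last first.
      by rewrite -expRD; congr expR; ring.
    have := expRN_sub1_ge (ltW kh0); have := expR_gt0 (- (k * u)) => q.
    have : k * h * expR (- k) <= k * h * expR (- (k * h)) by rewrite ler_pM2l.
    nra.
  rewrite ltr0_norm//.
  have -> : - (k * - u) = k * u by ring.
  have eu0 := expR_gt0 (k * u).
  have eu1 : expR (k * u) <= 1 by rewrite expR_le1 pmulr_rle0// ltW.
  have e1 : expR (- k) <= 1 by rewrite expR_le1; lra.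
  case: (leP 0 (u + h)) => uh.
    have a1 := expRN_sub1_ge (mulr_ge0 (ltW k0) uh).
    have ku : 0 <= k * - u by rewrite mulr_ge0//; lra.
    have a2 := expRN_sub1_ge ku; rewrite mulrN opprK in a2.
    have b1 : expR (- k) <= expR (- (k * (u + h))) by rewrite ler_expR lerN2; nra.
    have b2 : expR (- k) <= expR (k * u) by rewrite ler_expR; nra.
    have c1 : k * (u + h) * expR (- k) <= k * (u + h) * expR (- (k * (u + h))).
      by rewrite ler_wpM2l//; pos.
    have c2 : k * - u * expR (- k) <= k * - u * expR (k * u) by rewrite ler_wpM2l.
    have : k * h * expR (- k) * expR (k * u) <= k * h * expR (- k).
      by rewrite ler_piMr//; pos.
    lra.
  rewrite (_ : expR (k * (u + h)) = expR (k * u) * expR (k * h)); last first.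
    by rewrite -expRD; congr expR; ring.
  have := expR_ge1Dx (k * h).
  have : k * h * expR (- k) <= k * h by rewrite ler_piMr//; pos.
  nra.
have tele : \sum_(j < n) (G (h * j%:R + c + h) - G (h * j%:R + c)) <= 2.
  rewrite (eq_bigr (fun j : 'I_n => G (h * j.+1%:R + c) - G (h * j%:R + c))); last first.
    by move=> j _; congr (G _ - _); rewrite -natr1; ring.
  rewrite -(big_mkord xpredT (fun j => G (h * j.+1%:R + c) - G (h * j%:R + c))).
  rewrite (telescope_sumr (fun j => G (h * j%:R + c)))//.
  by have := GB (h * n%:R + c); have := GB (h * 0%:R + c); lra.
have : \sum_(j < n) (k * h * expR (- k) * expR (- (k * `|h * j%:R + c|))) <= 2.
  by apply: le_trans tele; apply: ler_sum => j _; exact: step.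
rewrite -mulr_sumr => t2.
rewrite ler_pdivlMr// -ler_pdivrMr ?expR_gt0// -expRN.
by apply: le_trans t2; rewrite le_eqVlt; apply/orP; left; apply/eqP; ring.
Qed.

(** Completing the square gives - l x^2 <= 1 / (4 l) - |x|, which reduces a Gaussian sum to
    [sum_expRN_le] with rate 1. *)
Definition gauss_bound l : R := 2 * expR 1 * expR (4 * l)^-1.

Lemma sum_grid_gauss_le l h N c : 0 < l -> 0 < h -> h <= 1 ->
  h * \sum_(t <- grid h N) expR (- (l * (t + c) ^+ 2)) <= gauss_bound l.
Proof.
move=> l0 h0 h1; rewrite sum_grid.
have := @sum_expRN_le 1 h (c - h * N%:R) (N + N) ltr01 h0 h1; rewrite divr1 => B.
rewrite /gauss_bound [leRHS]mulrC; apply: le_trans (ler_wpM2l (expR_ge0 (4 * l)^-1) B).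
rewrite mulrCA ler_pM2l// mulr_sumr; apply: ler_sum => j _; rewrite -expRD ler_expR.
rewrite (_ : h * (j%:R - N%:R) + c = h * j%:R + (c - h * N%:R)); last by ring.
set u := _ + _; rewrite -(real_normK (num_real u)) mul1r.
set x := `|u|.
have := sqr_ge0 (2 * l * x - 1); rewrite sqrrB expr1n mulr1.
have -> : (4 * l)^-1 - x = (1 - 4 * l * x) / (4 * l).
  by field; exact: lt0r_neq0.
rewrite ler_pdivlMr; last by pos.
by nra.
Qed.

End ExpSum.

(** * Schur complements of quadratic forms *)

Section QuadraticForms.

Lemma col_mx_surj (K : pzSemiRingType) d (u : 'cV[K]_d.+1) :
  exists t (u' : 'cV[K]_d), u = col_mx t%:M u'.
Proof.
exists (u 0 0), (dsubmx (u : 'cV[K]_(1 + d))).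
have -> : (u 0 0)%:M = usubmx (u : 'cV[K]_(1 + d)).
  by rewrite [RHS]mx11_scalar; congr (_%:M); rewrite mxE; congr (u _ _); exact/val_inj.
by rewrite vsubmxK.
Qed.

Definition qform (K : comPzRingType) d (G : 'M[K]_d) (z : 'cV[K]_d) : K :=
  (z^T *m G *m z) 0 0.

Lemma qform0 (K : comPzRingType) d (G : 'M[K]_d) : qform G 0 = 0.
Proof. by rewrite /qform mulmx0 mxE. Qed.

(** Completing the square in [u]. The vector [v] replaces the inverse of [G] applied to [b], so that
    no invertibility is involved and the identity holds over R and over R[i] alike. *)
Lemma qform_block (K : comNzRingType) d (g : K) (b v : 'cV[K]_d) (G : 'M[K]_d)
    (t : K) (u : 'cV[K]_d) : G^T = G -> G *m v = b ->
  qform (block_mx g%:M (b^T) b G : 'M[K]_d.+1) (col_mx t%:M u : 'cV_d.+1) =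
  (g - (b^T *m v) 0 0) * t ^+ 2 + qform G (u + t *: v).
Proof.
move=> GT Gv; rewrite /qform.
have -> : (col_mx t%:M u)^T *m block_mx g%:M (b^T) b G *m col_mx t%:M u =
    (t * g * t)%:M + t *: (u^T *m b) + t *: (b^T *m u) + u^T *m G *m u.
  rewrite tr_col_mx mul_row_block mul_row_col !mulmxDl tr_scalar_mx.
  rewrite !mul_scalar_mx !mul_mx_scalar !scale_scalar_mx -!scalemxAl.
  rewrite -!addrA; congr (_ + (_ + (_ + _))).
  by congr (_%:M); ring.
have bT : b^T = v^T *m G by rewrite -Gv trmx_mul GT.
have -> : (u + t *: v)^T *m G *m (u + t *: v) =
    u^T *m G *m u + t *: (u^T *m b) + t *: (b^T *m u) + (t ^+ 2) *: (b^T *m v).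
  have -> : (u + t *: v)^T = u^T + t *: v^T by apply/matrixP => i j; rewrite !mxE.
  rewrite !mulmxDl !mulmxDr -!scalemxAl -!scalemxAr.
  rewrite -bT -(mulmxA u^T G v) Gv scalerA -expr2 !addrA.
  by rewrite -!addrA; congr (_ + _); congr (_ + _); rewrite addrC.
rewrite !mxE eqxx mulr1n; ring.
Qed.

(** Right multiplication by the unipotent block matrix with lower left block [- v] clears the block
    [b] and leaves an upper triangular matrix. *)
Lemma det_block_schur (K : comNzRingType) d (g : K) (b v : 'cV[K]_d) (G : 'M[K]_d) :
  G *m v = b ->
  \det (block_mx g%:M (b^T) b G : 'M[K]_(1 + d)) = (g - (b^T *m v) 0 0) * \det G.
Proof.
move=> Gv.
have := congr1 (fun A => \det A) (erefl (block_mx g%:M (b^T) b G *m block_mx 1%:M 0 (- v) 1%:M)).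
rewrite {2}mulmx_block !mulmx1 !mulmx0 !add0r !mulmxN Gv subrr det_mulmx det_lblock !det1 !mulr1.
by rewrite det_ublock det_mx11 !mxE eqxx mulr1n.
Qed.

End QuadraticForms.

(** * Gaussian sums in dimension d *)

Section GaussD.
Variable R : realType.

Definition spd d (G : 'M[R]_d) : Prop :=
  G^T = G /\ forall v : 'cV[R]_d, v != 0 -> 0 < qform G v.

Lemma spd_unit d (G : 'M[R]_d) : spd G -> G \in unitmx.
Proof.
move=> [GT Gp]; rewrite -unitmx_tr -row_free_unit -kermx_eq0; apply/eqP/row_matrixP => i.
rewrite row0; apply/eqP/negPn/negP => r0.
have v0 : (row i (kermx G^T))^T != 0 by rewrite -(inj_eq trmx_inj) trmxK trmx0.
have := Gp _ v0; rewrite /qform trmxK.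
have : row i (kermx G^T) *m G = 0 by rewrite -{2}GT -row_mul mulmx_ker row0.
by move=> ->; rewrite mul0mx mxE ltxx.
Qed.

(** Every positive definite matrix is obtained by adjoining one coordinate at a time with a positive
    Schur complement [s]; the corner entry is written so that [s] appears explicitly. This lets the
    Gaussian estimates be proved one variable at a time. *)
Lemma spd_ind (P : forall d, 'M[R]_d -> Prop) :
  (forall G : 'M[R]_0, P 0%N G) ->
  (forall d (s : R) (b v : 'cV[R]_d) (G : 'M[R]_d),
    spd G -> P d G -> 0 < s -> G *m v = b ->
    P d.+1 (block_mx (s + (b^T *m v) 0 0)%:M (b^T) b G : 'M[R]_d.+1)) ->
  forall d (G : 'M[R]_d), spd G -> P d G.
Proof.
move=> P0 PS; elim => [G _|d IH G [GT Gp]]; first exact: P0.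
pose G' : 'M[R]_d := drsubmx (G : 'M[R]_(1 + d)).
pose b : 'cV[R]_d := dlsubmx (G : 'M[R]_(1 + d)).
pose g : R := ulsubmx (G : 'M[R]_(1 + d)) 0 0.
have GE : G = block_mx g%:M b^T b G' :> 'M[R]_(1 + d).
  rewrite -[LHS](@submxK _ 1 d 1 d); congr block_mx.
    by rewrite [LHS]mx11_scalar.
  by rewrite /b trmx_dlsub GT.
have G'T : G'^T = G' by rewrite /G' trmx_drsub GT.
have G'p : spd G'.
  split=> // v v0.
  have := Gp (col_mx 0 v : 'cV[R]_(1 + d)).
  have -> : (col_mx 0 v : 'cV[R]_(1 + d)) != 0.
    by apply: contra v0 => /eqP/colP h; apply/eqP/colP => i; have := h (rshift 1 i);
       rewrite col_mxEd !mxE.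
  move=> /(_ isT); rewrite GE /qform.
  have -> : (col_mx 0 v)^T *m block_mx g%:M b^T b G' *m col_mx 0 v = v^T *m G' *m v.
    by rewrite tr_col_mx mul_row_block mul_row_col trmx0 !mul0mx mulmx0 !add0r.
  by [].
pose v := invmx G' *m b.
have Gv : G' *m v = b by rewrite mulKVmx// spd_unit.
pose s := g - (b^T *m v) 0 0.
have s0 : 0 < s.
  (* At (1, - v) the completed square vanishes and the form takes the value [s]. *)
  have := Gp (col_mx 1%:M (- v) : 'cV[R]_(1 + d)).
  have -> : (col_mx 1%:M (- v) : 'cV[R]_(1 + d)) != 0.
    apply/eqP => /colP /(_ (lshift d 0)); rewrite col_mxEu !mxE /=.
    by move/eqP; rewrite oner_eq0.
  move=> /(_ isT); rewrite GE.
  rewrite (@qform_block _ _ g b v G' 1 (- v) G'T Gv).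
  by rewrite scale1r addNr qform0 expr1n mulr1 addr0.
have -> : G = (block_mx (s + (b^T *m v) 0 0)%:M (b^T) b G' : 'M[R]_d.+1).
  by rewrite /s subrK.
by apply: PS => //; exact: IH.
Qed.

Lemma spd_det_gt0 d (G : 'M[R]_d) : spd G -> 0 < \det G.
Proof.
elim/spd_ind : G / => [G|n s b v G _ IH s0 Gv]; first by rewrite det_mx00.
by rewrite (det_block_schur _ Gv) addrK mulr_gt0.
Qed.

Definition sqnorm d (u : 'cV[R]_d) : R := \sum_i u i 0 ^+ 2.

Lemma sqnorm_ge0 d (u : 'cV[R]_d) : 0 <= sqnorm u.
Proof. by apply: sumr_ge0 => i _; exact: sqr_ge0. Qed.

Lemma sqnorm_col_mx d t (u : 'cV[R]_d) :
  sqnorm (col_mx t%:M u : 'cV[R]_d.+1) = t ^+ 2 + sqnorm u.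
Proof.
rewrite /sqnorm (@big_split_ord _ _ _ 1 d) /= big_ord1 (@col_mxEu _ 1 d 1) mxE eqxx mulr1n.
by congr (_ + _); apply: eq_bigr => i _; rewrite (@col_mxEd _ 1 d 1).
Qed.

(** The form controls [t] and u' + t v. Since |u'|^2 <= 2 |u' + t v|^2 + 2 t^2 |v|^2, it also
    controls u'; the two entries of the minimum balance these terms. *)
Lemma spd_lower d (G : 'M[R]_d) : spd G ->
  exists2 l, 0 < l & forall u, l * sqnorm u <= qform G u.
Proof.
elim/spd_ind : G / => [G|n s b v G [GT _] [l l0 IH] s0 Gv].
  by exists 1 => // u; rewrite (flatmx0 u) qform0 /sqnorm big_ord0 mulr0.
pose V := sqnorm v; have V0 : 0 <= V := sqnorm_ge0 v.
exists (Num.min (l / 2) (s / (1 + 2 * V))).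
  by rewrite lt_min; apply/andP; split; pos.
set k := Num.min _ _.
have kl : 2 * k <= l by have : k <= l / 2 by [rewrite ge_min lexx]; lra.
have ks : k * (1 + 2 * V) <= s.
  by rewrite -ler_pdivlMr; [rewrite ge_min lexx orbT | lra].
have k0 : 0 <= k by rewrite le_min; apply/andP; split; pos.
move=> u; have [t [u' ->]] := col_mx_surj u.
rewrite (qform_block _ _ _ GT Gv) addrK sqnorm_col_mx.
have h1 := IH (u' + t *: v).
have h2 : sqnorm u' <= 2 * sqnorm (u' + t *: v) + 2 * t ^+ 2 * V.
  rewrite /V /sqnorm !mulr_sumr -big_split; apply: ler_sum => i _ /=; rewrite !mxE.
  have := sqr_ge0 (u' i 0 + 2 * (t * v i 0)); move: (u' i 0) (v i 0) => x y; nra.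
have := sqnorm_ge0 (u' + t *: v); have := sqr_ge0 t; nra.
Qed.

(** Extended bilinearly, without conjugation: a polynomial in [z], hence suited to contour
    shifts. *)
Definition cqform d (G : 'M[R]_d) (z : 'cV[R[i]]_d) : R[i] :=
  qform (map_mx (real_complex R) G) z.

Definition gaussker d (G : 'M[R]_d) (z : 'cV[R[i]]_d) : R[i] :=
  cexp (- (2^-1 * cqform G z)).

Lemma cqform_block d (s : R) (b v : 'cV[R]_d) (G : 'M[R]_d) (t : R[i]) (u : 'cV[R[i]]_d) :
  G^T = G -> G *m v = b ->
  cqform (block_mx (s + (b^T *m v) 0 0)%:M (b^T) b G : 'M[R]_d.+1) (col_mx t%:M u : 'cV_d.+1)
  = s%:C * t ^+ 2 + cqform G (u + t *: rvec v).
Proof.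
move=> GT Gv; rewrite /cqform (_ : map_mx _ (_ : 'M[R]_d.+1) =
  block_mx (s + (b^T *m v) 0 0)%:C%:M (rvec b)^T (rvec b) (map_mx (real_complex R) G)); last first.
  by rewrite (@map_block_mx _ _ _ 1 d 1 d) map_scalar_mx map_trmx.
rewrite (@qform_block _ d _ (rvec b) (rvec v)); first 1 last.
- by rewrite map_trmx GT.
- by rewrite -map_mxM Gv.
congr (_ * _ + _).
have -> : ((rvec b)^T *m rvec v) 0 0 = ((b^T *m v) 0 0)%:C.
  by rewrite !mxE rmorph_sum; apply: eq_bigr => j _; rewrite !mxE rmorphM.
by rewrite rmorphD addrK.
Qed.

(** The integral over R^d of exp (- u^T G u / 2). *)
Definition gauss_const d (G : 'M[R]_d) : R :=
  Num.sqrt (2 * pi) ^+ d / Num.sqrt (\det G).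

Lemma gauss_const_block d (s : R) (b v : 'cV[R]_d) (G : 'M[R]_d) :
  0 < s -> G *m v = b ->
  gauss_const (block_mx (s + (b^T *m v) 0 0)%:M (b^T) b G : 'M[R]_d.+1) =
  Num.sqrt (2 * pi) / Num.sqrt s * gauss_const G.
Proof.
move=> s0 Gv; rewrite /gauss_const (det_block_schur _ Gv) addrK (sqrtrM (\det G) (ltW s0)).
by rewrite exprS invfM; ring.
Qed.

Lemma rvec_col_mx d t (u : 'cV[R]_d) (c : R[i]) (w : 'cV[R[i]]_d) :
  (rvec (col_mx t%:M u : 'cV[R]_d.+1) + (col_mx c%:M w : 'cV_d.+1)) =
  col_mx (t%:C + c)%:M (rvec u + w) :> 'cV_d.+1.
Proof.
apply/colP => i; rewrite !mxE; case: splitP => j _; rewrite !mxE//.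
by rewrite (ord1 j) eqxx !mulr1n.
Qed.

Lemma gaussker_block d (s : R) (b v : 'cV[R]_d) (G : 'M[R]_d) t (u : 'cV[R]_d)
   (c : R[i]) (w : 'cV[R[i]]_d) : G^T = G -> G *m v = b ->
  gaussker (block_mx (s + (b^T *m v) 0 0)%:M (b^T) b G : 'M[R]_d.+1)
    (rvec (col_mx t%:M u : 'cV[R]_d.+1) + (col_mx c%:M w : 'cV_d.+1)) =
  cexp (- (2^-1 * s%:C * (t%:C + c) ^+ 2)) *
  gaussker G (rvec u + (w + (t%:C + c) *: rvec v)).
Proof.
move=> GT Gv; rewrite rvec_col_mx /gaussker cqform_block// -cexpD addrA.
by congr cexp; ring.
Qed.

Lemma Im_affine (a c : R[i]) (t v : R) :
  complex.Im (a + (t%:C + c) * v%:C) = complex.Im a + complex.Im c * v.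
Proof. by case: a => a1 a2; case: c => c1 c2 /=; ring. Qed.

Lemma cabs_gauss1 (s t : R) (c : R[i]) :
  cabs (cexp (- (2^-1 * s%:C * (t%:C + c) ^+ 2))) =
  expR (s / 2 * complex.Im c ^+ 2) * expR (- (s / 2 * (t + complex.Re c) ^+ 2)).
Proof.
rewrite cabs_cexp -expRD; congr expR.
have -> : 2^-1 * s%:C = (2^-1 * s)%:C :> R[i] by rewrite rmorphM fmorphV rmorph_nat.
case: c => a b /=; rewrite add0r; ring.
Qed.

(** Only the imaginary parts are bounded, since [sum_grid_gauss_le] is uniform under real
    translations. This freedom is needed because completing the square translates the remaining
    coordinates by a multiple [t] of [v], with [t] running over the whole grid. *)
Lemma gaussker_grid_bound d (G : 'M[R]_d) : spd G -> forall S : R, 0 <= S ->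
  exists2 B : R, 0 <= B & forall (h : R) N, 0 < h -> h <= 1 ->
  forall w : 'cV[R[i]]_d, (forall i, `|complex.Im (w i 0)| <= S) ->
  h ^+ d * gridsum (grid h N) (fun u => cabs (gaussker G (rvec u + w))) <= B.
Proof.
elim/spd_ind : G / => [G|n s b v G [GT _] IH s0 Gv] S S0.
  exists 1 => // h N h0 h1 w _; rewrite expr0 mul1r /= /gaussker /cqform.
  by rewrite (flatmx0 (rvec 0 + w)) qform0 mulr0 oppr0 cexp0 cabs1.
have [V V0 Vv] : exists2 V : R, 0 <= V & forall i, `|v i 0| <= V.
  exists (\sum_i `|v i 0|) => [|i]; first exact: sumr_ge0.
  by rewrite (bigD1 i)//= lerDl sumr_ge0.
have [B B0 hB] := IH (S + S * V) (addr_ge0 S0 (mulr_ge0 S0 V0)).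
have s2 : 0 < s / 2 by pos.
have E0 : 0 <= expR (s / 2 * S ^+ 2) * gauss_bound (s / 2) by rewrite /gauss_bound; pos.
exists (expR (s / 2 * S ^+ 2) * gauss_bound (s / 2) * B) => [|h N h0 h1 w wS]; first by pos.
have [t0 [w' wE]] := col_mx_surj w.
have t0S : `|complex.Im t0| <= S.
  by have := wS (@lshift 1 n 0 : 'I_n.+1); rewrite wE (@col_mxEu _ 1 n 1) mxE eqxx mulr1n.
have wS' i : `|complex.Im (w' i 0)| <= S.
  by have := wS (@rshift 1 n i : 'I_n.+1); rewrite wE (@col_mxEd _ 1 n 1).
rewrite /= wE.
have inner t : h ^+ n * gridsum (grid h N) (fun u => cabs (gaussker
      (block_mx (s + (b^T *m v) 0 0)%:M (b^T) b G : 'M[R]_n.+1)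
    (rvec (col_mx t%:M u : 'cV[R]_n.+1) + (col_mx t0%:M w' : 'cV_n.+1)))) <=
    expR (s / 2 * S ^+ 2) * expR (- (s / 2 * (t + complex.Re t0) ^+ 2)) * B.
  rewrite (@eq_gridsum _ _ _ _ _ (fun u =>
     cabs (cexp (- (2^-1 * s%:C * (t%:C + t0) ^+ 2))) *
     cabs (gaussker G (rvec u + (w' + (t%:C + t0) *: rvec v))))); last first.
    by move=> u _; rewrite gaussker_block// cabsM.
  rewrite gridsumMl mulrCA; apply: ler_pM; first exact: cabs_ge0.
  - rewrite mulr_ge0 ?exprn_ge0 ?(ltW h0)// -(gridsum0 R (grid h N) n).
    by apply: ler_gridsum => u _; exact: cabs_ge0.
  - rewrite cabs_gauss1 ler_pM2r ?expR_gt0// ler_expR ler_pM2l//.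
    by rewrite -(real_normK (num_real _)) ler_sqr ?nnegrE.
  - apply: hB => // i; rewrite !mxE Im_affine.
    by rewrite (le_trans (ler_normD _ _))// lerD// normrM ler_pM.
rewrite exprS -mulrA mulr_sumr.
apply: (@le_trans _ _ (h * \sum_(t <- grid h N)
   (expR (s / 2 * S ^+ 2) * expR (- (s / 2 * (t + complex.Re t0) ^+ 2)) * B))).
  by rewrite ler_pM2l//; apply: ler_sum => t _; exact: inner.
rewrite -mulr_suml -mulr_sumr mulrA ler_wpM2r// mulrCA ler_pM2l ?expR_gt0//.
exact: sum_grid_gauss_le.
Qed.

Lemma gauss1_grid (s eps S : R) : 0 < s -> 0 < eps -> 0 <= S -> exists2 H0 : R, 0 < H0 &
  forall H1 : R, exists2 h0 : R, 0 < h0 &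
  forall (h : R) N, 0 < h -> h < h0 -> H0 <= h * N%:R -> h * N%:R <= H1 ->
  forall c : R[i], cabs c <= S ->
  cabs (h%:C * \sum_(t <- grid h N) cexp (- (2^-1 * s%:C * (t%:C + c) ^+ 2)) -
        (Num.sqrt (2 * pi) / Num.sqrt s)%:C) <= eps.
Proof.
move=> s0 eps0 S0; pose q := Num.sqrt (s / 2).
have s2 : 0 < s / 2 by pos.
have q0 : 0 < q by rewrite sqrtr_gt0.
have q2 : q ^+ 2 = s / 2 by rewrite sqr_sqrtr// ltW.
have [H0 H00 hH0] := @cgauss_grid R (eps * q) (q * S) (mulr_gt0 eps0 q0) (mulr_ge0 (ltW q0) S0).
exists (H0 / q) => [|H1]; first by pos.
have [h0 h00 hh0] := hH0 (H1 * q).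
exists (h0 / q) => [|h N hp hh HN NH c cS]; first by pos.
have key := hh0 (q * h) N.
have sq : Num.sqrt (2 * pi) / Num.sqrt s = Num.sqrt pi / q.
  rewrite /q sqrtrM// sqrtrM ?ltW// sqrtrV// invfM invrK.
  by ring.
rewrite sq -(ler_pM2r q0).
have qC : cabs (q%:C : R[i]) = q by rewrite cabs_real gtr0_norm.
rewrite -[X in _ * X <= _]qC.
rewrite -cabsM mulrBl -(rmorphM (real_complex R)) divfK ?gt_eqF//.
rewrite mulrAC -(rmorphM (real_complex R)) [h * q]mulrC.
rewrite (_ : \sum_(t <- grid h N) _ = \sum_(t <- grid (q * h) N) cgauss (t%:C + q%:C * c)).
  apply: key.
  - by rewrite mulr_gt0.
  - by rewrite mulrC -ltr_pdivlMr.
  - by rewrite -mulrA mulrC -ler_pdivrMr.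
  - by rewrite -mulrA mulrC ler_pM2r.
  - by rewrite cabsM cabs_real gtr0_norm// ler_pM2l.
rewrite -grid_scale [RHS]big_map; apply: eq_bigr => t _.
congr cexp; congr (- _); rewrite rmorphM -mulrDr exprMn; congr (_ * _).
by rewrite -(rmorphXn (real_complex R)) q2 mulrC rmorphM fmorphV rmorph_nat.
Qed.

Lemma gauss_const_ge0 d (G : 'M[R]_d) : 0 <= gauss_const G.
Proof. by rewrite divr_ge0// ?exprn_ge0 ?sqrtr_ge0. Qed.

(** After completing the square, the inner sum over the last coordinates is close to its limit only
    while its translation is bounded, that is for bounded [t]. For large [t] it is merely bounded,
    and the Gaussian weight in [t] makes these terms small. *)
Lemma gaussker_grid d (G : 'M[R]_d) : spd G -> forall eps S : R, 0 < eps -> 0 <= S ->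
  exists2 H0 : R, 0 < H0 & forall H1 : R, exists2 h0 : R, 0 < h0 &
  forall (h : R) N, 0 < h -> h < h0 -> H0 <= h * N%:R -> h * N%:R <= H1 ->
  forall w : 'cV[R[i]]_d, (forall i, cabs (w i 0) <= S) ->
  cabs ((h ^+ d)%:C * gridsum (grid h N) (fun u => gaussker G (rvec u + w)) -
        (gauss_const G)%:C) <= eps.
Proof.
elim/spd_ind : G / => [G|n s b v G sG IH s0 Gv] eps S eps0 S0.
  exists 1 => // H1; exists 1 => // h N h0 h1 _ _ w _; rewrite expr0 mul1r /= /gaussker /cqform.
  rewrite (flatmx0 (rvec 0 + w)) qform0 mulr0 oppr0 cexp0 /gauss_const det_mx00.
  by rewrite sqrtr1 divr1 expr0 subrr cabs0 ltW.
have [V V0 Vv] : exists2 V : R, 0 <= V & forall i, `|v i 0| <= V.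
  exists (\sum_i `|v i 0|) => [|i]; first exact: sumr_ge0.
  by rewrite (bigD1 i)//= lerDl sumr_ge0.
have [B B0 hB] := gaussker_grid_bound sG (addr_ge0 S0 (mulr_ge0 S0 V0)).
pose C' := gauss_const G; have C0 : 0 <= C' := gauss_const_ge0 G.
pose e2 : R := expR (s / 2 * S ^+ 2); have e20 : 0 < e2 by exact: expR_gt0.
pose B1 : R := e2 * gauss_bound (s / 2).
have B10 : 0 <= B1 by rewrite /B1 /gauss_bound; pos.
pose A : R := e2 * gauss_bound (s / 4) * (B + C').
have A0 : 0 <= A by rewrite /A /gauss_bound; pos.
(* Since y >= 1, s / 4 * y^2 >= 4 A / eps, and exp (- x) <= 1 / (1 + x) turns this into [hE4]. *)
pose y : R := 1 + 4 / s * (4 * A / eps).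
have y1 : 1 <= y by rewrite lerDl; pos.
pose E4 : R := expR (- (s / 4 * y ^+ 2)).
have hE4 : E4 * A <= eps / 4.
  have x0 : 4 * A / eps <= s / 4 * y ^+ 2.
    have : s / 4 * (4 / s * (4 * A / eps)) <= s / 4 * y ^+ 2.
      rewrite ler_pM2l; last by pos.
      apply: (@le_trans _ _ y); first by rewrite /y; lra.
      by rewrite expr2 ler_peMr//; lra.
    by apply: le_trans; rewrite le_eqVlt; apply/orP; left; apply/eqP; field; rewrite !lt0r_neq0.
  rewrite /E4 expRN mulrC ler_pdivrMr ?expR_gt0//.
  have := expR_ge1Dx (s / 4 * y ^+ 2) => e1.
  have : eps / 4 * (4 * A / eps) <= eps / 4 * expR (s / 4 * y ^+ 2).
    by rewrite ler_pM2l; [lra|pos].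
  by apply: le_trans; rewrite le_eqVlt; apply/orP; left; apply/eqP; field; exact: lt0r_neq0.
(* Beyond [T] the real part of t + c has modulus at least [y]. *)
pose T := S + y.
have T0 : 0 <= T by rewrite /T; lra.
pose eps1 : R := eps / (4 * (B1 + 1)).
have eps10 : 0 < eps1 by rewrite /eps1; pos.
have eps20 : 0 < eps / (4 * (C' + 1)) by pos.
have S'0 : 0 <= S + (T + S) * V by pos.
have [K0 K00 hK] := IH _ _ eps10 S'0.
have [L0 L00 hL] := gauss1_grid s0 eps20 S0.
exists (K0 + L0) => [|H1]; first by pos.
have [k0 k00 {}hK] := hK H1; have [l0 l00 {}hL] := hL H1.
exists (Num.min 1 (Num.min k0 l0)); first by rewrite !lt_min ltr01 k00.
move=> h N h0; rewrite !lt_min => /and3P[h1 hk hl] HN NH w wS.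
have [c [w' wE]] := col_mx_surj w.
have cS : cabs c <= S.
  by have := wS (@lshift 1 n 0 : 'I_n.+1); rewrite wE (@col_mxEu _ 1 n 1) mxE eqxx mulr1n.
have wS' i : cabs (w' i 0) <= S.
  by have := wS (@rshift 1 n i : 'I_n.+1); rewrite wE (@col_mxEd _ 1 n 1).
pose E t : R[i] := cexp (- (2^-1 * s%:C * (t%:C + c) ^+ 2)).
pose I t : R[i] := (h ^+ n)%:C *
  gridsum (grid h N) (fun u => gaussker G (rvec u + (w' + (t%:C + c) *: rvec v))).
have -> : (h ^+ n.+1)%:C * gridsum (grid h N) (fun u : 'cV_n.+1 =>
     gaussker (block_mx (s + (b^T *m v) 0 0)%:M (b^T) b G : 'M[R]_n.+1) (rvec u + w)) =
   h%:C * \sum_(t <- grid h N) E t * I t.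
  rewrite exprS (rmorphM (real_complex R)) /= -mulrA; congr (_ * _); rewrite mulr_sumr.
  apply: eq_bigr => t _; rewrite wE.
  rewrite (@eq_gridsum _ _ _ _ _ (fun u =>
     E t * gaussker G (rvec u + (w' + (t%:C + c) *: rvec v)))); last first.
    by move=> u _; rewrite gaussker_block//; case: sG.
  by rewrite gridsumMl mulrCA.
rewrite gauss_const_block// -/C'.
set C1 := Num.sqrt (2 * pi) / Num.sqrt s.
have -> : h%:C * \sum_(t <- grid h N) E t * I t - (C1 * C')%:C =
   h%:C * \sum_(t <- grid h N) E t * (I t - C'%:C) +
   C'%:C * (h%:C * (\sum_(t <- grid h N) E t) - C1%:C).
  rewrite [X in _ = _ * X + _](eq_bigr (fun t => E t * I t - C'%:C * E t)); last by move=> t _; ring.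
  by rewrite sumrB -mulr_sumr rmorphM; ring.
have hh1 : h <= 1 := ltW h1.
have HNK : K0 <= h * N%:R by lra.
have HNL : L0 <= h * N%:R by lra.
have s2 : 0 < s / 2 by pos.
have s4 : 0 < s / 4 by pos.
have a1 : `|complex.Re c| <= S := le_trans (cabs_Re c) cS.
have b1 : `|complex.Im c| <= S := le_trans (cabs_Im c) cS.
have Ele t : cabs (E t) <= e2 * expR (- (s / 2 * (t + complex.Re c) ^+ 2)).
  rewrite cabs_gauss1 ler_pM2r ?expR_gt0// ler_expR ler_pM2l//.
  by rewrite -(real_normK (num_real _)) ler_sqr ?nnegrE.
have point t : t \in grid h N -> cabs (E t * (I t - C'%:C)) <=
   e2 * expR (- (s / 2 * (t + complex.Re c) ^+ 2)) * eps1 +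
   e2 * expR (- (s / 4 * (t + complex.Re c) ^+ 2)) * (E4 * (B + C')).
  move=> tg; rewrite cabsM; have E0 := cabs_ge0 (E t).
  (* For |t| > T half of the exponent s / 2 yields the small factor [E4]; the other half remains to
     sum over the grid. *)
  have [tT|tT] := leP `|t| T.
    rewrite -[leLHS]addr0 lerD//; last by rewrite /E4; pos.
    apply: ler_pM; [exact: cabs_ge0|exact: cabs_ge0|exact: Ele|].
    apply: hK => // i; rewrite !mxE (le_trans (ler_cabsD _ _))// lerD//.
    rewrite cabsM cabs_real; apply: ler_pM => //; first exact: cabs_ge0.
    by rewrite (le_trans (ler_cabsD _ _))// cabs_real lerD.
  rewrite -[leLHS]add0r lerD//; first by pos.
  rewrite mulrA; apply: ler_pM; [exact: cabs_ge0|exact: cabs_ge0| |].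
    apply: le_trans (Ele t) _; rewrite -[leRHS]mulrA ler_pM2l// /E4 -expRD ler_expR.
    have : y ^+ 2 <= (t + complex.Re c) ^+ 2.
      rewrite -(real_normK (num_real (t + _))) ler_sqr ?nnegrE//; last lra.
      by have := lerB_normD t (complex.Re c); rewrite /T in tT; lra.
    by have := sqr_ge0 y; nra.
  rewrite (le_trans (ler_cabsB _ _))// cabs_real (ger0_norm C0) lerD2r.
  rewrite /I cabsM cabs_real ger0_norm ?exprn_ge0 ?(ltW h0)//.
  apply: le_trans (ler_wpM2l _ (cabs_gridsum _ _)) _; first by rewrite exprn_ge0 ?(ltW h0).
  apply: hB => // i; rewrite !mxE Im_affine.
  rewrite (le_trans (ler_normD _ _))// lerD//.
    by rewrite (le_trans (cabs_Im _)).
  by rewrite normrM ler_pM.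
have sum1 := sum_grid_gauss_le N (complex.Re c) s2 h0 hh1.
have sum2 := sum_grid_gauss_le N (complex.Re c) s4 h0 hh1.
have part1 : cabs (h%:C * \sum_(t <- grid h N) E t * (I t - C'%:C)) <= eps / 4 + eps / 4.
  rewrite cabsM cabs_real (ger0_norm (ltW h0)).
  apply: (@le_trans _ _ (h * \sum_(t <- grid h N)
     (e2 * expR (- (s / 2 * (t + complex.Re c) ^+ 2)) * eps1 +
      e2 * expR (- (s / 4 * (t + complex.Re c) ^+ 2)) * (E4 * (B + C'))))).
    rewrite ler_pM2l// (le_trans (ler_cabs_sum _ _ _))// !big_seq.
    by apply: ler_sum => t; exact: point.
  rewrite big_split /= mulrDr -!mulr_suml -!mulr_sumr; apply: lerD.
    apply: (@le_trans _ _ (B1 * eps1)).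
      by rewrite /B1 mulrA ler_pM2r// mulrCA ler_pM2l.
    by apply: mul_divD1_le => //; exact: ltW.
  apply: le_trans hE4; rewrite /A.
  set Z := \sum_(t <- _) _.
  have -> : h * (e2 * Z * (E4 * (B + C'))) = E4 * (e2 * (h * Z) * (B + C')) by ring.
  apply: ler_wpM2l; first exact: expR_ge0.
  by apply: ler_wpM2r; [pos|apply: ler_wpM2l => //; exact: ltW].
have part2 : cabs (C'%:C * (h%:C * (\sum_(t <- grid h N) E t) - C1%:C)) <= eps / 4.
  rewrite cabsM cabs_real (ger0_norm C0).
  apply: (@le_trans _ _ (C' * (eps / (4 * (C' + 1))))).
    by rewrite ler_wpM2l//; apply: hL.
  by apply: mul_divD1_le => //; exact: ltW.
rewrite (le_trans (ler_cabsD _ _))//; lra.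
Qed.

End GaussD.

(** * Fourier averages over grids *)

Section TendsTo.
Variable R : realType.
Implicit Types (V W : normedModType R[i]).

(** An explicit form with real norms, in which errors can be added by linear arithmetic;
    [tends_to_cvg] relates it to filter convergence. *)
Definition tends_to V (u : nat -> V) (l : V) : Prop :=
  forall e : R, 0 < e -> exists N0, forall N, (N0 <= N)%N -> rnorm (u N - l) <= e.

Lemma tends_to_unique V (u : nat -> V) l l' : tends_to u l -> tends_to u l' -> l = l'.
Proof.
move=> h h'; apply/eqP; rewrite -subr_eq0; apply/eqP/rnorm0_eq0/eqP.
rewrite eq_le rnorm_ge0 andbT; apply/ler_addgt0Pl => e e0; rewrite addr0.
have e2 : 0 < e / 2 by pos.
have [N hN] := h _ e2; have [M hM] := h' _ e2.
have := hN _ (leq_maxl N M); have := hM _ (leq_maxr N M).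
have := ler_rnorm_dist l (u (maxn N M)) l'; rewrite (rnorm_distC l (u _)); lra.
Qed.

Lemma tends_to_eq V (u v : nat -> V) l :
  (exists N0, forall N, (N0 <= N)%N -> u N = v N) -> tends_to u l -> tends_to v l.
Proof.
move=> [N1 h1] h e e0; have [N0 h0] := h e e0; exists (maxn N0 N1) => N.
by rewrite geq_max => /andP[n0 n1]; rewrite -h1// h0.
Qed.

Lemma tends_to_cst V (l : V) : tends_to (fun=> l) l.
Proof. by move=> e e0; exists 0%N => N _; rewrite subrr rnorm0 ltW. Qed.

Lemma tends_toD V (u v : nat -> V) l m :
  tends_to u l -> tends_to v m -> tends_to (fun N => u N + v N) (l + m).
Proof.
move=> h h' e e0; have e2 : 0 < e / 2 by pos.
have [N hN] := h _ e2; have [M hM] := h' _ e2.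
exists (maxn N M) => k; rewrite geq_max => /andP[nk mk].
have := hN _ nk; have := hM _ mk; rewrite opprD addrACA.
have := ler_rnormD (u k - l) (v k - m); lra.
Qed.

Lemma tends_to_sum V (I : Type) (r : seq I) (P : pred I) (u : I -> nat -> V) (l : I -> V) :
  (forall i, P i -> tends_to (u i) (l i)) ->
  tends_to (fun N => \sum_(i <- r | P i) u i N) (\sum_(i <- r | P i) l i).
Proof.
move=> h; elim: r => [|i r IH].
  by rewrite big_nil; apply: tends_to_eq (tends_to_cst _); exists 0%N => N _; rewrite big_nil.
rewrite big_cons; case: (boolP (P i)) => Pi.
  apply: tends_to_eq (tends_toD (h i Pi) IH).
  by exists 0%N => N _; rewrite big_cons Pi.
by apply: tends_to_eq IH; exists 0%N => N _; rewrite big_cons (negbTE Pi).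
Qed.

Lemma tends_to_lin V W (f : V -> W) (C : R) (u : nat -> V) l :
  (forall x y, f (x - y) = f x - f y) -> (forall x, rnorm (f x) <= C * rnorm x) ->
  tends_to u l -> tends_to (fun N => f (u N)) (f l).
Proof.
move=> fB fC h e e0; have C1 : 0 < `|C| + 1 by rewrite ltr_wpDl.
have [N hN] := h _ (divr_gt0 e0 C1); exists N => M /hN hM.
rewrite -fB (le_trans (fC _))// (le_trans (ler_wpM2r (rnorm_ge0 _) (ler_norm C)))//.
have := ler_wpM2l (ltW C1) hM; rewrite mulrCA mulfV ?gt_eqF// mulr1.
have := rnorm_ge0 (u M - l); nra.
Qed.

Lemma tends_to_norm_le V (u : nat -> V) l (c : R) :
  (exists N0, forall N, (N0 <= N)%N -> rnorm (u N) <= c) -> tends_to u l -> rnorm l <= c.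
Proof.
move=> [N1 h1] h; apply/ler_addgt0Pr => e e0; have [N0 h0] := h e e0.
have := h0 _ (leq_maxl N0 N1); have := h1 _ (leq_maxr N0 N1).
set N := maxn _ _; have := ler_rnormD (l - u N) (u N); rewrite subrK (rnorm_distC l); lra.
Qed.

(** An exchange of limits: the truncation is fixed first, with an error uniform in large N, and only
    then is N sent to infinity. *)
Lemma tends_to_approx V (u : nat -> V) (l : V) :
  (forall e : R, 0 < e -> exists v m, [/\ tends_to v m, rnorm (m - l) <= e &
     exists N0, forall N, (N0 <= N)%N -> rnorm (u N - v N) <= e]) -> tends_to u l.
Proof.
move=> h e e0; have e3 : 0 < e / 3 by pos.
have [v [m [vm ml [N0 h0]]]] := h _ e3; have [N1 h1] := vm _ e3.
exists (maxn N0 N1) => k; rewrite geq_max => /andP[n0 n1].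
have a1 := h0 _ n0; have a2 := h1 _ n1.
have := ler_rnorm_dist (u k) (v k) l; have := ler_rnorm_dist (v k) m l; lra.
Qed.

Lemma nbhs_rnormP V (v : V) (A : set V) :
  nbhs v A <-> exists2 e : R, 0 < e & forall w, rnorm (v - w) < e -> A w.
Proof.
split=> [/nbhs_ballP[e /= e0 h]|[e e0 h]].
  (* In the order of [R[i]] a positive element is real. *)
  have eE : e = (complex.Re e)%:C by move: e0; case: e {h} => a b; rewrite ltcE /= => /andP[/eqP ->].
  exists (complex.Re e); first by rewrite -ltcR -eE.
  by move=> w vw; apply: h; rewrite -ball_normE /ball_ /= rnormE eE ltcR.
apply/nbhs_ballP; exists e%:C => /=; first by rewrite ltcR.
by move=> w; rewrite -ball_normE /ball_ /= rnormE ltcR => /h.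
Qed.

Lemma tends_to_cvg V (u : nat -> V) l : tends_to u l <-> u @ \oo --> l.
Proof.
split=> [h|h e e0].
  move=> A /nbhs_rnormP[e e0 hA]; have e2 : 0 < e / 2 by pos.
  have [N0 h0] := h _ e2; exists N0 => // N /= /h0 hN.
  by apply: hA; rewrite rnorm_distC; lra.
have /h [N0 _ h0] : nbhs l [set w | rnorm (l - w) < e] by apply/nbhs_rnormP; exists e.
by exists N0 => N /h0 /= hN; rewrite rnorm_distC ltW.
Qed.

Lemma cauchy_tends_to (B : completeNormedModType R[i]) (u : nat -> B) :
  (forall e : R, 0 < e -> exists N0, forall N M, (N0 <= N)%N -> (N0 <= M)%N ->
     rnorm (u N - u M) <= e) -> exists l, tends_to u l.
Proof.
move=> h; suff : cvgn u by move=> c; exists (lim (u @ \oo)); apply/tends_to_cvg.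
apply/cauchy_cvgP/cauchy_ballP => e e0.
have eE : e = (complex.Re e)%:C by move: e0; case: e => a b; rewrite ltcE /= => /andP[/eqP ->].
have r0 : 0 < complex.Re e by rewrite -ltcR -eE.
have r2 : 0 < complex.Re e / 2 by pos.
have [N0 h0] := h _ r2.
pose A : set B := [set x | exists2 N, (N0 <= N)%N & x = u N].
exists (A, A) => /=; first by split; exists N0 => // N /= hN; exists N.
move=> [_ _] /= [[N hN ->] [M hM ->]].
rewrite -ball_normE /ball_ /= rnormE eE ltcR.
by apply: le_lt_trans (h0 N M hN hM) _; lra.
Qed.

Lemma continuous_scalar_bounded V (phi : V -> R[i]) :
  (forall (a : R[i]) f g, phi (a *: f + g) = a * phi f + phi g) ->
  continuous phi -> exists2 C : R, 0 <= C & forall f, cabs (phi f) <= C * rnorm f.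
Proof.
move=> lin cont.
have p0 : phi 0 = 0 by have := lin (-1) 0 0; rewrite scaler0 addr0 mulN1r addNr.
have pZ a f : phi (a *: f) = a * phi f by have := lin a f 0; rewrite addr0 p0 addr0.
have /cont /nbhs_rnormP[d d0 h] :
    nbhs (phi 0 : R[i]^o) [set w : R[i]^o | rnorm ((phi 0 : R[i]^o) - w) < 1].
  by apply/nbhs_rnormP; exists 1.
exists (2 / d); first by pos.
move=> f; have [f0|f0] := eqVneq (rnorm f) 0.
  by rewrite (rnorm0_eq0 f0) p0 cabs0 rnorm0 mulr0.
have fp : 0 < rnorm f by rewrite lt_neqAle eq_sym f0 rnorm_ge0.
pose c : R := d / (2 * rnorm f).
have c0 : 0 < c by rewrite /c; pos.
have : rnorm (0 - c%:C *: f) < d.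
  rewrite sub0r rnormN rnormZ cabs_real gtr0_norm// /c invfM mulrA mulfVK//.
  by lra.
move=> /h /=; rewrite p0 pZ sub0r rnorm_cabs cabsN cabsM cabs_real gtr0_norm//.
rewrite mulrC -ltr_pdivlMr// div1r /c invf_div => /ltW.
by rewrite mulrAC.
Qed.

End TendsTo.

(** * Orthogonality of characters on grids *)

Section Characters.
Variable R : realType.
Implicit Types (N : nat).

Definition rdot d (z : 'cV[R]_d) (k : multi d) : R := \sum_i z i 0 * (k i)%:R.

(** The normalised average over the 2N-point grid of [-pi, pi)^d, in place of (2 pi)^-d times the
    integral over the torus. *)
Definition gavg (V : lmodType R[i]) d N (F : 'cV[R]_d -> V) : V :=
  ((N + N)%:R^-1 ^+ d : R[i]) *: gridsum (grid (pi / N%:R) N) F.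

Definition cube d (u : 'cV[R]_d) : Prop := forall i, `|u i 0| <= pi.

Lemma grid_cube N (t : R) : t \in grid (pi / N%:R) N -> `|t| <= pi.
Proof.
move=> tg; have h : 0 <= (pi : R) / N%:R by rewrite divr_ge0 ?pi_ge0.
apply: (le_trans (grid_bound h tg)); case: N {tg h} => [|N]; first by rewrite mulr0 pi_ge0.
by rewrite divfK.
Qed.

Lemma gavg_eq (V : lmodType R[i]) d N (F G : 'cV[R]_d -> V) :
  (forall u, cube u -> F u = G u) -> gavg N F = gavg N G.
Proof.
by move=> h; congr (_ *: _); apply: eq_gridsum => u us; apply: h => i; exact: grid_cube (us i).
Qed.

Lemma gavg_sum (V : lmodType R[i]) (I : Type) (r : seq I) (P : pred I) d N
    (F : I -> 'cV[R]_d -> V) :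
  gavg N (fun u => \sum_(i <- r | P i) F i u) = \sum_(i <- r | P i) gavg N (F i).
Proof. by rewrite /gavg gridsum_sum scaler_sumr. Qed.

Lemma gavgB (V : lmodType R[i]) d N (F G : 'cV[R]_d -> V) :
  gavg N (fun u => F u - G u) = gavg N F - gavg N G.
Proof. by rewrite /gavg gridsumB scalerBr. Qed.

Lemma gavg_lin (V W : lmodType R[i]) d N (f : V -> W) (F : 'cV[R]_d -> V) :
  linear f -> f (gavg N F) = gavg N (fun u => f (F u)).
Proof.
move=> lf.
have f0 : f 0 = 0 by have := lf (-1) 0 0; rewrite scaler0 addr0 scaleN1r addNr.
have fD x y : f (x + y) = f x + f y by have := lf 1 x y; rewrite !scale1r.
have fZ a x : f (a *: x) = a *: f x by have := lf a x 0; rewrite !addr0 f0 addr0.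
rewrite /gavg fZ; congr (_ *: _).
elim: d F => [//|d IH] F /=; rewrite (big_morph f fD f0); apply: eq_bigr => t _.
exact: IH.
Qed.

Lemma rnorm_gavg (V : normedModType R[i]) d N (F : 'cV[R]_d -> V) :
  rnorm (gavg N F) <= (N + N)%:R^-1 ^+ d * gridsum (grid (pi / N%:R) N) (fun u => rnorm (F u)).
Proof.
rewrite rnormZ cabsX cabsV cabs_nat ler_wpM2l ?exprn_ge0 ?invr_ge0//.
exact: rnorm_gridsum.
Qed.

Lemma rnorm_gavg_le (V : normedModType R[i]) d N (F : 'cV[R]_d -> V) (c : R) :
  (0 < N)%N -> (forall u, cube u -> rnorm (F u) <= c) -> rnorm (gavg N F) <= c.
Proof.
move=> N0 h; apply: (le_trans (rnorm_gavg _ _)).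
apply: (@le_trans _ _ ((N + N)%:R^-1 ^+ d *
   gridsum (grid (pi / N%:R) N) (fun _ : 'cV[R]_d => c))).
  rewrite ler_wpM2l ?exprn_ge0 ?invr_ge0//; apply: ler_gridsum => u us.
  by apply: h => i; exact: grid_cube (us i).
rewrite gridsum_const size_grid mulrA -exprMn mulVf ?expr1n ?mul1r//.
by rewrite pnatr_eq0 -lt0n addn_gt0 N0.
Qed.

(** Its modulus does not depend on [u]. The index [l] is carried along for the induction in
    [fourier_iter_Qop], where each factor e^((z + i u).r) is absorbed into it. *)
Definition phase d (z : 'cV[R]_d) (l k : multi d) (u : 'cV[R]_d) : R[i] :=
  cexp (cdot (cvec z u) l - cdot (cvec z u) k).

Lemma phase_prod d (z : 'cV[R]_d) l k u :
  phase z l k u = \prod_i cexp ((z i 0 +i* u i 0) * ((l i)%:R - (k i)%:R)).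
Proof.
rewrite /phase /cdot -sumrB cexp_sum; apply: eq_bigr => i _.
by rewrite mxE mulrBr.
Qed.

Lemma cabs_phase d (z : 'cV[R]_d) l k u :
  cabs (phase z l k u) = expR (rdot z l - rdot z k).
Proof.
rewrite cabs_cexp; congr expR; rewrite raddfB /= /rdot /cdot !raddf_sum /=.
have E i (n : nat) : complex.Re (cvec z u i 0 * n%:R) = z i 0 * n%:R.
  by rewrite mxE -(rmorph_nat (real_complex R)) /=; ring.
by congr (_ + _); apply: eq_bigr => i _; rewrite E.
Qed.

Lemma cexp_iX (y : R) n : cexp (0 +i* y) ^+ n = cexp (0 +i* (y * n%:R)).
Proof.
rewrite -cexpMn; congr cexp; elim: n => [|n IH]; first by rewrite mulr0n mulr0.
rewrite mulrS IH -natr1; apply/eqP; rewrite eq_complex /= addr0 eqxx /=; apply/eqP; ring.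
Qed.

(** A geometric sum whose ratio is a 2N-th root of unity, different from 1 because 0 < |a - b| <
    2N. *)
Lemma sum_grid_character N (a b : nat) (x : R) : (0 < N)%N ->
  a != b -> (a < N + N)%N -> (b < N + N)%N ->
  \sum_(t <- grid (pi / N%:R) N) cexp ((x +i* t) * (a%:R - b%:R)) = 0.
Proof.
move=> N0 ab aN bN.
have Nr : N%:R != 0 :> R by rewrite pnatr_eq0 -lt0n.
pose w : R[i] := cexp (0 +i* (pi / N%:R * (a%:R - b%:R))).
pose c0 : R[i] := cexp ((x +i* (- pi)) * (a%:R - b%:R)).
rewrite sum_grid (eq_bigr (fun j : 'I_(N + N) => c0 * w ^+ j)); last first.
  move=> j _; rewrite /c0 /w cexp_iX -cexpD; congr cexp.
  rewrite -[a%:R](rmorph_nat (real_complex R)) -[b%:R](rmorph_nat (real_complex R)).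
  by apply/eqP; rewrite eq_complex /=; apply/andP; split; apply/eqP; field.
rewrite -mulr_sumr; suff -> : \sum_(i < N + N) w ^+ i = 0 by rewrite mulr0.
have w1 : w != 1.
  suff W (p q : nat) : (p < N + N)%N -> (q < p)%N ->
      cexp (0 +i* (pi / N%:R * (p%:R - q%:R))) != 1 :> R[i].
    move: ab; rewrite neq_ltn => /orP[ltab|]; last exact: W.
    have := W _ _ bN ltab; apply: contraNneq; rewrite /w => e.
    have -> : 0 +i* (pi / N%:R * (b%:R - a%:R)) = - (0 +i* (pi / N%:R * (a%:R - b%:R))) :> R[i].
      by apply/eqP; rewrite eq_complex /= oppr0 eqxx /=; apply/eqP; ring.
    by rewrite cexpN e invr1.
  move=> pN qp.
  apply/eqP => /(congr1 (@complex.Re R)); rewrite /cexp /= expR0 !mul1r mul0r subr0.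
  (* If the ratio were 1 then cos y = 1, hence sin (y / 2) = 0, although 0 < y / 2 < pi. *)
  set y := _ * _ => cy.
  have y0 : 0 < y / 2 < pi.
    have ba : 0 < (p%:R - q%:R : R) by rewrite subr_gt0 ltr_nat.
    have Np : 0 < N%:R :> R by rewrite ltr0n.
    have pp := @pi_gt0 R.
    apply/andP; split; first by rewrite /y; pos.
    have : (p%:R - q%:R : R) < N%:R + N%:R.
      by rewrite -natrD -natrB ?(ltnW qp)// ltr_nat (leq_ltn_trans (leq_subr _ _)).
    move=> pq; have -> : y / 2 = pi * ((p%:R - q%:R) / (2 * N%:R)) by rewrite /y; field.
    by rewrite gtr_pMr// ltr_pdivrMr; lra.
  have := sin_gt0_pi y0.
  have : cos ((y / 2) *+ 2) = 1.
    by rewrite (_ : y / 2 *+ 2 = y)// -[_ *+ 2]mulr_natr; field.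
  rewrite cos_mulr2n; have := cos2Dsin2 (y / 2).
  move=> h1 h2 h3; have : sin (y / 2) ^+ 2 = 0 by lra.
  by move/eqP; rewrite expf_eq0 /= => /eqP h0; rewrite h0 ltxx in h3.
have wN : w ^+ (N + N) = 1.
  rewrite /w cexp_iX.
  have -> : pi / N%:R * (a%:R - b%:R) * (N + N)%:R = 2 * pi * (a%:R - b%:R) :> R.
    by rewrite natrD; field.
  have per (n : nat) : cexp (0 +i* (2 * pi * n%:R)) = 1 :> R[i].
    rewrite /cexp /= expR0 mul1r.
    have -> : 2 * pi * n%:R = 0 + pi *+ 2 *+ n :> R.
      by rewrite add0r -[pi *+ 2]mulr_natl mulr_natr.
    by rewrite (periodicn (@cosD2pi R)) (periodicn (@sinD2pi R)) cos0 sin0.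
  have -> : 0 +i* (2 * pi * (a%:R - b%:R)) =
    (0 +i* (2 * pi * a%:R)) - (0 +i* (2 * pi * b%:R)) :> R[i].
    by apply/eqP; rewrite eq_complex /= subrr eqxx /=; apply/eqP; ring.
  by rewrite cexpD cexpN !per invr1 mulr1.
have := subrX1 w (N + N); rewrite wN subrr => /esym/eqP.
by rewrite mulf_eq0 subr_eq0 (negbTE w1) /= => /eqP.
Qed.

(** Exact at finite N, for every tilt: there is no aliasing as long as all indices stay below 2N. *)
Lemma gavg_phase d (z : 'cV[R]_d) (l k : multi d) N : (0 < N)%N ->
  (forall i, (l i < N + N)%N) -> (forall i, (k i < N + N)%N) ->
  @gavg R[i]^o d N (phase z l k) = if l == k then 1 else 0.
Proof.
move=> N0 lN kN; rewrite /gavg.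
have -> : gridsum (grid (pi / N%:R) N) (phase z l k : 'cV[R]_d -> R[i]^o) =
   \prod_i \sum_(t <- grid (pi / N%:R) N) cexp ((z i 0 +i* t) * ((l i)%:R - (k i)%:R)).
  rewrite -(@gridsum_prod _ R[i] _ _ (fun i t => cexp ((z i 0 +i* t) * ((l i)%:R - (k i)%:R)))).
  by apply: eq_gridsum => u _; exact: phase_prod.
case: eqVneq => [->|lk].
  rewrite (eq_bigr (fun=> (N + N)%:R)); last first.
    move=> i _; rewrite (eq_bigr (fun=> 1)); last by move=> t _; rewrite subrr mulr0 cexp0.
    by rewrite big_const_seq count_predT iter_addr_0 size_grid.
  rewrite prodr_const card_ord /= /GRing.scale /= -exprMn mulVf ?expr1n//.
  by rewrite pnatr_eq0 -lt0n addn_gt0 N0.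
have [i li] : exists i, l i != k i.
  by apply/existsP; apply: contraNT lk => /existsPn h; apply/eqP/ffunP => i; apply/eqP; rewrite -[_ == _]negbK h.
by rewrite (bigD1 i)//= sum_grid_character// mul0r scaler0.
Qed.

End Characters.

(** * Geometric sums over multi-indices *)

Section MultiSums.
Variable R : realType.

Definition deg d (j : multi d) : nat := \sum_i j i.

Lemma prod_expr_deg (x : R) d (j : multi d) : \prod_i x ^+ j i = x ^+ deg j.
Proof. by rewrite /deg (big_morph (fun n => x ^+ n) (exprD x) (expr0 x)). Qed.

Lemma ler_sum_uniq_sub (T : eqType) (s t : seq T) (F : T -> R) :
  uniq s -> {subset s <= t} -> (forall x, 0 <= F x) ->
  \sum_(x <- s) F x <= \sum_(x <- t) F x.
Proof.
move=> us st F0; elim: s t us st => [|a s IH] t /=.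
  by rewrite big_nil sumr_ge0.
move=> /andP[an us] st; have at_ : a \in t by apply: st; rewrite mem_head.
rewrite big_cons (perm_big _ (perm_to_rem at_)) big_cons lerD2l IH// => x xs.
have : x \in t by apply: st; rewrite in_cons xs orbT.
rewrite (perm_mem (perm_to_rem at_)) in_cons => /orP[/eqP xa|//].
by rewrite -xa xs in an.
Qed.

Lemma sum_geometric_le (x : R) n : 0 <= x -> x < 1 ->
  \sum_(i < n) x ^+ i <= (1 - x)^-1.
Proof.
move=> x0 x1; have y0 : 0 < 1 - x by rewrite subr_gt0.
rewrite -(ler_pM2l y0) mulfV ?gt_eqF// -opprB mulNr -subrX1 opprB.
by rewrite gerBl exprn_ge0.
Qed.

(** A finite set of indices lies in a box, over which the sum factors into d geometric sums; the
    bound does not see the size of the box. *)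
Lemma sum_deg_le (x : R) d (s : seq (multi d)) : 0 <= x -> x < 1 -> uniq s ->
  \sum_(j <- s) x ^+ deg j <= (1 - x)^-1 ^+ d.
Proof.
move=> x0 x1 us.
have [M hM] : exists M, forall j, j \in s -> forall i, (j i < M)%N.
  exists (\sum_(j <- s) deg j).+1 => j js i.
  rewrite ltnS (big_rem j js) /= (leq_trans _ (leq_addr _ _))//.
  by rewrite /deg (bigD1 i)//= leq_addr.
apply: (@le_trans _ _ (\sum_(f : {ffun 'I_d -> 'I_M}) \prod_i x ^+ f i)).
  pose phi (f : {ffun 'I_d -> 'I_M}) : multi d := [ffun i => f i : nat].
  rewrite (eq_bigr (fun f => x ^+ deg (phi f))); last first.
    by move=> f _; rewrite -prod_expr_deg; apply: eq_bigr => i _; rewrite ffunE.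
  rewrite -(big_map phi xpredT (fun j => x ^+ deg j)).
  apply: ler_sum_uniq_sub => // [j js|j]; last exact: exprn_ge0.
  apply/mapP; exists [ffun i => Ordinal (hM j js i)]; first by rewrite mem_index_enum.
  by apply/ffunP => i; rewrite !ffunE.
rewrite -(bigA_distr_bigA (fun (i : 'I_d) (a : 'I_M) => x ^+ a)) prodr_const card_ord.
by rewrite lerXn2r ?nnegrE ?invr_ge0 ?subr_ge0 ?sumr_ge0 ?(ltW x1)// ?sum_geometric_le// => i _; rewrite exprn_ge0.
Qed.

Lemma partial_sumE (V : zmodType) d (F : multi d -> V) (J : {fset multi d}) :
  partial_sum F J = \sum_(j <- J) F j.
Proof. by rewrite /partial_sum [RHS]big_seq_fsetE. Qed.

End MultiSums.

(** * Lipschitz bounds from power series *)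

Section Analytic.
Variable R : realType.
Variable B : completeNormedModType R[i].

Lemma cmonomial_bound d (h : 'cV[R[i]]_d) (x : R) j : (forall i, cabs (h i 0) <= x) ->
  cabs (cmonomial h j) <= x ^+ deg j.
Proof.
move=> hx; rewrite cabs_prod -prod_expr_deg; apply: ler_prod => i _.
by rewrite cabs_ge0 cabsX lerXn2r ?nnegrE ?cabs_ge0//= (le_trans (cabs_ge0 _) (hx i)).
Qed.

Lemma partial_sum_funE d (A : multi d -> B -> B) (J : {fset multi d}) f :
  (partial_sum A J : B -> B) f = \sum_(j <- J) A j f.
Proof. by rewrite partial_sumE fct_sumE. Qed.

Lemma deg_eq0 d (j : multi d) : (deg j == 0%N) = (j == multi0).
Proof.
rewrite /deg sum_nat_eq0; apply/forallP/eqP => [h|-> i]; last by rewrite ffunE.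
by apply/ffunP => i; rewrite ffunE; apply/eqP; have := h i.
Qed.

(** Convergence of the series at the diagonal point (r, ..., r) bounds r^|j| |A_j f| uniformly in j,
    a Cauchy estimate without contour integrals. For increments of size x <= r / 2 the terms j != 0
    are then dominated by a geometric sum of order x. *)
Lemma op_analytic_lipschitz d (F : 'cV[R[i]]_d -> B -> B) z0 : op_analytic_at F z0 ->
  exists s C : R, [/\ 0 < s, 0 <= C & forall (h : 'cV[R[i]]_d) x, x <= s -> (forall i, cabs (h i 0) <= x) ->
    0 <= x -> forall f, rnorm (F (z0 + h) f - F z0 f) <= C * x * rnorm f].
Proof.
move=> [s [A [s0 Ab hA]]]; pose r := s / 2; have r0 : 0 < r by rewrite /r; pos.
have [J0 _ hJ0] : \forall J \near totally,
   linear (F (z0 + const_mx r%:C) - partial_sum (fun j => cmonomial (const_mx r%:C) j *: A j) J) /\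
   op_le (F (z0 + const_mx r%:C) - partial_sum (fun j => cmonomial (const_mx r%:C) j *: A j) J) 1.
  by apply: hA => [i|//]; rewrite mxE cabs_real gtr0_norm /r//; lra.
have mono j : cmonomial (const_mx r%:C : 'cV_d) j = (r ^+ deg j)%:C.
  rewrite /cmonomial -prod_expr_deg rmorph_prod; apply: eq_bigr => i _.
  by rewrite mxE rmorphXn.
have {}hJ0 (J : {fset multi d}) : (J0 `<=` J)%fset -> forall f,
    rnorm (F (z0 + const_mx r%:C) f - \sum_(j <- J) (r ^+ deg j)%:C *: A j f) <= rnorm f.
  move=> JJ f; have [_ /op_leP /(_ f)] := hJ0 J JJ; rewrite mul1r; congr (_ <= _).
  congr (rnorm (_ - _)); rewrite partial_sum_funE; apply: eq_bigr => j _.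
  by rewrite mono.
have [c hc] := choice Ab.
pose C0 : R := 2 + \sum_(j <- J0) `|c j| * r ^+ deg j.
have S0 : 0 <= \sum_(j <- J0) `|c j| * r ^+ deg j.
  by apply: sumr_ge0 => j _; rewrite mulr_ge0// exprn_ge0// ltW.
have term j f : r ^+ deg j * rnorm (A j f) <= C0 * rnorm f.
  have rj : 0 < r ^+ deg j by rewrite exprn_gt0.
  have [jJ|jJ] := boolP (j \in J0).
    have [_ /op_leP /(_ f) cj] := hc j.
    have : r ^+ deg j * rnorm (A j f) <= (`|c j| * r ^+ deg j) * rnorm f.
      rewrite [X in _ <= X * _]mulrC -mulrA ler_pM2l// (le_trans cj)// ler_wpM2r ?rnorm_ge0//.
      exact: ler_norm.
    move=> /le_trans; apply; rewrite ler_wpM2r ?rnorm_ge0// /C0 (big_rem j jJ) /=.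
    have : 0 <= \sum_(y <- rem j J0) `|c y| * r ^+ deg y.
      by apply: sumr_ge0 => i _; rewrite mulr_ge0// exprn_ge0// ltW.
    lra.
  (* A term outside [J0] is the difference of two partial sums, both within |f| of the value. *)
  have h1 := hJ0 J0 (fsubset_refl _) f.
  have h2 := hJ0 (j |` J0)%fset (fsubsetU1 _ _) f.
  rewrite big_fsetU1//= in h2.
  set u := F _ f in h1 h2; set v := \sum_(_ <- _) _ in h1 h2.
  have : rnorm ((r ^+ deg j)%:C *: A j f) <= 2 * rnorm f.
    have -> : (r ^+ deg j)%:C *: A j f = (u - v) - (u - ((r ^+ deg j)%:C *: A j f + v)).
      by rewrite opprB [RHS]addrC addrA subrK addrK.
    by apply: (le_trans (ler_rnormB _ _)); lra.
  rewrite rnormZ cabs_real (gtr0_norm rj) => /le_trans; apply.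
  by rewrite ler_wpM2r ?rnorm_ge0// /C0; lra.
have A0 f : F z0 f = A multi0 f.
  apply/eqP; rewrite -subr_eq0; apply/eqP/rnorm0_eq0/eqP.
  rewrite eq_le rnorm_ge0 andbT; apply/ler_addgt0Pl => e e0; rewrite addr0.
  have e1 : 0 < e / (rnorm f + 1) by have nf := rnorm_ge0 f; pos.
  have [J1 _ hJ1] := hA 0 ltac:(by move=> i; rewrite mxE cabs0) _ e1.
  have [_ /op_leP /(_ f)] := hJ1 (multi0 |` J1)%fset (fsubsetU1 _ _).
  rewrite /= addr0 => h; apply: le_trans (_ : _ <= e / (rnorm f + 1) * rnorm f) _; last first.
    by rewrite mulrAC ler_pdivrMr; have := rnorm_ge0 f; nra.
  move: h; congr (_ <= _); congr (rnorm (_ - _)).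
  rewrite partial_sum_funE (bigD1_seq multi0) ?fset_uniq ?fset1U1//= big1 ?addr0.
    rewrite /cmonomial big1 ?scale1r// => i _; by rewrite ffunE expr0.
  move=> j j0; rewrite [X in X *: _](_ : _ = 0) ?scale0r//.
  have [i ji] : exists i, j i != 0%N.
    apply/existsP; apply: contraNT j0 => /existsPn h; apply/eqP/ffunP => i.
    by rewrite ffunE; apply/eqP; rewrite -[_ == _]negbK h.
  by rewrite /cmonomial (bigD1 i)//= mxE expr0n (negbTE ji) mul0r.
exists (r / 2), (C0 * (2 / r) * 2 ^+ d); split; first by pos.
  by rewrite /C0; pos.
move=> h x xs hx x0 f; apply/ler_addgt0Pl => e e0.
have e1 : 0 < e / (rnorm f + 1) by have nf := rnorm_ge0 f; pos.
have rs : r = s / 2 by [].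
have xs' : x < s by lra.
have [J1 _ hJ1] := hA h (fun i => le_lt_trans (hx i) xs') _ e1.
have [_ /op_leP /(_ f)] := hJ1 (multi0 |` J1)%fset (fsubsetU1 _ _).
set J := (_ |` _)%fset; have J0' : multi0 \in J by rewrite fset1U1.
have -> : (F (z0 + h) - partial_sum (fun j => cmonomial h j *: A j) J) f =
   (F (z0 + h) f - F z0 f) - \sum_(j <- J | j != multi0) cmonomial h j *: A j f.
  have -> : (F (z0 + h) - partial_sum (fun j => cmonomial h j *: A j) J) f =
    F (z0 + h) f - (partial_sum (fun j => cmonomial h j *: A j) J : B -> B) f by [].
  rewrite partial_sum_funE (bigD1_seq multi0) ?fset_uniq//= A0.
  rewrite [X in X *: _](_ : _ = 1).
    by rewrite -[(1 *: A multi0) f]/(1 *: A multi0 f) scale1r opprD addrA.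
  by rewrite /cmonomial big1// => i _; rewrite ffunE expr0.
move=> h1.
have h2 : rnorm (\sum_(j <- J | j != multi0) cmonomial h j *: A j f) <=
    C0 * (2 / r) * 2 ^+ d * x * rnorm f.
  apply: (le_trans (ler_rnorm_sum _ _ _)).
  apply: (@le_trans _ _ (\sum_(j <- J) (C0 * (2 * x / r) * rnorm f) * 2^-1 ^+ deg j)).
    rewrite [leRHS](bigID (fun j => j != multi0)) /= -[leLHS]addr0 lerD//; last first.
      apply: sumr_ge0 => j _; rewrite /C0; have nf := rnorm_ge0 f; pos.
    apply: ler_sum => j j0; rewrite rnormZ.
    apply: (@le_trans _ _ (x ^+ deg j * rnorm (A j f))).
      by rewrite ler_wpM2r ?rnorm_ge0// cmonomial_bound.
    have jd : (0 < deg j)%N by rewrite lt0n deg_eq0.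
    have -> : x ^+ deg j = (x / r) ^+ deg j * r ^+ deg j.
      by rewrite -exprMn divfK ?gt_eqF.
    have q0 : 0 <= x / r by pos.
    have q2 : x / r <= 2^-1 by rewrite ler_pdivrMr//; lra.
    (* As the degree is positive, one factor x / r is kept for the Lipschitz bound, and the others
       are replaced by 1/2 for summability. *)
    have q : (x / r) ^+ deg j <= (2 * x / r) * 2^-1 ^+ deg j.
      case: (deg j) jd => // n _; rewrite !exprS.
      have -> : 2 * x / r * (2^-1 * 2^-1 ^+ n) = x / r * 2^-1 ^+ n.
        by field; exact: lt0r_neq0.
      by rewrite ler_wpM2l// lerXn2r ?nnegrE.
    rewrite -mulrA; apply: (le_trans (ler_pM _ _ q (term j f))).
    - by rewrite exprn_ge0.
    - by rewrite mulr_ge0 ?exprn_ge0 ?rnorm_ge0// ltW.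
    - by rewrite le_eqVlt; apply/orP; left; apply/eqP; ring.
  rewrite -mulr_sumr.
  have := @sum_deg_le R 2^-1 d J _ _ (fset_uniq J) => /(_ ltac:(lra) ltac:(lra)).
  have -> : (1 - 2^-1 : R)^-1 = 2 by field.
  move=> h2; apply: (le_trans (ler_wpM2l _ h2)); first by rewrite /C0; have nf := rnorm_ge0 f; pos.
  by rewrite le_eqVlt; apply/orP; left; apply/eqP; field; exact: lt0r_neq0.
have h3 : e / (rnorm f + 1) * rnorm f <= e.
  by rewrite mulrAC ler_pdivrMr; have := rnorm_ge0 f; nra.
have := ler_rnormD (F (z0 + h) f - F z0 f - \sum_(j <- J | j != multi0) cmonomial h j *: A j f)
  (\sum_(j <- J | j != multi0) cmonomial h j *: A j f).
rewrite subrK; lra.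
Qed.

End Analytic.

(** * Compactness arguments over the torus *)

Section OperatorFields.
Variable R : realType.
Variable B : completeNormedModType R[i].
Variable d : nat.

Definition close (x : R) (u v : 'cV[R]_d) : Prop := forall i, `|u i 0 - v i 0| <= x.

(** A Lebesgue number argument: a property that holds near every point of the cube for all small
    parameters holds on the cube for one common parameter. The cube is handled as a product of
    segments in row vectors, whence the transposes. *)
Lemma cube_near_covering (P : R -> 'cV[R]_d -> Prop) :
  (forall u, cube u -> exists2 x, 0 < x & forall v y, close x v u -> 0 < y -> y <= x -> P y v) ->
  exists2 x, 0 < x & forall u, cube u -> P x u.
Proof.
move=> hP.
pose K := [set v : 'rV[R]_d | forall i, `[- pi, pi]%classic (v ord0 i)].
have cK : compact K by apply: (@rV_compact _ _ (fun=> `[- pi, pi]%classic)) => i; exact: segment_compact.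
have cov := (compact_near_coveringP K).1 cK R (0^'+) (fun y v => P y v^T) _.
have : \forall y \near 0^'+, K `<=` (fun v => P y v^T).
  apply: cov => v Kv.
  have [x x0 hx] : exists2 x, 0 < x & forall w y, close x w v^T -> 0 < y -> y <= x -> P y w.
    apply: hP => i; have := Kv i; rewrite /= in_itv /= ler_norml !mxE.
    by rewrite (ord1 0).
  exists (ball v x, [set y | 0 < y <= x]) => /=.
    split; first exact: nbhsx_ballx.
    near=> y; apply/andP; split; near: y.
      exact: nbhs_right_gt.
    exact: nbhs_right_le.
  move=> [w y] /= [vw /andP[y0 yx]]; apply: hx => // i.
  by rewrite !mxE distrC ltW//; case: vw => _ /(_ 0 i).
move=> h.
have [y [y0 hy]] := filter_ex (filterI (nbhs_right_gt (0 : R)) h).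
exists y => // u cu; have := hy u^T; rewrite trmxK; apply.
by move=> i /=; rewrite in_itv /= mxE -ler_norml.
Unshelve. all: end_near. Qed.

(** What analyticity at each point provides: points are compared with the centre [u] only, and
    radius and constant may depend on it. *)
Definition loc_lipschitz (F : 'cV[R]_d -> B -> B) : Prop :=
  forall u, exists s C : R, [/\ 0 < s, 0 <= C & forall v x, 0 <= x -> x <= s ->
    close x v u -> forall f, rnorm (F v f - F u f) <= C * x * rnorm f].

Lemma field_bounded (F : 'cV[R]_d -> B -> B) : loc_lipschitz F ->
  (forall u, exists c, op_le (F u) c) ->
  exists2 M : R, 0 <= M & forall u, cube u -> forall f, rnorm (F u f) <= M * rnorm f.
Proof.
move=> hF hb.
(* The single parameter of the covering lemma serves as radius and as reciprocal of the bound. *)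
have [|x x0 hx] := @cube_near_covering (fun y v => forall f, rnorm (F v f) <= y^-1 * rnorm f);
  last by exists x^-1; [rewrite invr_ge0 ltW | exact: hx].
move=> u cu; have [s [C [s0 C0 h]]] := hF u; have [c /op_leP hc] := hb u.
pose D : R := C * s + `|c| + s^-1.
have D0 : 0 < D.
  by rewrite /D ltr_wpDl// ?invr_gt0// addr_ge0// mulr_ge0// ltW.
exists D^-1; first by rewrite invr_gt0.
move=> v y vu y0 yD f.
have sD : s^-1 <= D by rewrite /D lerDr addr_ge0// mulr_ge0// ltW.
have Ds : D^-1 <= s by rewrite -[leRHS]invrK lef_pV2 ?posrE ?invr_gt0.
have h1 := h v D^-1 (ltW (lt_le_trans y0 yD)) Ds vu f.
have h2 := hc f; have h3 := ler_rnormD (F v f - F u f) (F u f).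
rewrite subrK in h3; have n0 := rnorm_ge0 f.
apply: (le_trans h3); apply: (@le_trans _ _ (D * rnorm f)).
  have : C * D^-1 * rnorm f <= C * s * rnorm f by rewrite ler_wpM2r// ler_wpM2l.
  have : c * rnorm f <= `|c| * rnorm f by rewrite ler_wpM2r// ler_norm.
  have : 0 <= s^-1 * rnorm f by rewrite mulr_ge0// invr_ge0 ltW.
  rewrite /D !mulrDl; lra.
by rewrite ler_wpM2r// -[leLHS]invrK lef_pV2 ?posrE ?invr_gt0.
Qed.

Lemma field_unif_continuous (F : 'cV[R]_d -> B -> B) (e : R) : loc_lipschitz F -> 0 < e ->
  exists2 x, 0 < x & forall u v, cube u -> close x v u ->
    forall f, rnorm (F v f - F u f) <= e * rnorm f.
Proof.
move=> hF e0.
have [|x x0 hx] := @cube_near_covering (fun y u => forall v, close y v u ->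
  forall f, rnorm (F v f - F u f) <= e * rnorm f); last first.
  by exists x => // u v cu vu f; exact: hx.
move=> u cu; have [s [C [s0 C0 h]]] := hF u.
pose x : R := Num.min (s / 2) (e / (4 * (C + 1))).
have x0 : 0 < x by rewrite lt_min; apply/andP; split; pos.
have xs : 2 * x <= s by have : x <= s / 2 by [rewrite ge_min lexx]; lra.
have xe : C * (2 * x) <= e / 2.
  have : x * (4 * (C + 1)) <= e by rewrite -ler_pdivlMr; [rewrite ge_min lexx orbT|lra].
  nra.
exists x => // v y vu y0 yx w wv f; have n0 := rnorm_ge0 f.
have h1 : rnorm (F v f - F u f) <= e / 2 * rnorm f.
  apply: (@le_trans _ _ (C * x * rnorm f)); first by apply: h; rewrite ?(ltW x0)//; lra.
  by rewrite ler_wpM2r//; nra.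
have h2 : rnorm (F w f - F u f) <= e / 2 * rnorm f.
  apply: (@le_trans _ _ (C * (2 * x) * rnorm f)); last by rewrite ler_wpM2r.
  apply: h => //; first lra.
  move=> i; have := wv i; have := vu i; have := ler_distD (v i 0) (w i 0) (u i 0); lra.
have := ler_rnorm_dist (F w f) (F u f) (F v f); rewrite (rnorm_distC (F u f)); lra.
Qed.

Definition unif_cont (G : 'cV[R]_d -> B) : Prop := forall e : R, 0 < e ->
  exists2 x, 0 < x & forall u v, cube u -> cube v -> close x u v -> rnorm (G u - G v) <= e.

Lemma unif_cont_field (F : 'cV[R]_d -> B -> B) (G : 'cV[R]_d -> B) : 
  (forall u, linear (F u)) -> (forall u, exists c, op_le (F u) c) ->
  loc_lipschitz F -> unif_cont G -> (exists M : R, forall u, cube u -> rnorm (G u) <= M) ->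
  unif_cont (fun u => F u (G u)).
Proof.
move=> lF bF lipF uG [M hM] e e0.
have [A A0 hA] := field_bounded lipF bF.
have M1 : 0 < `|M| + 1 by rewrite ltr_wpDl.
have e1 : 0 < e / 2 / (`|M| + 1) by pos.
have [x x0 hx] := field_unif_continuous lipF e1.
have e2 : 0 < e / 2 / (A + 1) by pos.
have [y y0 hy] := uG _ e2.
exists (Num.min x y); first by rewrite lt_min x0.
move=> u v cu cv uv.
have c1 : close x u v by move=> i; rewrite (le_trans (uv i))// ge_min lexx.
have c2 : close y u v by move=> i; rewrite (le_trans (uv i))// ge_min lexx orbT.
have FB w f g : F w (f - g) = F w f - F w g.
  by have := lF w (-1) g f; rewrite !scaleN1r => h; rewrite addrC h addrC.
have -> : F u (G u) - F v (G v) = (F u (G u) - F v (G u)) + F v (G u - G v).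
  by rewrite FB addrA subrK.
apply: (le_trans (ler_rnormD _ _)).
have h1 : rnorm (F u (G u) - F v (G u)) <= e / 2.
  apply: (le_trans (hx _ _ cv c1 _)); rewrite mulrAC ler_pdivrMr//.
  by rewrite ler_pM2l; [have := hM u cu; have := ler_norm M; lra|pos].
have h2 : rnorm (F v (G u - G v)) <= e / 2.
  apply: (le_trans (hA _ cv _)); apply: (le_trans (ler_wpM2l A0 (hy _ _ cu cv c2))).
  by rewrite mulrCA ger_pMr; [rewrite ler_pdivrMr; lra|pos].
lra.
Qed.

End OperatorFields.

(** * Riemann sums with values in a Banach space *)

Section Riemann.
Variable R : realType.
Variable B : completeNormedModType R[i].

Lemma sum_refine (V : nmodType) (p n : nat) (F : nat -> V) :
  \sum_(j < n * p) F j = \sum_(i < n) \sum_(r < p) F (i * p + r)%N.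
Proof.
rewrite -(big_mkord xpredT F) big_nat_mul big_mkord; apply: eq_bigr => i _.
rewrite mulSn addnC -{1}[(i * p)%N]add0n big_addn addKn big_mkord.
by apply: eq_bigr => r _; rewrite addnC.
Qed.

(** Each coarse grid point owns p^d fine ones, at distance at most [h] in each coordinate. Two
    functions [F] and [G] are allowed so that the induction can freeze different first
    coordinates. *)
Lemma gridsum_refine (V : normedModType R[i]) d (h e : R) (N p : nat) (F G : 'cV[R]_d -> V) :
  (0 < p)%N -> 0 < h ->
  (forall u v : 'cV[R]_d, (forall i, u i 0 \in grid (h / p%:R) (N * p)) ->
     (forall i, v i 0 \in grid h N) -> close h u v -> rnorm (F u - G v) <= e) ->
  rnorm (gridsum (grid (h / p%:R) (N * p)) F - (p%:R ^+ d : R[i]) *: gridsum (grid h N) G) <=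
  (p * (N + N))%:R ^+ d * e.
Proof.
move=> p0 h0; have pr : p%:R != 0 :> R by rewrite pnatr_eq0 -lt0n.
elim: d F G => [|d IH] F G FG.
  by rewrite /= !expr0 scale1r mul1r; apply: FG => -[].
rewrite /= !sum_grid -mulnDl (sum_refine p (N + N)
  (fun j => gridsum (grid (h / p%:R) (N * p)) (fun u => F (col_mx (h / p%:R * (j%:R - (N * p)%:R))%:M u)))).
rewrite exprS -scalerA scaler_sumr scaler_sumr -sumrB.
apply: (le_trans (ler_rnorm_sum _ _ _)).
rewrite exprS natrM [X in _ <= X](_ : _ = \sum_(i < N + N) (p%:R * ((p * (N + N))%:R ^+ d * e))); last first.
  by rewrite sumr_const card_ord -[_ *+ (N + N)]mulr_natl natrM; ring.
apply: ler_sum => i _.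
set Z := _ *: gridsum _ _; have -> : (p%:R : R[i]) *: Z = \sum_(r < p) Z.
  by rewrite sumr_const card_ord scaler_nat.
rewrite -sumrB.
apply: (le_trans (ler_rnorm_sum _ _ _)).
rewrite [X in _ <= X](_ : _ = \sum_(r < p) ((p * (N + N))%:R ^+ d * e)); last first.
  by rewrite sumr_const card_ord [LHS]mulr_natl.
apply: ler_sum => r _; apply: IH => u v us vs uv.
have rp := ltn_ord r.
apply: FG.
- apply: (@col_mx_forall _ (fun x => x \in grid (h / p%:R) (N * p))) => //.
  apply/mapP; exists (i * p + r)%N; last by rewrite natrM.
  rewrite mem_iota add0n /= -mulnDl.
  by rewrite (@leq_trans (i.+1 * p))%N ?leq_mul// mulSn addnC ltn_add2r.
- apply: (@col_mx_forall _ (fun x => x \in grid h N)) => //.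
  by apply/mapP; exists (i : nat) => //; rewrite mem_iota add0n /= ltn_ord.
- move=> k; rewrite !mxE; case: splitP => j _; last exact: uv.
  rewrite !mxE (ord1 j) eqxx !mulr1n natrD natrM.
  have -> : h / p%:R * (i%:R * p%:R + r%:R - N%:R * p%:R) - h * (i%:R - N%:R) = h * (r%:R / p%:R).
    by field.
  rewrite ger0_norm; last by rewrite mulr_ge0 ?divr_ge0// ltW.
  by rewrite ger_pMr// ler_pdivrMr ?ltr0n// mul1r ler_nat ltnW.
Qed.

Lemma gavg_refine (V : normedModType R[i]) d (e : R) (N p : nat) (F : 'cV[R]_d -> V) :
  (0 < p)%N -> (0 < N)%N ->
  (forall u v, cube u -> cube v -> close (pi / N%:R) u v -> rnorm (F u - F v) <= e) ->
  rnorm (gavg (N * p) F - gavg N F) <= e.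
Proof.
move=> p0 N0 hF; have Np : 0 < N%:R :> R by rewrite ltr0n.
have pp : 0 < p%:R :> R by rewrite ltr0n.
have h0 : 0 < pi / N%:R :> R by rewrite divr_gt0 ?pi_gt0.
have hh : pi / (N * p)%:R = pi / N%:R / p%:R :> R by rewrite natrM invfM mulrA.
have key : rnorm (gridsum (grid (pi / N%:R / p%:R) (N * p)) F -
   (p%:R ^+ d : R[i]) *: gridsum (grid (pi / N%:R) N) F) <= (p * (N + N))%:R ^+ d * e.
  apply: gridsum_refine => // u v us vs uv; apply: hF => // i.
    by apply: (@grid_cube _ (N * p)); rewrite hh.
  exact: grid_cube (vs i).
have -> : gavg (N * p) F - gavg N F = ((p * (N + N))%:R^-1 ^+ d : R[i]) *:
   (gridsum (grid (pi / N%:R / p%:R) (N * p)) F - (p%:R ^+ d : R[i]) *: gridsum (grid (pi / N%:R) N) F).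
  rewrite /gavg hh scalerBr scalerA -exprMn -mulnDl [(_ * p)%N]mulnC.
  congr (_ - _ *: _); congr (_ ^+ _); rewrite natrM invfM mulrAC mulVf ?mul1r//.
  by rewrite pnatr_eq0 -lt0n.
rewrite rnormZ cabsX cabsV cabs_nat exprVn mulrC ler_pdivrMr; last first.
  by rewrite exprn_gt0// ltr0n muln_gt0 p0 addn_gt0 N0.
by rewrite [leRHS]mulrC.
Qed.

(** The averages over N and M are compared through the common refinement N M; completeness then
    supplies the integral without constructing it. *)
Lemma gavg_tends_to d (F : 'cV[R]_d -> B) : unif_cont F -> exists l, tends_to (fun N => gavg N F) l.
Proof.
move=> uF; apply: cauchy_tends_to => e e0.
have e2 : 0 < e / 2 by pos.
have [x x0 hx] := uF _ e2.
pose N0 := (Num.truncn (pi / x)).+1.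
have hN0 N : (N0 <= N)%N -> pi / N%:R <= x.
  move=> N0N; have : pi / x < N%:R by rewrite (lt_le_trans (truncnS_gt _))// ler_nat.
  rewrite ltr_pdivrMr// => h; rewrite ler_pdivrMr; first by rewrite mulrC ltW.
  by rewrite ltr0n (leq_trans _ N0N).
exists N0 => N M hN hM.
have N1 : (0 < N)%N by rewrite (leq_trans _ hN).
have M1 : (0 < M)%N by rewrite (leq_trans _ hM).
have cl (n : nat) (u v : 'cV[R]_d) : (N0 <= n)%N -> close (pi / n%:R) u v -> close x u v.
  by move=> hn uv i; rewrite (le_trans (uv i))// hN0.
have h1 := @gavg_refine _ d (e / 2) N M F M1 N1
  (fun u v cu cv uv => hx u v cu cv (cl N u v hN uv)).
have h2 := @gavg_refine _ d (e / 2) M N F N1 M1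
  (fun u v cu cv uv => hx u v cu cv (cl M u v hM uv)).
have := ler_rnorm_dist (gavg N F) (gavg (N * M) F) (gavg M F).
rewrite (rnorm_distC (gavg N F) (gavg (N * M) F)); rewrite [(M * N)%N]mulnC in h2; lra.
Qed.

End Riemann.

(** * Convolution powers as iterated integrals *)

Section FiniteKernels.
Context (R : realType) (disp : measure_display) (X : measurableType disp).
Local Open Scope ereal_scope.

Section KSnd.
Variable K : R.-fker X ~> X.

(** [mkcomp] composes with a kernel that sees the starting point as well as the current one; here
    the starting point is forgotten. *)
Definition ksnd : (X * X)%type -> {measure set X -> \bar R} := fun z => K z.2.

Let measurable_ksnd U : measurable U -> measurable_fun setT (ksnd ^~ U).
Proof.
move=> mU; rewrite (_ : ksnd ^~ U = (fun y => K y U) \o snd)//.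
by apply: measurableT_comp => //; exact: (measurable_kernel K).
Qed.

HB.instance Definition _ := @isKernel.Build _ _ _ _ _ ksnd measurable_ksnd.

Let ksnd_uub : measure_fam_uub ksnd.
Proof. by have [r hr] := measure_uub K; exists r => -[x y]; exact: hr. Qed.

HB.instance Definition _ := @Kernel_isFinite.Build _ _ _ _ _ ksnd ksnd_uub.

End KSnd.

Section KBounded.
Variables (k : R.-ker X ~> X) (h : measure_fam_uub k).

(** An alias carrying the finite-kernel structure that the composition of kernels requires. *)
Definition kbounded of measure_fam_uub k : X -> {measure set X -> \bar R} := k.

HB.instance Definition _ := @isKernel.Build _ _ _ _ _ (kbounded h) (measurable_kernel k).
HB.instance Definition _ := @Kernel_isFinite.Build _ _ _ _ _ (kbounded h) h.

End KBounded.

Import KCOMP_FINITE_KERNEL.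

Lemma fker_comp (k l : R.-fker X ~> X) : exists K : R.-fker X ~> X, forall x,
  (K x = (fun A => \int[k x]_y l y A) :> (set X -> \bar R)) /\
  forall g, (forall y, 0 <= g y) -> measurable_fun setT g ->
    \int[K x]_y g y = \int[k x]_y \int[l y]_z g z.
Proof.
exists (mkcomp k (ksnd l)) => x; split=> // g g0 mg.
exact: (@integral_kcomp _ _ _ _ _ _ _ k (ksnd l)).
Qed.

Lemma fker_sum (I : Type) (s : seq I) (F : I -> R.-fker X ~> X) :
  exists K : R.-fker X ~> X, forall x,
  (K x = (fun A => \sum_(r <- s) F r x A) :> (set X -> \bar R)) /\
  forall g, (forall y, 0 <= g y) -> measurable_fun setT g ->
    \int[K x]_y g y = \sum_(r <- s) \int[F r x]_y g y.
Proof.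
elim: s => [|a s [K hK]].
  exists (@kzero _ _ X X R) => x; split=> [|g g0 mg].
    by apply/funext => A; rewrite big_nil.
  by rewrite big_nil; exact: integral_measure_zero.
exists (kadd (F a) K) => x; have [KE Kg] := hK x; split=> [|g g0 mg].
  by apply/funext => A; rewrite big_cons -[X in _ = _ + X](congr1 (fun f => f A) KE) -measure_addE.
by rewrite big_cons -Kg// -ge0_integral_measure_add.
Qed.

End FiniteKernels.

Lemma sume_sub (R : realType) (I : Type) (s : seq I) (A B : I -> \bar R) :
  (forall r, 0 <= B r)%E ->
  (\sum_(r <- s) (A r - B r) = \sum_(r <- s) A r - \sum_(r <- s) B r)%E.
Proof.
move=> B0; rewrite big_split /= -sumeN// => i j _ _.
by apply: ge0_adde_def; rewrite inE.
Qed.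

Section ConvolutionPowers.
Context (R : realType) (disp : measure_display) (X : measurableType disp) (d : nat).
Variable q : multi d -> R.-ker X ~> X.
Hypothesis hq : forall x, (\esum_(k in [set: multi d]) q k x setT = 1)%E.

Definition below (k : multi d) : {fset multi d} := fset_set [set r | multi_le r k].

Lemma finite_below (k : multi d) : finite_set [set r | multi_le r k].
Proof.
pose M := (\sum_i k i).+1.
pose phi (f : {ffun 'I_d -> 'I_M}) : multi d := [ffun i => f i : nat].
apply: (@sub_finite_set _ _ (phi @` setT)); last exact: finite_image.
move=> r /= /forallP rk.
have rM i : (r i < M)%N.
  by rewrite ltnS (leq_trans (rk i))// (bigD1 i)//= leq_addr.
by exists [ffun i => Ordinal (rM i)] => //; apply/ffunP => i; rewrite !ffunE.
Qed.

Lemma in_below (k r : multi d) : (r \in below k) = multi_le r k.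
Proof. by rewrite (in_fset_set (finite_below k)); apply/idP/idP; rewrite inE. Qed.

Lemma convpowS n k x : convpow q n.+1 k x =
  (fun A => \sum_(r <- below k) \int[q r x]_y convpow q n (multi_sub k r) y A)%E.
Proof. by apply/funext => A /=; rewrite fsbig_finite//; exact: finite_below. Qed.

Lemma finite_kernel_of : exists Q : multi d -> R.-fker X ~> X, forall r x,
  q r x = Q r x :> (set X -> \bar R).
Proof.
have le1 r x : (q r x setT <= 1)%E.
  rewrite -(hq x); apply: esum_ge; exists [set r]%fset => //=.
  by rewrite fsbig_set1.
have uub r : measure_fam_uub (q r).
  (* The mass is at most 1, but a strict upper bound is required. *)
  by exists 2 => x; rewrite (le_lt_trans (le1 r x))// lte_fin ltr1n.
by exists (fun r => kbounded (uub r)).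
Qed.

(** [convpow] is defined as a bare set function. Identifying it with a kernel makes the integration
    theorems available. *)
Lemma convpow_kernel n : exists K : multi d -> R.-fker X ~> X, forall k x,
  convpow q n k x = K k x :> (set X -> \bar R).
Proof.
have [Q hQ] := finite_kernel_of.
elim: n => [|n [K hK]].
  have md : measurable_fun [set: X] (id : X -> X) by exact: measurable_id.
  exists (fun k => if k == multi0 then (kdirac md : R.-fker X ~> X) else @kzero _ _ X X R).
  by move=> k x; apply/funext => A /=; case: ifP.
have /choice[K' hK'] (k : multi d) : exists K' : R.-fker X ~> X, forall x,
    convpow q n.+1 k x = K' x :> (set X -> \bar R).
  have /choice[C hC] (r : multi d) := fker_comp (Q r) (K (multi_sub k r)).
  have [S hS] := fker_sum (below k) C.
  exists S => x; rewrite (hS x).1 convpowS; apply/funext => A.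
  apply: eq_bigr => r _; rewrite (hC r x).1 hQ.
  by apply: eq_integral => y _; rewrite hK.
by exists K'.
Qed.

Lemma ge0_integral_convpow n k x (g : X -> \bar R) :
  (forall y, 0 <= g y)%E -> measurable_fun setT g ->
  (\int[convpow q n.+1 k x]_y g y =
   \sum_(r <- below k) \int[q r x]_y \int[convpow q n (multi_sub k r) y]_z g z)%E.
Proof.
move=> g0 mg.
have [Q hQ] := finite_kernel_of; have [K hK] := convpow_kernel n.
have /choice[C hC] (r : multi d) := fker_comp (Q r) (K (multi_sub k r)).
have [S hS] := fker_sum (below k) C.
have -> : convpow q n.+1 k x = S x.
  rewrite (hS x).1 convpowS; apply/funext => A.
  apply: eq_bigr => r _; rewrite (hC r x).1 hQ.
  by apply: eq_integral => y _; rewrite hK.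
rewrite (hS x).2//; apply: eq_bigr => r _; rewrite (hC r x).2// hQ.
by apply: eq_integral => y _; rewrite hK.
Qed.

Lemma measurable_integral_convpow n k (g : X -> \bar R) :
  (forall y, 0 <= g y)%E -> measurable_fun setT g ->
  measurable_fun setT (fun y => \int[convpow q n k y]_z g z)%E.
Proof.
move=> g0 mg; have [K hK] := convpow_kernel n.
under eq_fun do rewrite hK.
by apply: (measurable_fun_integral_kernel (measurable_kernel (K k))).
Qed.

(** Tonelli is applied to the positive and negative parts. Their integrals against the power n + 1
    are finite, and a finite sum of nonnegative terms has finite terms, so the subtraction meets no
    infinity. *)
Lemma integral_convpow n k x (u : X -> R) : measurable_fun setT u ->
  (forall n k x, (convpow q n k x).-integrable setT (EFin \o u)) ->
  (\int[convpow q n.+1 k x]_y (u y)%:E =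
   \sum_(r <- below k) \int[q r x]_y \int[convpow q n (multi_sub k r) y]_z (u z)%:E)%E /\
  forall r, r \in below k ->
    (q r x).-integrable setT (fun y => \int[convpow q n (multi_sub k r) y]_z (u z)%:E)%E.
Proof.
move=> mu iu.
pose up : X -> \bar R := (fun y => (EFin \o u)^\+ y)%E.
pose um : X -> \bar R := (fun y => (EFin \o u)^\- y)%E.
have meu : measurable_fun setT (EFin \o u) by exact/measurable_EFinP.
have mup : measurable_fun setT up by exact: measurable_funepos.
have mum : measurable_fun setT um by exact: measurable_funeneg.
have up0 y : (0 <= up y)%E by exact: funepos_ge0.
have um0 y : (0 <= um y)%E by exact: funeneg_ge0.
have fin n' k' x' : ((\int[convpow q n' k' x']_y up y)%E \is a fin_num) /\
    ((\int[convpow q n' k' x']_y um y)%E \is a fin_num).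
  have [K hK] := convpow_kernel n'; have := iu n' k' x'; rewrite hK => i.
  by split; [exact: integrable_pos_fin_num|exact: integrable_neg_fin_num].
have ge0 n' k' x' : (0 <= \int[convpow q n' k' x']_y up y)%E /\
    (0 <= \int[convpow q n' k' x']_y um y)%E.
  have [K hK] := convpow_kernel n'; rewrite hK.
  by split; apply: integral_ge0.
have E n' k' x' : (\int[convpow q n' k' x']_y (u y)%:E =
    \int[convpow q n' k' x']_y up y - \int[convpow q n' k' x']_y um y)%E.
  by have [K hK] := convpow_kernel n'; rewrite hK integralE.
have [fp fm] := fin n.+1 k x.
rewrite (ge0_integral_convpow n k x up0 mup) in fp.
rewrite (ge0_integral_convpow n k x um0 mum) in fm.
have sum_fin (G : multi d -> \bar R) : (forall r, 0 <= G r)%E ->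
    (\sum_(r <- below k) G r)%E \is a fin_num -> forall r, r \in below k -> G r \is a fin_num.
  move=> G0 sf r rk; rewrite ge0_fin_numE//.
  move: sf; rewrite ge0_fin_numE; last exact: sume_ge0.
  apply: le_lt_trans; rewrite (big_rem r rk) /= leeDl// sume_ge0//.
have ip r : r \in below k -> (q r x).-integrable setT
    (fun y => \int[convpow q n (multi_sub k r) y]_z up z)%E.
  move=> rk; apply/integrableP; split; first exact: measurable_integral_convpow.
  under eq_integral do rewrite gee0_abs ?(ge0 _ _ _).1//.
  rewrite -ge0_fin_numE; last by apply: integral_ge0 => y _; exact: (ge0 _ _ _).1.
  apply: (sum_fin _ _ fp) => // r'.
  by apply: integral_ge0 => y _; exact: (ge0 _ _ _).1.
have im r : r \in below k -> (q r x).-integrable setT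
    (fun y => \int[convpow q n (multi_sub k r) y]_z um z)%E.
  move=> rk; apply/integrableP; split; first exact: measurable_integral_convpow.
  under eq_integral do rewrite gee0_abs ?(ge0 _ _ _).2//.
  rewrite -ge0_fin_numE; last by apply: integral_ge0 => y _; exact: (ge0 _ _ _).2.
  apply: (sum_fin _ _ fm) => // r'.
  by apply: integral_ge0 => y _; exact: (ge0 _ _ _).2.
split; last first.
  move=> r rk; under eq_fun do rewrite E.
  by apply: integrableB; [exact: measurableT|exact: ip|exact: im].
rewrite E (ge0_integral_convpow n k x up0 mup) (ge0_integral_convpow n k x um0 mum).
rewrite [RHS](@eq_big_seq _ _ _ _ _ _ (fun r =>
    \int[q r x]_y \int[convpow q n (multi_sub k r) y]_z up z -
    \int[q r x]_y \int[convpow q n (multi_sub k r) y]_z um z)%E); last first.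
  move=> r rk; under eq_integral do rewrite E.
  by rewrite integralB//; [exact: ip|exact: im].
apply/esym/sume_sub => r; by apply: integral_ge0 => y _; exact: (ge0 _ _ _).2.
Qed.

End ConvolutionPowers.

(** * Fourier inversion of the twisted operators *)

Section Unconditional.
Variable R : realType.

Lemma sum_fsetU_disjoint (I : choiceType) (V : nmodType) (J K : {fset I}) (a : I -> V) :
  (forall j, j \in K -> j \notin J) ->
  \sum_(j <- (J `|` K)%fset) a j = \sum_(j <- J) a j + \sum_(j <- K) a j.
Proof.
move=> h; rewrite -big_cat; apply: perm_big; apply: uniq_perm.
- exact: fset_uniq.
- rewrite cat_uniq !fset_uniq andbT /=; apply/hasPn => j; exact: h.
- by move=> j; rewrite in_fsetU mem_cat.
Qed.

Lemma cvg_totallyP (I : choiceType) (a : I -> R[i]) (l : R[i]) :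
  partial_sum a @ totally --> l ->
  forall e : R, 0 < e -> exists J0 : {fset I}, forall J : {fset I}, (J0 `<=` J)%fset ->
    cabs (l - \sum_(j <- J) a j) <= e.
Proof.
move=> h e e0.
have /h [J0 _ hJ] : nbhs (l : R[i]^o) [set w : R[i]^o | rnorm ((l : R[i]^o) - w) < e].
  by apply/nbhs_rnormP; exists e.
exists J0 => J JJ; have := hJ J JJ; rewrite /= /partial_sum [\sum_(j <- J) a j]big_seq_fsetE.
exact: ltW.
Qed.

(* In R[i] unconditional convergence is absolute: split the real and the imaginary
   parts according to their signs. *)
Lemma unconditional_abs_tail (I : choiceType) (a : I -> R[i]) :
  cvg (partial_sum a @ totally) ->
  forall e : R, 0 < e -> exists J0 : {fset I}, forall J : {fset I},
    (forall j, j \in J -> j \notin J0) -> \sum_(j <- J) cabs (a j) <= e.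
Proof.
move=> ca e e0; have e8 : 0 < e / 8 by pos.
have [J0 hJ0] := cvg_totallyP ca e8; exists J0 => J disj.
have small (K : {fset I}) : (K `<=` J)%fset -> cabs (\sum_(j <- K) a j) <= e / 4.
  move=> KJ; have h1 := hJ0 _ (fsubset_refl J0); have h2 := hJ0 _ (fsubsetUl J0 K).
  have -> : \sum_(j <- K) a j = (lim (partial_sum a @ totally) - \sum_(j <- J0) a j) -
      (lim (partial_sum a @ totally) - \sum_(j <- (J0 `|` K)%fset) a j).
    rewrite sum_fsetU_disjoint; first by ring.
    by move=> j jK; exact: disj (fsubsetP KJ _ jK).
  by apply: (le_trans (ler_cabsB _ _)); lra.
have part (f : R[i] -> R) : (forall z, `|f z| <= cabs z) ->
    (forall K : {fset I}, f (\sum_(j <- K) a j) = \sum_(j <- K) f (a j)) ->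
    \sum_(j <- J) `|f (a j)| <= e / 2.
  move=> fle fsum.
  have sub (P : pred I) : ([fset j in J | P j] `<=` J)%fset by apply/fsubsetP => j; rewrite !inE => /andP[].
  have h1 := small _ (sub (fun j => 0 <= f (a j))).
  have h2 := small _ (sub (fun j => ~~ (0 <= f (a j)))).
  have g1 := le_trans (fle _) h1; have g2 := le_trans (fle _) h2.
  rewrite !fsum !big_fset /= in g1 g2.
  rewrite (bigID (fun j => 0 <= f (a j))) /=.
  rewrite (eq_bigr (fun j => f (a j))); last by move=> j; exact: ger0_norm.
  rewrite [X in _ + X](eq_bigr (fun j => - f (a j))); last first.
    by move=> j; rewrite -ltNge => /ltr0_norm.
  rewrite sumrN; move: g1 g2; rewrite !ler_norml => /andP[_ g1] /andP[g2 _]; lra.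
apply: (@le_trans _ _ (\sum_(j <- J) (`|complex.Re (a j)| + `|complex.Im (a j)|))).
  by apply: ler_sum => j _; exact: cabs_le_ReIm.
rewrite big_split /=.
have := part (@complex.Re R) (@cabs_Re R) (fun K => raddf_sum _ _ _ _).
have := part (@complex.Im R) (@cabs_Im R) (fun K => raddf_sum _ _ _ _).
lra.
Qed.

End Unconditional.

(** * Recovering the kernels and their powers from the twisted operators *)

Section Fourier.
Context (R : realType) (disp : measure_display) (X : measurableType disp) (d : nat).
Variable q : multi d -> R.-ker X ~> X.
Hypothesis hq : forall x, (\esum_(k in [set: multi d]) q k x setT = 1)%E.
Variables (B : completeNormedModType R[i]) (ev : B -> X -> R[i]).
Hypothesis ev_lin : forall (a : R[i]) f g x, ev (a *: f + g) x = a * ev f x + ev g x.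
Hypothesis ev_inj : injective ev.
Hypothesis ev_meas : forall f, cmeasurable (ev f).
Hypothesis ev_int : forall n k x f, cintegrable (convpow q n k x) (ev f).
Hypothesis ev_cont : forall x, continuous (fun f : B => cintegral (convpow q 0 multi0 x) (ev f)).
Variable eta : R.
Hypothesis eta0 : 0 < eta.
Hypothesis hS3 : forall z, strip eta z -> Q_acts_boundedly ev q z /\ op_analytic_at (Qop ev q) z.

Lemma elt_spec g : belongs ev g -> ev (elt ev g) = g.
Proof. by move=> [b bg]; rewrite /elt; case: xgetP => [b' _ //|/(_ b)]; rewrite /= bg. Qed.

Lemma elt_ev f : elt ev (ev f) = f.
Proof. by apply: ev_inj; apply: elt_spec; exists f. Qed.

Lemma cintegral_dirac x f : cintegral (convpow q 0 multi0 x) (ev f) = ev f x.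
Proof.
have [mr mi] := ev_meas f.
have -> : convpow q 0 multi0 x = \d_x :> (set X -> \bar R).
  by apply/funext => A; rewrite /= eqxx.
rewrite /cintegral !integral_dirac//=; [|exact/measurable_EFinP|exact/measurable_EFinP].
by rewrite indicT !mul1r; case: (ev f x).
Qed.

(** Evaluation at [x] is integration against the Dirac mass [convpow q 0 multi0 x], so it is
    continuous on B. Limits taken in B can therefore be identified pointwise. *)
Lemma ev_bounded x : exists2 C : R, 0 <= C & forall f, cabs (ev f x) <= C * rnorm f.
Proof.
have [|C C0 h] := @continuous_scalar_bounded R B (fun f => ev f x) (fun a f g => ev_lin a f g x).
  rewrite (_ : (fun f => ev f x) = fun f => cintegral (convpow q 0 multi0 x) (ev f)); first exact: ev_cont.
  by apply/funext => f; rewrite cintegral_dirac.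
by exists C.
Qed.

Lemma ev_sub f g x : ev (f - g) x = ev f x - ev g x.
Proof. by rewrite addrC -scaleN1r ev_lin mulN1r addrC. Qed.

Lemma ev_scale a f x : ev (a *: f) x = a * ev f x.
Proof.
have e0 : ev 0 x = 0 by have := ev_sub 0 0 x; rewrite !subrr.
by rewrite -[a *: f]addr0 ev_lin e0 addr0.
Qed.

Lemma ev_sum (I : Type) (s : seq I) (P : pred I) (F : I -> B) x :
  ev (\sum_(i <- s | P i) F i) x = \sum_(i <- s | P i) ev (F i) x.
Proof.
have e0 : ev 0 x = 0 by have := ev_sub 0 0 x; rewrite !subrr.
by apply: (big_morph (fun f => ev f x)) => // f g; rewrite -[f in LHS]scale1r ev_lin mul1r.
Qed.

Lemma tends_to_ev (u : nat -> B) l x : tends_to u l ->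
  @tends_to R R[i]^o (fun N => ev (u N) x) (ev l x).
Proof.
have [C C0 h] := ev_bounded x.
exact: (@tends_to_lin _ _ R[i]^o (fun f => ev f x) C) (fun f g => ev_sub f g x) h.
Qed.

Lemma strip_cvec (z u : 'cV[R]_d) : norm1 z < eta -> strip eta (cvec z u).
Proof. by rewrite /strip /= /norm1; under [X in _ -> X < _]eq_bigr do rewrite mxE /=. Qed.

Section FixedTilt.
Variable z : 'cV[R]_d.
Hypothesis hz : norm1 z < eta.
Let T (u : 'cV[R]_d) : B -> B := Qop ev q (cvec z u).

Lemma ev_Qop u f : ev (T u f) = Qfun q (cvec z u) (ev f).
Proof. by have [[_ hb _] _] := hS3 (strip_cvec u hz); exact: elt_spec. Qed.

Lemma Qop_linear u : linear (T u).
Proof. by have [[_ _ [hl _]] _] := hS3 (strip_cvec u hz); exact: hl. Qed.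

Lemma Qop_bounded u : exists c, op_le (T u) c.
Proof. by have [[_ _ [_ hc]] _] := hS3 (strip_cvec u hz); exact: hc. Qed.

Lemma Qop_loc_lipschitz : loc_lipschitz T.
Proof.
move=> u; have [_ /op_analytic_lipschitz[s [C [s0 C0 h]]]] := hS3 (strip_cvec u hz).
exists s, C; split=> // v x x0 xs vu f.
have E : cvec z v = cvec z u + cvec 0 (v - u).
  apply/colP => i; rewrite !mxE; apply/eqP; rewrite eq_complex /= addr0 eqxx /=.
  by rewrite addrCA subrr addr0.
rewrite /T E; apply: h => // i; rewrite !mxE.
have -> : cabs (0 +i* (v i 0 - u i 0)) = `|v i 0 - u i 0|.
  by rewrite cabs_normE /= expr0n add0r sqrtr_sqr.
exact: vu.
Qed.

Lemma phase_mul l k r u : phase z l k u * cexp (cdot (cvec z u) r) =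
  phase z [ffun i => (l i + r i)%N] k u.
Proof.
rewrite /phase -cexpD; congr cexp; rewrite addrAC; congr (_ - _).
by rewrite /cdot -big_split; apply: eq_bigr => i _; rewrite ffunE natrD mulrDr.
Qed.

Lemma phase_loc_lipschitz l k : loc_lipschitz (fun u (f : B) => phase z l k u *: f).
Proof.
move=> u; pose D : R := \sum_i ((l i)%:R + (k i)%:R).
have D0 : 0 <= D by apply: sumr_ge0 => i _; rewrite addr_ge0.
pose E := expR (rdot z l - rdot z k).
exists (2 * (D + 1))^-1, (4 * E * D); split.
- by rewrite invr_gt0; pos.
- by rewrite /E; pos.
move=> v x x0 xs vu f; rewrite -scalerBl rnormZ; apply: ler_wpM2r; first exact: rnorm_ge0.
pose w : R[i] := \sum_i (0 +i* ((v i 0 - u i 0) * ((l i)%:R - (k i)%:R))).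
have -> : phase z l k v - phase z l k u = phase z l k u * (cexp w - 1).
  rewrite mulrBr mulr1 !phase_prod /w cexp_sum -big_split /=; congr (_ - _).
  apply: eq_bigr => i _; rewrite -cexpD; congr cexp.
  rewrite -!(rmorph_nat (real_complex R)) -rmorphB.
  by apply/eqP; rewrite eq_complex /=; apply/andP; split; apply/eqP; ring.
rewrite cabsM cabs_phase -/E.
have wx : cabs w <= D * x.
  rewrite (le_trans (ler_cabs_sum _ _ _))// /D mulr_suml; apply: ler_sum => i _.
  rewrite cabs_normE /= expr0n add0r sqrtr_sqr normrM mulrC; apply: ler_pM => //.
  by rewrite (le_trans (ler_normB _ _))// !normr_nat.
have Dx : D * x <= 2^-1.
  apply: (@le_trans _ _ (D * (2 * (D + 1))^-1)); first by rewrite ler_wpM2l.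
  by rewrite ler_pdivrMr; [lra|pos].
have w2 : cabs w <= 2^-1 by rewrite (le_trans wx).
have := cexp_taylor w2; have := ler_cabsD (cexp w - 1 - w) w; rewrite subrK.
have := cabs_ge0 w => w0 h1 h2.
have : cabs (cexp w - 1) <= 4 * cabs w by nra.
move=> h3; rewrite [4 * E]mulrC -!mulrA ler_wpM2l ?expR_ge0//; nra.
Qed.

Lemma unif_cont_cst (f : B) : unif_cont (fun _ : 'cV[R]_d => f).
Proof. by move=> e e0; exists 1 => // u v _ _ _; rewrite subrr rnorm0 ltW. Qed.

Lemma unif_cont_iter n f : unif_cont (fun u => iter n (T u) f) /\
  exists M : R, forall u, cube u -> rnorm (iter n (T u) f) <= M.
Proof.
elim: n => [|n [IH [M hM]]] /=.
  by split; [exact: unif_cont_cst | exists (rnorm f)].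
split.
  apply: (@unif_cont_field _ _ _ T (fun u => iter n (T u) f)) => //.
  - exact: Qop_linear.
  - exact: Qop_bounded.
  - exact: Qop_loc_lipschitz.
  - by exists M.
have [A A0 hA] := field_bounded Qop_loc_lipschitz Qop_bounded.
exists (A * M) => u cu; rewrite (le_trans (hA _ cu _))// ler_wpM2l//.
exact: hM.
Qed.

Lemma unif_cont_phase_iter l k n f : unif_cont (fun u => phase z l k u *: iter n (T u) f).
Proof.
have [uc [M hM]] := unif_cont_iter n f.
apply: (@unif_cont_field _ _ _ (fun u (f : B) => phase z l k u *: f) (fun u => iter n (T u) f)) => //.
- by move=> u a g h; rewrite scalerDr !scalerA [a * _]mulrC.
- move=> u; exists (expR (rdot z l - rdot z k)); apply/op_leP => g.
  by rewrite rnormZ cabs_phase.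
- exact: phase_loc_lipschitz.
- by exists M.
Qed.

Lemma cabs_Qterm u f x k :
  cabs (Qterm q (cvec z u) (ev f) x k) = cabs (Qterm q (cvec z 0) (ev f) x k).
Proof.
rewrite /Qterm cabsM cabs_cexp [RHS]cabsM [in RHS]cabs_cexp; congr (expR _ * _).
rewrite /cdot !raddf_sum; apply: eq_bigr => i _; rewrite !mxE.
by rewrite -(rmorph_nat (real_complex R)) /=; ring.
Qed.

(* Only the modulus of the terms of Q_z f x depends on Re z, so one finite set
   controls the tails for all imaginary parts at once. *)
Lemma gavg_Qfun_tends_to f x k :
  @tends_to R R[i]^o (fun N => gavg N (fun u => (phase z multi0 k u * ev (T u f) x : R[i]^o)))
    (cintegral (q k x) (ev f)).
Proof.
have Qm u : Qmeaningful q (cvec z u) (ev f) x by have [[]] := hS3 (strip_cvec u hz).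
move=> e e0; pose E := expR (rdot z multi0 - rdot z k).
have E0 : 0 < E by exact: expR_gt0.
have e1 : 0 < e / (E * 2) by pos.
have [J1 hJ1] := unconditional_abs_tail (Qm 0).2 e1.
pose J0 := (k |` J1)%fset.
have [N0 [N00 hN0]] : exists N0, (0 < N0)%N /\ forall j, j \in J0 -> forall i, (j i < N0)%N.
  exists (\sum_(j <- J0) deg j).+1; split=> // j js i.
  rewrite ltnS (big_rem j js) /= (leq_trans _ (leq_addr _ _))//.
  by rewrite /deg (bigD1 i)//= leq_addr.
exists N0 => N hN; have Np : (0 < N)%N := leq_trans N00 hN.
have tail u : cabs (ev (T u f) x - \sum_(j <- J0) Qterm q (cvec z u) (ev f) x j) <= e / E.
  rewrite ev_Qop /Qfun; have [J2 hJ2] := cvg_totallyP (Qm u).2 e1.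
  have h1 := hJ2 (J2 `|` J0)%fset (fsubsetUl _ _).
  have h2 : cabs (\sum_(j <- (J2 `\` J0)%fset) Qterm q (cvec z u) (ev f) x j) <= e / (E * 2).
    rewrite (le_trans (ler_cabs_sum _ _ _))// (eq_bigr _ (fun j _ => cabs_Qterm u f x j)).
    apply: hJ1 => j; rewrite in_fsetD => /andP[jJ _].
    by apply: contra jJ => jJ; rewrite /J0 in_fset1U jJ orbT.
  have s : \sum_(j <- (J2 `|` J0)%fset) Qterm q (cvec z u) (ev f) x j =
    \sum_(j <- (J2 `\` J0)%fset) Qterm q (cvec z u) (ev f) x j + \sum_(j <- J0) Qterm q (cvec z u) (ev f) x j.
    rewrite addrC -sum_fsetU_disjoint.
      apply: perm_big; apply: uniq_perm; rewrite ?fset_uniq// => j; rewrite !inE.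
      by case: (j \in J2); case: (j == k); case: (j \in J1).
    by move=> j; rewrite in_fsetD => /andP[].
  rewrite s in h1; set A := \sum_(j <- J0) _ in h1 *; set D := \sum_(j <- _) _ in h1 h2.
  set l := lim _ in h1 *.
  have := ler_cabsD (l - (D + A)) D; rewrite (_ : l - (D + A) + D = l - A); last by ring.
  by rewrite (_ : e / E = e / (E * 2) + e / (E * 2)); [lra|field; exact: lt0r_neq0].
have exact_sum : @gavg R R[i]^o d N (fun u => phase z multi0 k u *
    \sum_(j <- J0) Qterm q (cvec z u) (ev f) x j) = cintegral (q k x) (ev f).
  rewrite (@gavg_eq _ R[i]^o _ _ _ (fun u => \sum_(j <- J0)
     (cintegral (q j x) (ev f) * phase z j k u : R[i]^o))); last first.
    move=> u _; rewrite mulr_sumr; apply: eq_bigr => j _.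
    rewrite /Qterm mulrA mulrC; congr (_ * _); rewrite phase_mul.
    have -> : [ffun i => (@multi0 d i + j i)%N] = j by apply/ffunP => i; rewrite !ffunE.
    by [].
  rewrite gavg_sum (bigD1_seq k) ?fset_uniq ?fset1U1//=.
  have phz j : j \in J0 -> @gavg R R[i]^o d N (fun u => (cintegral (q j x) (ev f) * phase z j k u : R[i]^o)) =
     cintegral (q j x) (ev f) * (if j == k then 1 else 0).
    move=> jJ; rewrite -(@gavg_phase R d z j k N Np).
    - apply/esym; apply: (@gavg_lin R R[i]^o R[i]^o d N (fun y => cintegral (q j x) (ev f) * y)).
      by move=> a y1 y2; rewrite /GRing.scale /=; ring.
    - by move=> i; rewrite (leq_trans (hN0 j jJ i))// (leq_trans hN)// leq_addr.
    - by move=> i; rewrite (leq_trans (hN0 k (fset1U1 _ _) i))// (leq_trans hN)// leq_addr.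
  rewrite phz ?fset1U1// eqxx mulr1 big_seq_cond big1 ?addr0// => j /andP[jJ jk].
  by rewrite phz// (negbTE jk) mulr0.
rewrite -exact_sum -gavgB; apply: rnorm_gavg_le => // u _.
rewrite rnorm_cabs -mulrBr cabsM cabs_phase -/E.
by apply: (le_trans (ler_wpM2l (ltW E0) (tail u))); rewrite mulrC divfK ?gt_eqF.
Qed.

(** The averages converge in B by uniform continuity, and at each point to the integral against q_k;
    continuity of evaluations makes the two limits agree. Thus q_k maps B to itself. *)
Lemma kernel_belongs f k : exists b, ev b = (fun x => cintegral (q k x) (ev f)) /\
  tends_to (fun N => gavg N (fun u => phase z multi0 k u *: T u f)) b.
Proof.
have [b hb] := gavg_tends_to (unif_cont_phase_iter multi0 k 1 f).
exists b; split=> //; apply/funext => x.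
apply: (tends_to_unique (tends_to_ev x hb)).
apply: tends_to_eq (gavg_Qfun_tends_to f x k); exists 0%N => N _.
rewrite (@gavg_lin R B R[i]^o d N (fun f => ev f x)).
  by apply: gavg_eq => u _; rewrite ev_scale.
by move=> a f1 f2; rewrite ev_lin.
Qed.

End FixedTilt.

Lemma norm1_0 : norm1 (0 : 'cV[R]_d) < eta.
Proof. by rewrite /norm1 big1// => i _; rewrite mxE normr0. Qed.

Definition qB (k : multi d) (f : B) : B := elt ev (fun x => cintegral (q k x) (ev f)).

Lemma ev_qB k f : ev (qB k f) = fun x => cintegral (q k x) (ev f).
Proof. by have [b [hb _]] := kernel_belongs norm1_0 f k; apply: elt_spec; exists b. Qed.

(** The limit is the same for every tilt [z], by injectivity of [ev]. This is what allows the tilt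
    to be chosen later in terms of k, n and a. *)
Lemma qB_tends_to z k f : norm1 z < eta ->
  tends_to (fun N => gavg N (fun u => phase z multi0 k u *: Qop ev q (cvec z u) f)) (qB k f).
Proof.
move=> hz; have [b [hb tb]] := kernel_belongs hz f k.
by rewrite (_ : qB k f = b)//; apply: ev_inj; rewrite ev_qB hb.
Qed.

Lemma qB_linear k : linear (qB k).
Proof.
move=> a f g; apply: (tends_to_unique (qB_tends_to k (a *: f + g) norm1_0)).
have h1 := qB_tends_to k f norm1_0; have h2 := qB_tends_to k g norm1_0.
have h3 := @tends_to_lin _ _ _ (fun x : B => a *: x) (cabs a) _ _ (fun x y => scalerBr a x y)
  (fun x => eq_ind_r (fun t => t <= _) (lexx _) (rnormZ a x)) h1.
apply: tends_to_eq (tends_toD h3 h2); exists 0%N => N _.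
rewrite (@gavg_lin R B B d N (fun x => a *: x)); last first.
  by move=> b x y; rewrite scalerDr !scalerA mulrC.
rewrite -scalerDr -gridsumD; congr (_ *: _); apply: eq_gridsum => u _.
by rewrite (Qop_linear norm1_0) scalerDr !scalerA [a * _]mulrC.
Qed.

Lemma rdot_multi0 (z : 'cV[R]_d) : rdot z multi0 = 0.
Proof. by rewrite /rdot big1// => i _; rewrite ffunE mulr0. Qed.

(** The Cauchy estimate for the coefficient of index k, the tilt playing the role of the radius. *)
Lemma qB_bound z : norm1 z < eta ->
  exists2 M : R, 0 <= M & forall k f, rnorm (qB k f) <= M * expR (- rdot z k) * rnorm f.
Proof.
move=> hz; have [M M0 hM] := field_bounded (Qop_loc_lipschitz hz) (Qop_bounded hz).
exists M => // k f; apply: tends_to_norm_le (qB_tends_to k f hz); exists 1%N => N N0.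
apply: rnorm_gavg_le => // u cu; rewrite rnormZ cabs_phase rdot_multi0 sub0r.
by rewrite [M * _]mulrC -mulrA ler_wpM2l ?expR_ge0// hM.
Qed.

(** Sized so that a vector with all [d] coordinates at most this large stays in the strip, by
    [small_norm1]. *)
Definition tilt_radius : R := eta / (2 * (d%:R + 1)).

Lemma tilt_radius_gt0 : 0 < tilt_radius.
Proof. by rewrite /tilt_radius; pos. Qed.

Lemma small_norm1 (z : 'cV[R]_d) : (forall i, `|z i 0| <= tilt_radius) -> norm1 z < eta.
Proof.
move=> h; apply: (@le_lt_trans _ _ (\sum_(i < d) tilt_radius)); first exact: ler_sum.
rewrite sumr_const card_ord -mulr_natl mulrA ltr_pdivrMr; last by pos.
have : 0 <= d%:R * eta by rewrite mulr_ge0 ?ler0n// ltW.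
by move: eta0; lra.
Qed.

Lemma qB_bound_deg : exists2 M : R, 0 <= M &
  forall k f, rnorm (qB k f) <= M * expR (- tilt_radius) ^+ deg k * rnorm f.
Proof.
have [|M M0 hM] := @qB_bound (const_mx tilt_radius).
  by apply: small_norm1 => i; rewrite mxE ger0_norm// ltW// tilt_radius_gt0.
exists M => // k f; rewrite (le_trans (hM k f))// ler_wpM2r ?rnorm_ge0// ler_wpM2l//.
rewrite -expRM_natl ler_expR le_eqVlt; apply/orP; left; apply/eqP.
rewrite mulrN; congr (- _); rewrite /rdot /deg natr_sum mulr_suml.
by apply: eq_bigr => i _; rewrite mxE mulrC.
Qed.

Definition cst_multi (M : nat) : multi d := [ffun=> M].

Lemma geometric_small (y C e : R) : 0 <= y -> y < 1 -> 0 < e ->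
  exists M0, forall M, (M0 <= M)%N -> C * y ^+ M <= e.
Proof.
move=> y0 y1 e0; have C1 : 0 < `|C| + 1 by rewrite ltr_wpDl.
have : (fun n => y ^+ n) @ \oo --> (0 : R) by apply: cvg_expr; rewrite ger0_norm.
move=> /cvgrPdist_le /(_ _ (divr_gt0 e0 C1))[M0 _ hM]; exists M0 => M /hM /=.
rewrite sub0r normrN ger0_norm ?exprn_ge0// => h.
apply: (@le_trans _ _ ((`|C| + 1) * y ^+ M)).
  by rewrite ler_wpM2r ?exprn_ge0//; have := ler_norm C; lra.
by rewrite mulrC -ler_pdivlMr.
Qed.

Lemma cabs_cexp_cdot (z u : 'cV[R]_d) r :
  cabs (cexp (cdot (cvec z u) r)) = expR (rdot z r).
Proof.
have := cabs_phase z r multi0 u; rewrite rdot_multi0 subr0 => <-; congr (cabs (cexp _)).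
by rewrite [X in _ - X](_ : _ = 0) ?subr0// /cdot big1// => i _; rewrite ffunE mulr0.
Qed.

(* The tilt by [tilt_radius] in every direction bounds |q_k| by a geometric sequence,
   so the power series of Q_z converges in operator norm. *)
Lemma Qop_expand : exists C y : R, [/\ 0 <= C, 0 <= y, y < 1 & forall z u : 'cV[R]_d,
  (forall i, `|z i 0| <= tilt_radius / 2) -> forall M f,
  rnorm (Qop ev q (cvec z u) f -
    \sum_(r <- below (cst_multi M)) cexp (cdot (cvec z u) r) *: qB r f) <= C * y ^+ M * rnorm f].
Proof.
have [A A0 hA] := qB_bound_deg; have r0 := tilt_radius_gt0.
(* A tilt by at most half the radius leaves a decay exp (- tilt_radius / 2) per unit of degree, that
   is y^2: one factor [y] gives the tail bound and the other the summability over r. *)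
pose y := expR (- (tilt_radius / 4)).
have y0 : 0 <= y by exact: expR_ge0.
have y1 : y < 1 by rewrite expR_lt1; lra.
exists (A * (1 - y)^-1 ^+ d), y; split=> //.
  by rewrite mulr_ge0// exprn_ge0// invr_ge0; lra.
move=> z u hz M f; have zeta : norm1 z < eta.
  by apply: small_norm1 => i; have := hz i; lra.
pose S M := \sum_(r <- below (cst_multi M)) cexp (cdot (cvec z u) r) *: qB r f.
have term r : rnorm (cexp (cdot (cvec z u) r) *: qB r f) <= A * rnorm f * (y ^+ deg r * y ^+ deg r).
  rewrite rnormZ cabs_cexp_cdot.
  have h1 : expR (rdot z r) <= expR (tilt_radius / 2) ^+ deg r.
    rewrite -expRM_natl ler_expR /rdot /deg natr_sum mulr_suml; apply: ler_sum => i _.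
    by rewrite mulrC ler_wpM2l// (le_trans (ler_norm _)).
  have -> : A * rnorm f * (y ^+ deg r * y ^+ deg r) =
    expR (tilt_radius / 2) ^+ deg r * (A * expR (- tilt_radius) ^+ deg r * rnorm f).
    have -> : y ^+ deg r * y ^+ deg r = expR (tilt_radius / 2) ^+ deg r * expR (- tilt_radius) ^+ deg r.
      by rewrite -!exprMn -!expRD; congr (expR _ ^+ _); lra.
    ring.
  by apply: ler_pM; rewrite ?expR_ge0 ?rnorm_ge0.
have cauchy : forall M N, (M <= N)%N -> rnorm (S N - S M) <= A * (1 - y)^-1 ^+ d * y ^+ M * rnorm f.
  move=> {}M N MN.
  have -> : S N - S M = \sum_(r <- (below (cst_multi N) `\` below (cst_multi M))%fset)
      cexp (cdot (cvec z u) r) *: qB r f.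
    apply/eqP; rewrite subr_eq addrC -sum_fsetU_disjoint; last first.
      by move=> r; rewrite in_fsetD => /andP[].
    apply/eqP/perm_big; apply: uniq_perm; rewrite ?fset_uniq// => r.
    rewrite in_fsetU in_fsetD !in_below; case: (boolP (multi_le r (cst_multi M))) => //= /forallP h.
    by apply/forallP => i; rewrite (leq_trans (h i))// !ffunE.
  rewrite (le_trans (ler_rnorm_sum _ _ _))//.
  apply: (@le_trans _ _ (\sum_(r <- (below (cst_multi N) `\` below (cst_multi M))%fset)
      A * rnorm f * y ^+ M * y ^+ deg r)).
    rewrite [leLHS]big_seq_cond [leRHS]big_seq_cond; apply: ler_sum => r.
    rewrite in_fsetD in_below andbT => /andP[rM _].
    rewrite (le_trans (term r))// !mulrA ler_wpM2r ?exprn_ge0//.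
    rewrite ler_wpM2l ?mulr_ge0 ?rnorm_ge0// ler_wiXn2l ?(ltW y1)//.
    rewrite leqNgt; apply: contra rM => rM; apply/forallP => i; rewrite ffunE.
    by rewrite (leq_trans _ (ltnW rM))// /deg (bigD1 i)//= leq_addr.
  rewrite -mulr_sumr.
  have := sum_deg_le (s := (below (cst_multi N) `\` below (cst_multi M))%fset) y0 y1 (fset_uniq _).
  move=> h; rewrite [leRHS](_ : _ = A * rnorm f * y ^+ M * (1 - y)^-1 ^+ d); last by ring.
  by rewrite ler_wpM2l// !mulr_ge0 ?rnorm_ge0 ?exprn_ge0.
have [g Sg] : exists g, tends_to S g.
  apply: cauchy_tends_to => e e0.
  have [M0 hM0] := geometric_small (A * (1 - y)^-1 ^+ d * rnorm f) y0 y1 (divr_gt0 e0 (ltr0n R 2)).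
  have close_M N : (M0 <= N)%N -> rnorm (S N - S M0) <= e / 2.
    move=> /cauchy h; rewrite (le_trans h)//; have := hM0 _ (leqnn M0); lra.
  exists M0 => N N' hN hN'; have := close_M _ hN; have := close_M _ hN'.
  have := ler_rnormB (S N - S M0) (S N' - S M0).
  by rewrite opprB addrA subrK; lra.
(* The boxes exhaust the index set, so at each point the limit of the box sums is the unconditional
   sum defining Q_z f. *)
have <- : g = Qop ev q (cvec z u) f.
  apply: ev_inj; apply/funext => x; apply: (tends_to_unique (tends_to_ev x Sg)).
  have [[Qm _ _] _] := hS3 (strip_cvec u zeta).
  move=> e e0; have [J0 hJ0] := cvg_totallyP (Qm f x).2 e0.
  exists (\sum_(j <- J0) deg j)%N => N hN.
  rewrite rnorm_distC rnorm_cabs (ev_Qop zeta) ev_sum.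
  have -> : \sum_(r <- below (cst_multi N)) ev (cexp (cdot (cvec z u) r) *: qB r f) x =
     \sum_(r <- below (cst_multi N)) Qterm q (cvec z u) (ev f) x r.
    by apply: eq_bigr => r _; rewrite ev_scale ev_qB.
  apply: hJ0; apply/fsubsetP => j jJ; rewrite in_below; apply/forallP => i; rewrite ffunE.
  rewrite (leq_trans _ hN)// (big_rem j jJ) /= (leq_trans _ (leq_addr _ _))//.
  by rewrite /deg (bigD1 i)//= leq_addr.
apply: (tends_to_norm_le _ (tends_toD Sg (tends_to_cst (- S M)))).
by exists M => N; exact: cauchy.
Qed.

(** The recursion of [convpow] transported to B, where it can be compared with iterates of Q_z;
    [ev_qn] identifies it with integration against the convolution powers. *)
Fixpoint qn (n : nat) (k : multi d) (f : B) : B :=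
  if n is n'.+1 then \sum_(r <- below k) qB r (qn n' (multi_sub k r) f)
  else if k == multi0 then f else 0.

Lemma qB0 k : qB k 0 = 0.
Proof. by have := qB_linear k (-1) 0 0; rewrite scaler0 addr0 scaleN1r addNr. Qed.

Definition multi_add (l r : multi d) : multi d := [ffun i => (l i + r i)%N].

(** If l <= k, the condition l + r <= k means r <= k - l, and a box containing k loses none of these
    r; otherwise no r qualifies. *)
Lemma sum_below_shift (V : nmodType) (M : nat) (k l : multi d) (F : multi d -> V) :
  (forall i, (k i <= M)%N) ->
  \sum_(r <- below (cst_multi M)) (if multi_le (multi_add l r) k then F r else 0) =
  if multi_le l k then \sum_(r <- below (multi_sub k l)) F r else 0.
Proof.
move=> kM; rewrite -big_mkcond -big_filter; case: ifPn => [/forallP lk|lk].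
  apply: perm_big; apply: uniq_perm; rewrite ?filter_uniq ?fset_uniq// => r.
  rewrite mem_filter !in_below; apply/andP/forallP => [[/forallP h1 _] i|h].
    by have := h1 i; rewrite !ffunE leq_subRL// lk.
  split; apply/forallP => i; have := h i; rewrite !ffunE leq_subRL ?lk// => hi.
  by rewrite (leq_trans _ (kM i))// (leq_trans _ hi)// leq_addl.
rewrite big1_seq// => r /andP[_]; rewrite mem_filter => /andP[/forallP h _].
case/negP: lk; apply/forallP => i; have := h i; rewrite ffunE; exact: leq_trans (leq_addr _ _).
Qed.

(** Induction on n with [l] free: the outermost Q_z is expanded as a sum of e^((z + i u).r) q_r, the
    exponential moves [l] to l + r, and the operators q_r leave the average. The case n = 0 is the
    exact orthogonality of characters. *)
Lemma fourier_iter_Qop (z : 'cV[R]_d) n l k f : (forall i, `|z i 0| <= tilt_radius / 2) ->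
  tends_to (fun N => gavg N (fun u => phase z l k u *: iter n (Qop ev q (cvec z u)) f))
    (if multi_le l k then qn n (multi_sub k l) f else 0).
Proof.
move=> hz; have zeta : norm1 z < eta.
  by apply: small_norm1 => i; have := hz i; have := tilt_radius_gt0; lra.
elim: n l k => [|n IH] l k.
  pose b := \sum_i (l i + k i)%N.
  have bi i : (l i + k i <= b)%N by rewrite /b (bigD1 i)//= leq_addr.
  have bl i : (l i <= b)%N := leq_trans (leq_addr _ _) (bi i).
  have bk i : (k i <= b)%N := leq_trans (leq_addl _ _) (bi i).
  apply: tends_to_eq (tends_to_cst _); exists b.+1 => N hN /=.
  have Np : (0 < N)%N by exact: leq_ltn_trans hN.
  rewrite -(@gavg_lin R R[i]^o B d N (fun y => y *: f)); last first.
    by move=> a x y; rewrite scalerDl scalerA.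
  rewrite gavg_phase//; last 2 first.
    by move=> i; rewrite (leq_ltn_trans (bl i))// (leq_trans hN)// leq_addr.
    by move=> i; rewrite (leq_ltn_trans (bk i))// (leq_trans hN)// leq_addr.
  case: (eqVneq l k) => [->|lk].
    have -> : multi_le k k by apply/forallP.
    by rewrite (_ : multi_sub k k = multi0) ?eqxx ?scale1r//; apply/ffunP => i; rewrite !ffunE subnn.
  rewrite scale0r; case: ifPn => // /forallP le_lk; case: eqP => // e0; case/eqP: lk.
  apply/ffunP => i; apply/eqP; rewrite eqn_leq le_lk /= -subn_eq0.
  by have /ffunP/(_ i) := e0; rewrite !ffunE => ->.
have [C [y [C0 y0 y1 hC]]] := Qop_expand.
have [_ [D hD]] := unif_cont_iter zeta n f.
pose E := expR (rdot z l - rdot z k).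
(* The expansion is truncated to a box, with an error uniform in [u] by [Qop_expand]. On the box the
   sum is finite and the induction hypothesis applies term by term. *)
apply: tends_to_approx => e e0.
have [M0 hM0] := geometric_small (E * C * `|D|) y0 y1 e0.
pose M := maxn M0 (\sum_i k i).
have kM i : (k i <= M)%N by rewrite leq_max (bigD1 i)//= leq_addr orbT.
pose S N r := gavg N (fun u => phase z (multi_add l r) k u *: iter n (Qop ev q (cvec z u)) f).
exists (fun N => \sum_(r <- below (cst_multi M)) qB r (S N r)).
exists (\sum_(r <- below (cst_multi M))
  (if multi_le (multi_add l r) k then qB r (qn n (multi_sub (multi_sub k l) r) f) else 0)).
split.
- apply: tends_to_sum => r _; have [c c0 hc] := qB_bound norm1_0.
  have := IH (multi_add l r) k; rewrite -/(S^~ r) => h.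
  have -> : (if multi_le (multi_add l r) k then qB r (qn n (multi_sub (multi_sub k l) r) f) else 0) =
     qB r (if multi_le (multi_add l r) k then qn n (multi_sub k (multi_add l r)) f else 0).
    case: ifP => _; last by rewrite qB0.
    by congr (qB r (qn n _ f)); apply/ffunP => i; rewrite !ffunE subnDA.
  apply: tends_to_lin h => [x1 x2|x1]; last exact: hc.
  by rewrite addrC -scaleN1r qB_linear scaleN1r addrC.
- rewrite sum_below_shift//; case: ifP => _; rewrite ?subrr ?rnorm0 ?(ltW e0)//=.
- exists 1%N => N N0.
  have -> : \sum_(r <- below (cst_multi M)) qB r (S N r) =
      gavg N (fun u => phase z l k u *: \sum_(r <- below (cst_multi M))
        cexp (cdot (cvec z u) r) *: qB r (iter n (Qop ev q (cvec z u)) f)).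
    rewrite (@gavg_eq _ _ _ _ _ (fun u => \sum_(r <- below (cst_multi M))
        phase z (multi_add l r) k u *: qB r (iter n (Qop ev q (cvec z u)) f))); last first.
      move=> u _; rewrite scaler_sumr; apply: eq_bigr => r _; rewrite scalerA phase_mul.
      by [].
    rewrite gavg_sum; apply: eq_bigr => r _; rewrite /S (gavg_lin _ _ (qB_linear r)).
    apply: gavg_eq => u _.
    by have := qB_linear r (phase z (multi_add l r) k u) (iter n (Qop ev q (cvec z u)) f) 0;
      rewrite !addr0 qB0 addr0.
  rewrite -gavgB; apply: rnorm_gavg_le => // u cu.
  rewrite -scalerBr rnormZ cabs_phase -/E iterS.
  apply: (@le_trans _ _ (E * (C * y ^+ M * `|D|))).
    rewrite ler_wpM2l ?expR_ge0// (le_trans (hC z u hz M _))// ler_wpM2l ?mulr_ge0 ?exprn_ge0//.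
    by rewrite (le_trans (hD u cu))// ler_norm.
  have := hM0 M (leq_maxl _ _); lra.
Qed.

Lemma ev_qn n k f : ev (qn n k f) = conv_apply q n k (ev f).
Proof.
have [mr mi] := ev_meas f.
elim: n k => [|n IH] k; apply/funext => x; rewrite /conv_apply.
  rewrite [qn _ _ _]/=; case: eqP => [->|/eqP k0]; first by rewrite cintegral_dirac.
  have z : convpow q 0 k x = mzero :> (set X -> \bar R).
    by apply/funext => A; rewrite /= (negbTE k0).
  have := ev_sub 0 0 x; rewrite !subrr => ->.
  by rewrite /cintegral z !integral_measure_zero.
rewrite [qn _ _ _]/= ev_sum.
have part (p : R[i] -> R) :
    measurable_fun setT (fun y => p (ev f y)) ->
    (forall n k x, (convpow q n k x).-integrable setT (fun y => (p (ev f y))%:E)) ->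
    fine (\int[convpow q n.+1 k x]_y (p (ev f y))%:E) =
    \sum_(r <- below k) fine (\int[q r x]_y \int[convpow q n (multi_sub k r) y]_z (p (ev f z))%:E).
  move=> mp ip; have [-> ir] := integral_convpow hq n k x mp ip.
  rewrite [X in fine X]big_seq_cond -sum_fine; last first.
    move=> r; rewrite andbT => rk; have := ir r rk.
    exact: integrable_fin_num.
  by rewrite [RHS]big_seq_cond.
have intR n' k' x' : (convpow q n' k' x').-integrable setT (fun y => (complex.Re (ev f y))%:E) := (ev_int n' k' x' f).1.
have intI n' k' x' : (convpow q n' k' x').-integrable setT (fun y => (complex.Im (ev f y))%:E) := (ev_int n' k' x' f).2.
rewrite /cintegral (part (@complex.Re R))// (part (@complex.Im R))//.
have -> : forall a b : multi d -> R, (\sum_(r <- below k) a r) +i* (\sum_(r <- below k) b r) =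
   \sum_(r <- below k) (a r +i* b r).
  by move=> a b; apply/eqP; rewrite eq_complex !raddf_sum /= !eqxx.
apply: eq_bigr => r _; rewrite ev_qB IH /cintegral.
have fn (p : X -> \bar R) : (forall y, p y \is a fin_num) ->
    fine (\int[q r x]_y (fine (p y))%:E) = fine (\int[q r x]_y p y).
  by move=> h; congr fine; apply: eq_integral => y _; rewrite fineK.
have finK n' k' y' (p : X -> R) : (convpow q n' k' y').-integrable setT (fun y => (p y)%:E) ->
   (\int[convpow q n' k' y']_z (p z)%:E)%E \is a fin_num.
  by have [K hK] := convpow_kernel hq n'; rewrite hK => h; exact: integrable_fin_num.
congr (_ +i* _).
  by rewrite -[RHS]fn// => y; exact: finK (intR _ _ _).
by rewrite -[RHS]fn// => y; exact: finK (intI _ _ _).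
Qed.

Lemma conv_apply_belongs n k f : belongs ev (conv_apply q n k (ev f)).
Proof. by exists (qn n k f); rewrite ev_qn. Qed.

Lemma elt_conv_apply n k f : elt ev (conv_apply q n k (ev f)) = qn n k f.
Proof. by rewrite -ev_qn elt_ev. Qed.

Lemma fourier_conv_apply (alpha : B -> R[i]) (c : R) (z : 'cV[R]_d) n k f :
  (forall (a : R[i]) f g, alpha (a *: f + g) = a * alpha f + alpha g) ->
  (forall f, cabs (alpha f) <= c * rnorm f) -> (forall i, `|z i 0| <= tilt_radius / 2) ->
  @tends_to R R[i]^o (fun N => gavg N (fun u =>
     cexp (- cdot (cvec z u) k) * alpha (iter n (Qop ev q (cvec z u)) f) : R[i]^o))
    (alpha (elt ev (conv_apply q n k (ev f)))).
Proof.
move=> la ba hz; rewrite elt_conv_apply.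
have aZ a g : alpha (a *: g) = a * alpha g.
  have := la (-1) 0 0; rewrite scaler0 addr0 mulN1r addNr => a0.
  by have := la a g 0; rewrite addr0 a0 addr0.
have := fourier_iter_Qop n multi0 k f hz.
have -> : multi_le (@multi0 d) k by apply/forallP => i; rewrite ffunE.
have -> : multi_sub k multi0 = k by apply/ffunP => i; rewrite !ffunE subn0.
move=> h; have := @tends_to_lin _ _ R[i]^o alpha c _ _ _ ba h => {}h.
apply: tends_to_eq (h _); last first.
  by move=> x y; rewrite addrC -scaleN1r la mulN1r addrC.
exists 0%N => N _; rewrite (@gavg_lin R B R[i]^o d N alpha _ la); apply: gavg_eq => u _.
rewrite aZ; congr (_ * _); rewrite /phase; congr cexp.
by rewrite [cdot _ multi0]big1 ?sub0r// => i _; rewrite ffunE mulr0.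
Qed.

End Fourier.


(** * Perturbation of the dominant eigenvalue *)

Section Perturbation.
Variable R : realType.

Section LinearMaps.
Variables (V W : lmodType R[i]) (T : V -> W).
Hypothesis lT : linear T.

Lemma lin0 : T 0 = 0.
Proof. by have := lT (-1) 0 0; rewrite scaler0 addr0 scaleN1r addNr. Qed.

Lemma linZ a f : T (a *: f) = a *: T f.
Proof. by have := lT a f 0; rewrite !addr0 lin0 addr0. Qed.

Lemma linD f g : T (f + g) = T f + T g.
Proof. by have := lT 1 f g; rewrite !scale1r. Qed.

Lemma linB f g : T (f - g) = T f - T g.
Proof. by rewrite linD -scaleN1r linZ scaleN1r. Qed.

End LinearMaps.

Variable B : normedModType R[i].
Implicit Types (T S P : B -> B) (f g : B).

Lemma iter_linear n T : linear T -> linear (iter n T).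
Proof. by move=> lT; elim: n => [//|n IH] a f g; rewrite !iterS IH lT. Qed.

Lemma iter_bound n T (b : R) : 0 <= b -> (forall f, rnorm (T f) <= b * rnorm f) ->
  forall f, rnorm (iter n T f) <= b ^+ n * rnorm f.
Proof.
move=> b0 hT f; elim: n => [|n IH]; first by rewrite mul1r.
by rewrite iterS exprS -mulrA (le_trans (hT _))// ler_wpM2l.
Qed.

Lemma iter_close n T S (b x : R) : linear S -> 1 <= b -> 0 <= x ->
  (forall f, rnorm (T f) <= b * rnorm f) -> (forall f, rnorm (S f) <= b * rnorm f) ->
  (forall f, rnorm (T f - S f) <= x * rnorm f) ->
  forall f, rnorm (iter n T f - iter n S f) <= n%:R * b ^+ n * x * rnorm f.
Proof.
move=> lS b1 x0 hT hS hTS f; have b0 : 0 <= b by lra.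
elim: n => [|n IH]; first by rewrite subrr rnorm0 !mul0r.
have -> : iter n.+1 T f - iter n.+1 S f =
    (T (iter n T f) - S (iter n T f)) + S (iter n T f - iter n S f).
  by rewrite (linB lS) addrA subrK.
rewrite (le_trans (ler_rnormD _ _))//.
have h1 : rnorm (T (iter n T f) - S (iter n T f)) <= x * (b ^+ n.+1 * rnorm f).
  rewrite (le_trans (hTS _))// ler_wpM2l// (le_trans (iter_bound n b0 hT f))//.
  by rewrite ler_wpM2r ?rnorm_ge0// ler_weXn2l.
have h2 := le_trans (hS _) (ler_wpM2l b0 IH).
rewrite [leRHS](_ : _ = x * (b ^+ n.+1 * rnorm f) + b * (n%:R * b ^+ n * x * rnorm f)).
  exact: lerD.
by rewrite -natr1 exprS; ring.
Qed.

(** Iterating c -> a + c / 2 leads to its fixed point 2 a, whatever the starting bound [b]. An a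
    priori bound without any uniformity thereby becomes an explicit one. *)
Lemma halving_bound (P : B -> B) (a b : R) : 0 <= a -> 0 <= b ->
  (forall f, rnorm (P f) <= b * rnorm f) ->
  (forall c, 0 <= c -> (forall f, rnorm (P f) <= c * rnorm f) ->
     forall f, rnorm (P f) <= (a + c / 2) * rnorm f) ->
  forall f, rnorm (P f) <= 2 * a * rnorm f.
Proof.
move=> a0 b0 hb step f.
have it n : forall g, rnorm (P g) <= (2 * a + b * 2^-1 ^+ n) * rnorm g.
  have p0 m : 0 <= b * 2^-1 ^+ m by rewrite mulr_ge0 ?exprn_ge0.
  elim: n => [|n IH] g.
    by rewrite (le_trans (hb g))// ler_wpM2r ?rnorm_ge0//; lra.
  have := step _ _ IH g; rewrite exprS.
  have -> : a + (2 * a + b * 2^-1 ^+ n) / 2 = 2 * a + b * (2^-1 * 2^-1 ^+ n) by field.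
  by apply; have := p0 n; lra.
apply/ler_addgt0Pr => e e0.
have h0 : (0 : R) <= 2^-1 by lra.
have h1 : (2^-1 : R) < 1 by lra.
have [M hM] := geometric_small (b * rnorm f) h0 h1 e0.
by rewrite (le_trans (it M f))// mulrDl lerD2l mulrAC hM.
Qed.

(* A is close to f |-> p f e and A = L P + M.  With w the eigenvector normalized by
   p w = 1, A w = L w forces w close to e; P A = L P bounds P first in terms of P e,
   hence absolutely, and then P f is close to p f e. *)
Lemma rank_one_perturbation (e v : B) (p : B -> R[i]) (K x : R) (A P M : B -> B) (L : R[i]) :
  1 <= K -> 0 <= x -> x * (64 * K ^+ 2) <= 1 -> rnorm e <= K ->
  (forall f, cabs (p f) <= K * rnorm f) -> (forall a f, p (a *: f) = a * p f) ->
  (forall f, rnorm (A f - p f *: e) <= x * rnorm f) -> cabs (L - 1) <= x ->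
  linear P -> (exists b : R, forall f, rnorm (P f) <= b * rnorm f) ->
  v != 0 -> P v = v -> (forall f, exists c, P f = c *: v) ->
  (forall f, A f = L *: P f + M f) -> (forall f, P (M f) = 0 /\ M (P f) = 0) ->
  forall f, rnorm (P f - p f *: e) <= 64 * K ^+ 4 * x * rnorm f /\
            rnorm (M f) <= 64 * K ^+ 4 * x * rnorm f.
Proof.
move=> K1 x0 xK eK pK pZ hA hL lP [b hb] v0 Pv Pr AE PM f.
have K2 : 1 <= K ^+ 2 by rewrite exprn_ege1.
have x64 : x <= 64^-1 by have := ler_wpM2l x0 K2; lra.
have L1 : 1 - x <= cabs L.
  by have := ler_cabsB L (L - 1); rewrite opprB addrCA subrr addr0 cabs1; lra.
have vpos : 0 < rnorm v.
  by rewrite lt_neqAle rnorm_ge0 andbT eq_sym; apply/eqP => /rnorm0_eq0 /eqP; rewrite (negbTE v0).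
have AP g : P g = g -> A g = L *: g by move=> Pg; rewrite AE -{2}Pg (PM g).2 addr0 Pg.
have pv0 : p v != 0.
  apply/eqP => pv; have := hA v; rewrite pv scale0r subr0 (AP v Pv) rnormZ.
  by rewrite ler_pM2r//; lra.
pose w := (p v)^-1 *: v.
have Pw : P w = w by rewrite /w (linZ lP) Pv.
have pw : p w = 1 by rewrite /w pZ mulVf.
have w_e : rnorm (w - e) <= 2 * x * rnorm w.
  have -> : w - e = (1 - L) *: w + (A w - p w *: e).
    by rewrite (AP w Pw) pw scale1r scalerBl scale1r addrA subrK.
  rewrite (le_trans (ler_rnormD _ _))// rnormZ cabs_distC.
  have := hA w; have := ler_wpM2r (rnorm_ge0 w) hL; lra.
have wK : rnorm w <= 2 * K.
  have := ler_rnormD (w - e) e; rewrite subrK; have := rnorm_ge0 w; nra.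
have {}w_e : rnorm (w - e) <= 4 * K * x by have := ler_wpM2l x0 wK; lra.
have PA g : P (A g) = L *: P g.
  by have [c Pg] := Pr g; rewrite AE (linD lP) (PM g).1 addr0 (linZ lP) Pg (linZ lP) Pv.
have PE g : P g = (1 - L) *: P g + p g *: P e + P (A g - p g *: e).
  rewrite (linB lP) PA (linZ lP) scalerBl scale1r.
  by rewrite addrA [_ + p g *: P e + _]addrAC subrK addrK.
have Pbound (c : R) g : 0 <= c -> (forall h, rnorm (P h) <= c * rnorm h) ->
    rnorm (P g) <= (K * rnorm (P e) + 2 * x * c) * rnorm g.
  move=> c0 hc; rewrite PE (le_trans (ler_rnormD _ _))//.
  have h1 := ler_rnormD ((1 - L) *: P g) (p g *: P e).
  rewrite !rnormZ cabs_distC in h1.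
  have h2 : cabs (L - 1) * rnorm (P g) <= x * (c * rnorm g).
    by apply: ler_pM; rewrite ?cabs_ge0 ?rnorm_ge0.
  have h3 : cabs (p g) * rnorm (P e) <= K * rnorm g * rnorm (P e) by rewrite ler_wpM2r ?rnorm_ge0.
  have h4 := le_trans (hc (A g - p g *: e)) (ler_wpM2l c0 (hA g)).
  rewrite [leRHS](_ : _ = x * (c * rnorm g) + K * rnorm g * rnorm (P e) + c * (x * rnorm g)); last by ring.
  lra.
(* Since 2 x <= 1/2, [Pbound] is a halving step, and the norm of [P] is controlled by |P e|
   alone. *)
have P1 g : rnorm (P g) <= 2 * (K * rnorm (P e)) * rnorm g.
  apply: (@halving_bound P _ `|b|) => //.
  - by rewrite mulr_ge0 ?rnorm_ge0//; lra.
  - by move=> h; rewrite (le_trans (hb h))// ler_wpM2r ?rnorm_ge0// ler_norm.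
  move=> c c0 hc h; rewrite (le_trans (Pbound c h c0 hc))// ler_wpM2r ?rnorm_ge0// lerD2l.
  nra.
have Pe0 := rnorm_ge0 (P e).
have K0 : 0 <= K by lra.
have w_Pe : rnorm (w - P e) <= 8 * K ^+ 2 * x * rnorm (P e).
  rewrite -{1}Pw -(linB lP) (le_trans (P1 _))//.
  have c0 : 0 <= 2 * (K * rnorm (P e)) by rewrite !mulr_ge0.
  rewrite (le_trans (ler_wpM2l c0 w_e))// le_eqVlt; apply/orP; left; apply/eqP; ring.
have PeK : rnorm (P e) <= 4 * K.
  have := ler_rnormB w (w - P e); rewrite opprB addrCA subrr addr0.
  have := ler_wpM2r Pe0 xK; lra.
have Pe_e : rnorm (P e - e) <= 36 * K ^+ 3 * x.
  have -> : P e - e = (w - e) - (w - P e) by rewrite opprB [RHS]addrC subrKA.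
  rewrite (le_trans (ler_rnormB _ _))//.
  have c0 : 0 <= 8 * K ^+ 2 * x by rewrite !mulr_ge0// exprn_ge0.
  have h := ler_wpM2l c0 PeK.
  have h3 : K * x <= K ^+ 3 * x by rewrite ler_wpM2r// -[leLHS]expr1 ler_weXn2l.
  rewrite !exprS !expr0 in h w_Pe h3 *; lra.
have P8 g : rnorm (P g) <= 8 * K ^+ 2 * rnorm g.
  rewrite (le_trans (P1 g))// ler_wpM2r ?rnorm_ge0//.
  by have := ler_wpM2l K0 PeK; rewrite expr2; lra.
have f0 := rnorm_ge0 f.
have K24 : K ^+ 2 <= K ^+ 4 by rewrite ler_weXn2l.
have K4 : 1 <= K ^+ 4 by rewrite exprn_ege1.
have LP : cabs (L - 1) * rnorm (P f) <= x * (8 * K ^+ 2 * rnorm f).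
  by apply: ler_pM; rewrite ?cabs_ge0 ?rnorm_ge0.
have xf : 0 <= x * rnorm f by rewrite mulr_ge0.
have g24 := ler_wpM2r xf K24; have g4 := ler_wpM2r xf K4.
have main : rnorm (P f - p f *: e) <= 52 * (K ^+ 4 * (x * rnorm f)).
  have -> : P f - p f *: e = (1 - L) *: P f + p f *: (P e - e) + P (A f - p f *: e).
    by rewrite {1}PE scalerBr [X in _ = X + _]addrA [RHS]addrAC.
  rewrite (le_trans (ler_rnormD _ _))//.
  have h1 := ler_rnormD ((1 - L) *: P f) (p f *: (P e - e)).
  rewrite !rnormZ cabs_distC in h1.
  have h2 : cabs (p f) * rnorm (P e - e) <= K * rnorm f * (36 * K ^+ 3 * x).
    by apply: ler_pM; rewrite ?cabs_ge0 ?rnorm_ge0.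
  have h2' : K * rnorm f * (36 * K ^+ 3 * x) = 36 * (K ^+ 4 * (x * rnorm f)) by ring.
  have c0 : 0 <= 8 * K ^+ 2 by rewrite !mulr_ge0// exprn_ge0.
  have h3 := le_trans (P8 (A f - p f *: e)) (ler_wpM2l c0 (hA f)).
  lra.
split; first by lra.
have -> : M f = (A f - p f *: e) - (P f - p f *: e) + (1 - L) *: P f.
  rewrite AE scalerBl scale1r opprB [_ + M f]addrC !addrA.
  by rewrite [_ + p f *: e]addrAC !subrK ?addrK // addrAC addrK subrK.
rewrite (le_trans (ler_rnormD _ _))// rnormZ cabs_distC.
have := ler_rnormB (A f - p f *: e) (P f - p f *: e); have := hA f; lra.
Qed.

Lemma iter_sub1 (l : R[i]) (x : R) n : cabs (l - 1) <= x -> x <= 1 ->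
  cabs (l ^+ n - 1) <= n%:R * 2 ^+ n * x.
Proof.
move=> lx x1; have x0 : 0 <= x by rewrite (le_trans (cabs_ge0 _) lx).
have l2 : cabs l <= 2 by have := ler_cabsD (l - 1) 1; rewrite subrK cabs1; lra.
elim: n => [|n IH]; first by rewrite expr0 subrr cabs0 !mul0r.
have -> : l ^+ n.+1 - 1 = l ^+ n * (l - 1) + (l ^+ n - 1) by rewrite exprSr; ring.
rewrite (le_trans (ler_cabsD _ _))// cabsM cabsX.
have h : cabs l ^+ n * cabs (l - 1) <= 2 ^+ n * x.
  by apply: ler_pM; rewrite ?exprn_ge0 ?cabs_ge0// lerXn2r ?nnegrE ?cabs_ge0.
have p2 : 0 <= 2 ^+ n * x by rewrite mulr_ge0 ?exprn_ge0.
have p3 : 0 <= n%:R * (2 ^+ n * x) by rewrite mulr_ge0.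
by rewrite -natr1 exprS; move: h IH p2 p3; rewrite -!mulrA; lra.
Qed.

(** Division of n by [n1]: the quotient contributes halvings, the remainder at most b^n1. The rate
    satisfies r^n1 = exp (- 1/2) >= 1/2, which converts the halvings into powers of r at the price
    of a factor 2. *)
Lemma iter_root_bound (N : B -> B) (n1 : nat) (b : R) : (0 < n1)%N -> 1 <= b ->
  (forall f, rnorm (N f) <= b * rnorm f) ->
  (forall f, rnorm (iter n1 N f) <= 2^-1 * rnorm f) ->
  forall n f, rnorm (iter n N f) <= 2 * b ^+ n1 * expR (- (2 * n1%:R)^-1) ^+ n * rnorm f.
Proof.
move=> n10 b1 hb hN n f; pose r := expR (- (2 * n1%:R)^-1 : R).
have nr : n1%:R != 0 :> R by rewrite pnatr_eq0 -lt0n.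
have rn1 : 2^-1 <= r ^+ n1.
  rewrite /r -expRM_natl; have -> : n1%:R * - (2 * n1%:R)^-1 = - 2^-1 :> R by field.
  by have := expR_ge1Dx (- 2^-1 : R); lra.
have r0 : 0 <= r by exact: expR_ge0.
have r1 : r <= 1 by rewrite -expR0 ler_expR oppr_le0 invr_ge0.
rewrite {1}(divn_eq n n1) addnC iterD.
have h1 := iter_bound (n %% n1) (le_trans ler01 b1) hb (iter (n %/ n1 * n1) N f).
have h2 : rnorm (iter (n %/ n1 * n1) N f) <= 2^-1 ^+ (n %/ n1) * rnorm f.
  rewrite iterM; exact: (@iter_bound _ (iter n1 N)).
have h3 : b ^+ (n %% n1) <= b ^+ n1 by rewrite ler_weXn2l// ltnW// ltn_mod.
have h4 : 2^-1 ^+ (n %/ n1) <= 2 * r ^+ n.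
  rewrite [in leRHS](divn_eq n n1) exprD mulnC exprM.
  have e1 : 2^-1 ^+ (n %/ n1) <= (r ^+ n1) ^+ (n %/ n1).
    by rewrite lerXn2r ?nnegrE ?exprn_ge0.
  have e2 : r ^+ n1 <= r ^+ (n %% n1) by rewrite ler_wiXn2l// ltnW// ltn_mod.
  have e3 : 0 <= (r ^+ n1) ^+ (n %/ n1) by rewrite !exprn_ge0.
  have e4 : (r ^+ n1) ^+ (n %/ n1) * 2^-1 <= (r ^+ n1) ^+ (n %/ n1) * r ^+ (n %% n1).
    by rewrite ler_wpM2l// (le_trans rn1).
  lra.
rewrite (le_trans h1)//; apply: (@le_trans _ _ (b ^+ n1 * (2 * r ^+ n * rnorm f))).
  apply: ler_pM => //; rewrite ?exprn_ge0 ?rnorm_ge0//; first by lra.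
  by rewrite (le_trans h2)// ler_wpM2r ?rnorm_ge0.
rewrite le_eqVlt; apply/orP; left; apply/eqP; rewrite /r; ring.
Qed.

(** Positivity of n matters: at n = 0 the right-hand side would be P f + f. *)
Lemma iter_decomposition (T P N : B -> B) (l : R[i]) : linear N -> linear P ->
  (forall f, P (P f) = P f) ->
  (forall f, T f = l *: P f + N f) -> (forall f, P (N f) = 0 /\ N (P f) = 0) ->
  forall n f, (0 < n)%N -> iter n T f = l ^+ n *: P f + iter n N f.
Proof.
move=> lN lP PP TE PN [//|n] f _; elim: n => [|n IH]; first by rewrite expr1 /= TE.
rewrite iterS IH TE (linD lP) (linZ lP) PP (linD lN) (linZ lN) (PN f).2 scaler0 add0r.
have -> : P (iter n.+1 N f) = 0 by rewrite iterS (PN _).1.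
by rewrite addr0 scalerA -exprS -iterS.
Qed.

End Perturbation.

(** * Uniform spectral splitting near 0 *)

Section SpectralPerturbation.
Variables (R : realType) (d : nat) (B : completeNormedModType R[i]).
Variables (T : 'cV[R[i]]_d -> B -> B) (rho : 'cV[R[i]]_d -> R[i]).
Variables (e : B) (p : B -> R[i]) (N0 : B -> B).
Let small (x : R) (h : 'cV[R[i]]_d) := forall i, cabs (h i 0) <= x.
Hypothesis pZ : forall a f, p (a *: f) = a * p f.
Hypothesis p_bounded : exists2 C : R, 0 <= C & forall f, cabs (p f) <= C * rnorm f.
Hypothesis pe : p e = 1.
Hypothesis N0_linear : linear N0.
Hypothesis p_linear : forall (a : R[i]) f g, p (a *: f + g) = a * p f + p g.
Hypothesis T0_linear : linear (T 0).
Hypothesis T0_bounded : exists c, op_le (T 0) c.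
Hypothesis T0E : forall f, T 0 f = p f *: e + N0 f.
Hypothesis pN0 : forall f, p (N0 f) *: e = 0 /\ N0 (p f *: e) = 0.
Hypothesis N0_power : exists C r : R, 0 <= r < 1 /\ forall n, op_le (iter n N0) (C * r ^+ n).
Hypothesis T_lipschitz : exists s C : R, [/\ 0 < s, 0 <= C & forall h x, x <= s ->
  small x h -> 0 <= x -> forall f, rnorm (T h f - T 0 f) <= C * x * rnorm f].
Hypothesis rho_continuous : forall y : R, 0 < y -> exists2 x : R, 0 < x &
  forall h, small x h -> cabs (rho h - 1) <= y.
Hypothesis T_dominant : exists2 s : R, 0 < s &
  forall h, small s h -> simple_dominant_eigenvalue (T h) (rho h).

(** The splitting at a single [h], with a bound on [P] that may depend on [h]; bounds uniform near 0
    come from [power_perturbation]. *)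
Let splits (h : 'cV[R[i]]_d) (P N : B -> B) := [/\ linear P /\ (exists c : R, forall f, rnorm (P f) <= c * rnorm f),
  linear N, forall f, P (P f) = P f,
  exists2 v : B, v != 0 & P v = v /\ forall f, exists c : R[i], P f = c *: v &
  (forall f, T h f = rho h *: P f + N f) /\ (forall f, P (N f) = 0 /\ N (P f) = 0)].

Lemma splitting : exists2 s : R, 0 < s & forall h, small s h -> exists P N, splits h P N.
Proof.
have [s s0 hs] := T_dominant; exists s => // h /hs[P [N [[[lP [c cP]] [lN _]] [v v0 [Pv Pr]] TE PN _]]].
exists P, N; split=> //.
- by split=> //; exists c; apply/op_leP.
- by move=> f; have [a Pf] := Pr f; rewrite Pf (linZ lP) Pv.
- by exists v.
Qed.

Lemma iter_T0 n f : (0 < n)%N -> iter n (T 0) f = p f *: e + iter n N0 f.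
Proof.
move=> n0; rewrite (@iter_decomposition _ _ (T 0) (fun f => p f *: e) N0 1) ?expr1n ?scale1r//.
- by move=> a g h; rewrite p_linear scalerDl scalerA.
- by move=> g; rewrite pZ pe mulr1.
- by move=> g; rewrite scale1r.
Qed.

Lemma T_bounded : exists s b : R, [/\ 0 < s, 1 <= b &
  forall h, small s h -> forall f, rnorm (T h f) <= b * rnorm f].
Proof.
have [s [C [s0 C0 hs]]] := T_lipschitz; have [c /op_leP hc] := T0_bounded.
exists s, (1 + `|c| + C * s); split=> //.
  by have := mulr_ge0 C0 (ltW s0); have := normr_ge0 c; lra.
move=> h hh f; have := hs h s (lexx _) hh (ltW s0) f.
have := ler_rnormD (T h f - T 0 f) (T 0 f); rewrite subrK.
have := hc f; have := ler_wpM2r (rnorm_ge0 f) (ler_norm c); have := rnorm_ge0 f; lra.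
Qed.

Lemma small_le (x y : R) h : x <= y -> small x h -> small y h.
Proof. by move=> xy hx i; exact: le_trans xy. Qed.

(** The operator at 0 need not be close to rank one, but its n-th power is, because N0^n decays.
    Once such an n is fixed, T_h^n is close to it for small h, and [rank_one_perturbation] is
    applied to T_h^n with eigenvalue rho^n and remainder N^n. *)
Lemma power_perturbation (y : R) : 0 < y -> exists n, (0 < n)%N /\ exists2 x : R, 0 < x &
  forall h, small x h -> forall P N, splits h P N -> forall f,
    rnorm (P f - p f *: e) <= y * rnorm f /\ rnorm (iter n N f) <= y * rnorm f.
Proof.
move=> y0; have [Cp Cp0 hp] := p_bounded.
pose K := 1 + rnorm e + Cp.
have K1 : 1 <= K by have := rnorm_ge0 e; rewrite /K; lra.
have K2 : 0 < K ^+ 2 by rewrite exprn_gt0//; lra.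
have K4 : 0 < K ^+ 4 by rewrite exprn_gt0//; lra.
(* The two entries are the conclusion wanted from [rank_one_perturbation] and its smallness
   hypothesis. *)
pose z := Num.min (y / (64 * K ^+ 4)) (64 * K ^+ 2)^-1.
have z0 : 0 < z by rewrite lt_min; apply/andP; split; rewrite ?invr_gt0; pos.
have [Cr [r [/andP[r0 r1] hr]]] := N0_power.
have [n1 hn1] := geometric_small Cr r0 r1 (divr_gt0 z0 (ltr0n R 2)).
pose n := n1.+1; exists n; split=> //.
have [s1 [C [s10 C0 hs1]]] := T_lipschitz; have [s2 [b [s20 b1 hs2]]] := T_bounded.
pose w := n%:R * b ^+ n * C + n%:R * 2 ^+ n + 1.
have bn : 0 <= b ^+ n by rewrite exprn_ge0//; lra.
have q1 : 0 <= n%:R * b ^+ n * C by rewrite !mulr_ge0.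
have q2 : (0 : R) <= n%:R * 2 ^+ n by rewrite mulr_ge0// exprn_ge0.
have w1 : 1 <= w by rewrite /w; lra.
have w0 : 0 < w by lra.
have yw : 0 < Num.min 1 (z / (2 * w)) by rewrite lt_min ltr01 /=; pos.
have [s3 s30 hs3] := rho_continuous yw.
exists (Num.min (Num.min s1 s2) (Num.min s3 (z / (2 * w)))).
  by rewrite !lt_min s10 s20 s30 /=; pos.
set x := Num.min _ _ => h hx P N [[lP bP] lN PP [v v0 [Pv Pr]] [TE PN]] f.
have x0 : 0 <= x by rewrite !le_min !ltW//; pos.
have xs1 : x <= s1 by rewrite !ge_min lexx.
have xs2 : x <= s2 by rewrite !ge_min lexx orbT.
have xs3 : x <= s3 by rewrite !ge_min lexx orbT.
have xz : x <= z / (2 * w) by rewrite !ge_min lexx !orbT.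
have wz (c : R) : 0 <= c -> c <= w -> c * (z / (2 * w)) <= z / 2.
  move=> c0 cw; have -> : z / 2 = w * (z / (2 * w)) by field; rewrite gt_eqF.
  by rewrite ler_wpM2r//; pos.
have zK : z * (64 * K ^+ 2) <= 1.
  by rewrite -ler_pdivlMr ?div1r ?ge_min ?lexx ?orbT//; pos.
have zy : 64 * K ^+ 4 * z <= y.
  by rewrite mulrC -ler_pdivlMr ?ge_min ?lexx//; pos.
have L1 : cabs (rho h ^+ n - 1) <= z.
  have := hs3 h (small_le xs3 hx); rewrite le_min => /andP[h1 h2].
  rewrite (le_trans (iter_sub1 n (lexx _) h1))//.
  have q0 : (0 : R) <= n%:R * 2 ^+ n by rewrite mulr_ge0// exprn_ge0.
  rewrite (le_trans (ler_wpM2l q0 h2))// (le_trans (wz _ q0 _))//; last by lra.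
  rewrite /w; have : 0 <= n%:R * b ^+ n * C by rewrite !mulr_ge0.
  lra.
have A1 g : rnorm (iter n (T h) g - p g *: e) <= z * rnorm g.
  have T0b : forall f, rnorm (T 0 f) <= b * rnorm f.
    by apply: hs2 => i; rewrite mxE cabs0 ltW.
  have Tb := hs2 h (small_le xs2 hx).
  have g1 := iter_close n T0_linear b1 (mulr_ge0 C0 x0) Tb T0b (hs1 h x xs1 hx x0) g.
  have /op_leP/(_ g) g2 := hr n.
  have g3 : Cr * r ^+ n <= z / 2 by apply: hn1; rewrite /n leqnSn.
  have g4 : n%:R * b ^+ n * (C * x) <= z / 2.
    have q0 : 0 <= n%:R * b ^+ n * C by rewrite !mulr_ge0.
    rewrite mulrA (le_trans (ler_wpM2l q0 xz))// wz// /w.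
    have : (0 : R) <= n%:R * 2 ^+ n by rewrite mulr_ge0// exprn_ge0.
    lra.
  have := ler_rnormD (iter n (T h) g - iter n (T 0) g) (iter n N0 g).
  rewrite (iter_T0 g (ltn0Sn _ : (0 < n)%N)) opprD addrA subrK.
  have := ler_wpM2r (rnorm_ge0 g) g3; have := ler_wpM2r (rnorm_ge0 g) g4.
  rewrite (iter_T0 g (ltn0Sn _ : (0 < n)%N)) opprD addrA in g1; lra.
have eK : rnorm e <= K by rewrite /K; lra.
have pK g : cabs (p g) <= K * rnorm g.
  by rewrite (le_trans (hp g))// ler_wpM2r ?rnorm_ge0// /K; have := rnorm_ge0 e; lra.
have MN g : P (iter n N g) = 0 /\ iter n N (P g) = 0.
  split; first by rewrite /n iterS (PN _).1.
  by rewrite /n iterSr (PN _).2 (lin0 (iter_linear _ lN)).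
have AE g := iter_decomposition lN lP PP TE PN g (ltn0Sn _ : (0 < n)%N).
have [h1 h2] := rank_one_perturbation K1 (ltW z0) zK eK pK pZ A1 L1 lP bP v0 Pv Pr AE MN f.
have zf := ler_wpM2r (rnorm_ge0 f) zy.
by split; [exact: le_trans h1 zf|exact: le_trans h2 zf].
Qed.

(** The rate [r] is fixed once, from a power of N of norm at most 1/2; the precision [y] affects
    only the distance of P to its limit and the neighbourhood. Hence [C] and [r] do not depend on
    [y], as the local limit theorem requires. *)
Lemma spectral_approx : exists C r : R, [/\ 0 <= C, 0 <= r, r < 1 &
  forall y : R, 0 < y -> exists2 x : R, 0 < x & forall h, small x h -> forall n f,
    rnorm (iter n (T h) f - (rho h ^+ n * p f) *: e) <= (y * cabs (rho h) ^+ n + C * r ^+ n) * rnorm f].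
Proof.
have h2 : (0 : R) < 2^-1 by lra.
have [n1 [n10 [x1 x10 hx1]]] := power_perturbation h2.
have [Cp Cp0 hp] := p_bounded; pose K := Cp * rnorm e.
have K0 : 0 <= K by rewrite mulr_ge0 ?rnorm_ge0.
have pe_bound f : rnorm (p f *: e) <= K * rnorm f.
  by rewrite rnormZ /K mulrAC ler_wpM2r ?rnorm_ge0.
have [s2 [b [s20 b1 hs2]]] := T_bounded; have [s4 s40 hs4] := splitting.
have [s3 s30 hs3] := rho_continuous (@ltr01 R).
pose b2 := b + 2 * (K + 1).
have b21 : 1 <= b2 by rewrite /b2; lra.
pose r := expR (- (2 * n1%:R)^-1 : R).
have r0 : 0 <= r by exact: expR_ge0.
exists (2 * b2 ^+ n1 + (1 + K)), r; split=> //.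
- by rewrite addr_ge0 ?mulr_ge0 ?exprn_ge0//; lra.
- by rewrite expR_lt1 oppr_lt0 invr_gt0 mulr_gt0// ltr0n.
move=> y y0; have [n2 [_ [x2 x20 hx2]]] := power_perturbation y0.
exists (Num.min (Num.min x1 x2) (Num.min s2 (Num.min s3 s4))).
  by rewrite !lt_min x10 x20 s20 s30 s40.
move=> h hx n f.
have hx1' : small x1 h by apply: small_le hx; rewrite !ge_min lexx.
have hx2' : small x2 h by apply: small_le hx; rewrite !ge_min lexx orbT.
have hs2' : small s2 h by apply: small_le hx; rewrite !ge_min lexx !orbT.
have hs3' : small s3 h by apply: small_le hx; rewrite !ge_min lexx !orbT.
have hs4' : small s4 h by apply: small_le hx; rewrite !ge_min lexx !orbT.
have [P [N PN]] := hs4 h hs4'.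
have f0 := rnorm_ge0 f; have l0 : 0 <= cabs (rho h) ^+ n by rewrite exprn_ge0 ?cabs_ge0.
have p2 : 0 <= b2 ^+ n1 by rewrite exprn_ge0//; lra.
have rn : 0 <= r ^+ n by rewrite exprn_ge0.
(* At n = 0 the difference is f - p f e, which the summand 1 + K of the constant absorbs. *)
case: (posnP n) => [->|n0].
  rewrite !expr0 mul1r /= (le_trans (ler_rnormB _ _))//.
  have := pe_bound f; have := mulr_ge0 p2 f0; have := mulr_ge0 (ltW y0) f0; lra.
have Phalf := hx1 h hx1' P N PN; have Py := hx2 h hx2' P N PN.
have [[lP bP] lN PP _ [TE PN0]] := PN.
have l2 : cabs (rho h) <= 2 by have := hs3 h hs3'; have := ler_cabsD (rho h - 1) 1; rewrite subrK cabs1; lra.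
have Nb g : rnorm (N g) <= b2 * rnorm g.
  have -> : N g = T h g - rho h *: P g by rewrite TE addrC addKr.
  rewrite (le_trans (ler_rnormB _ _))// rnormZ.
  have g1 := (Phalf g).1; have g2 := pe_bound g; have g3 := hs2 h hs2' g.
  have := ler_rnormD (P g - p g *: e) (p g *: e); rewrite subrK => g4.
  have g0 := rnorm_ge0 g.
  have g5 : cabs (rho h) * rnorm (P g) <= 2 * ((K + 1) * rnorm g).
    by apply: ler_pM; rewrite ?cabs_ge0 ?rnorm_ge0//; lra.
  by rewrite /b2; lra.
rewrite (iter_decomposition lN lP PP TE PN0 f n0) -scalerA addrAC -scalerBr.
rewrite (le_trans (ler_rnormD _ _))// rnormZ cabsX.
have g1 := ler_wpM2l l0 (Py f).1.
have g2 := iter_root_bound n10 b21 Nb (fun g => (Phalf g).2) n f; rewrite -/r in g2.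
have g3 : 0 <= (1 + K) * r ^+ n * rnorm f by rewrite !mulr_ge0//; lra.
lra.
Qed.

End SpectralPerturbation.


(** * Expansion of the eigenvalue *)

Section Log.
Variable R : realType.
Implicit Types (w z : R[i]) (x y : R).

Lemma cexp_sub1_le w : cabs (cexp w - 1) <= 3 * cabs w * (1 + expR (complex.Re w)).
Proof.
have hr := cabs_Re w; have hi := cabs_Im w; case: w hr hi => x y /= hr hi.
have -> : cexp (x +i* y) - 1 = (expR x)%:C * ((cos y - 1) +i* sin y) + (expR x - 1)%:C.
  by apply/eqP; rewrite eq_complex /=; apply/andP; split; apply/eqP; ring.
rewrite (le_trans (ler_cabsD _ _))// cabsM !cabs_real ger0_norm ?expR_ge0//.
have h1 : cabs ((cos y - 1) +i* sin y) <= 2 * `|y|.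
  rewrite (le_trans (cabs_le_ReIm _))//=.
  have := cos_sub1_le y; have := sin_le_norm y; have := cos_le1 y; have := cos_geN1 y => c1 c2 s c3.
  have c4 : `|cos y - 1| <= 2 by rewrite ler0_norm; lra.
  have y0 := normr_ge0 y.
  have := real_normK (num_real y).
  case: (lerP `|y| 2) => y2; last by lra.
  move=> yy; have : `|y| ^+ 2 <= 2 * `|y| by rewrite expr2 ler_wpM2r.
  by move: c3 s; rewrite -yy; lra.
have h2 : `|expR x - 1| <= `|x| * (1 + expR x).
  have e1 := expR_ge1Dx x; have e2 := expR_ge1Dx (- x); have e0 := expR_gt0 x.
  have e3 : 1 >= (1 - x) * expR x by rewrite -ler_pdivlMr// div1r -expRN.
  case: (lerP 0 x) => x0.
    by rewrite (ger0_norm x0) ger0_norm; lra.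
  have e4 : expR x <= 1 by rewrite -expR0 ler_expR ltW.
  rewrite (ltr0_norm x0) ler0_norm; last by lra.
  have : 0 <= - x * expR x by rewrite mulr_ge0 ?(ltW e0)// oppr_ge0 ltW.
  lra.
have e0 := expR_gt0 x; have w0 := cabs_ge0 (x +i* y).
have h3 : expR x * cabs ((cos y - 1) +i* sin y) <= expR x * (2 * cabs (x +i* y)).
  by rewrite ler_pM2l//; lra.
have h4 : `|x| * (1 + expR x) <= cabs (x +i* y) * (1 + expR x) by rewrite ler_wpM2r//; lra.
lra.
Qed.

(** No smallness of w - z is assumed: it is applied to n times a logarithm and n times its quadratic
    approximation, whose difference may be large. *)
Lemma cexp_dist w z : cabs (cexp w - cexp z) <= 3 * cabs (w - z) * (cabs (cexp w) + cabs (cexp z)).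
Proof.
have -> : cexp w - cexp z = cexp z * (cexp (w - z) - 1) by rewrite mulrBr mulr1 -cexpD addrCA subrr addr0.
rewrite cabsM (le_trans (ler_wpM2l (cabs_ge0 _) (cexp_sub1_le _)))//.
rewrite -cabs_cexp [leRHS](_ : _ = 3 * cabs (w - z) * (cabs (cexp z) * (1 + cabs (cexp (w - z))))); last first.
  by rewrite [in RHS]mulrDr mulr1 -cabsM -cexpD [z + _]addrCA subrr addr0 [cabs (cexp z) + _]addrC.
by rewrite mulrCA.
Qed.

Lemma cexp_clog z : z != 0 -> cexp (clog z) = z.
Proof.
move=> z0; have r0 : 0 < cabs z.
  by rewrite lt_neqAle cabs_ge0 andbT eq_sym; apply/eqP => /cabs0_eq0/eqP; rewrite (negbTE z0).
have rz := cabs_sqr z.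
set r := cabs z in r0 rz *.
have hr : `|complex.Re z / r| <= 1.
  by rewrite normrM normfV (ger0_norm (ltW r0)) ler_pdivrMr// mul1r cabs_Re.
have hin : complex.Re z / r \in `[(-1), 1] by rewrite in_itv /= -ler_norml.
rewrite /clog /cexp /= -/r lnK ?posrE//.
have c1 : cos (acos (complex.Re z / r)) = complex.Re z / r by rewrite acosK.
have s1 : sin (acos (complex.Re z / r)) = `|complex.Im z| / r.
  move: hr; rewrite ler_norml => hr; rewrite sin_acos//.
  have -> : 1 - (complex.Re z / r) ^+ 2 = (`|complex.Im z| / r) ^+ 2.
    rewrite !exprMn real_normK ?num_real// exprVn.
    have r2 : r ^+ 2 != 0 by rewrite expf_neq0// gt_eqF.
    by rewrite -[1](divff r2) -mulrBl rz addrAC subrr add0r.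
  by rewrite sqrtr_sqr ger0_norm// divr_ge0 ?normr_ge0// ltW.
have rn0 : r != 0 by rewrite gt_eqF.
case: ifPn => im.
  rewrite c1 s1 ger0_norm//; apply/eqP; rewrite eq_complex /=; apply/andP; split; apply/eqP; field; exact: rn0.
rewrite cosN sinN c1 s1 ltr0_norm ?ltNge//; apply/eqP; rewrite eq_complex /=; apply/andP; split; apply/eqP; field; exact: rn0.
Qed.

(* Here [ln 0 = 0] and [0 / 0 = 0], so [clog 0] is i pi / 2: as the logarithm in (S5)
   tends to 0, the eigenvalue does not vanish near 0. *)
Lemma cabs_clog0 : 1 <= cabs (clog (0 : R[i])).
Proof.
rewrite (le_trans _ (cabs_Im _))// /clog /= lexx mul0r acos0 ger0_norm ?divr_ge0 ?pi_ge0//.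
by have := @pi_ge2 R; lra.
Qed.

End Log.

(** * Quadratic approximation of the logarithm of the eigenvalue *)

Section Quadratic.
Variables (R : realType) (d : nat).

Definition csmall (x : R) (h : 'cV[R[i]]_d) : Prop := forall i, cabs (h i 0) <= x.
Definition vsmall (x : R) (u : 'cV[R]_d) : Prop := forall i, `|u i 0| <= x.

Lemma nbhs0_csmall (A : set 'cV[R[i]]_d) : nbhs (0 : 'cV[R[i]]_d) A ->
  exists2 x : R, 0 < x & forall h, csmall x h -> A h.
Proof.
move=> /nbhs_ballP[e /= e0 hA].
have eE : e = (complex.Re e)%:C by move: e0; case: e {hA} => a b; rewrite ltcE /= => /andP[/eqP ->].
have r0 : 0 < complex.Re e by rewrite -ltcR -eE.
exists (complex.Re e / 2); first by pos.
move=> h hh; apply: hA; split=> // i j; rewrite !mxE -ball_normE /ball_ /= sub0r normrN (ord1 j).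
by rewrite (rnormE (h i 0 : R[i]^o)) eE ltcR rnorm_cabs; have := hh i; lra.
Qed.

Lemma nbhs0_vsmall (A : set 'cV[R]_d) : nbhs (0 : 'cV[R]_d) A ->
  exists2 x : R, 0 < x & forall u, vsmall x u -> A u.
Proof.
move=> /nbhs_ballP[e /= e0 hA].
exists (e / 2); first by pos.
move=> h hh; apply: hA; split=> // i j; rewrite !mxE -ball_normE /ball_ /= sub0r normrN (ord1 j).
by have := hh i; lra.
Qed.

Lemma csmall_cvec (x : R) (u v : 'cV[R]_d) :
  vsmall (x / 2) u -> vsmall (x / 2) v -> csmall x (cvec u v).
Proof.
move=> hu hv i; rewrite mxE (le_trans (cabs_le_ReIm _))//=.
by have := hu i; have := hv i; lra.
Qed.

Definition dotv (K : pzRingType) (u v : 'cV[K]_d) : K := (u^T *m v) 0 0.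

Lemma dotvE (K : pzRingType) (u v : 'cV[K]_d) : dotv u v = \sum_i u i 0 * v i 0.
Proof. by rewrite /dotv mxE; apply: eq_bigr => i _; rewrite mxE. Qed.

Lemma qformE (K : comPzRingType) (G : 'M[K]_d) (z : 'cV[K]_d) :
  qform G z = \sum_i \sum_j z i 0 * G i j * z j 0.
Proof.
rewrite /qform mxE exchange_big /=; apply: eq_bigr => j _; rewrite mxE mulr_suml.
by apply: eq_bigr => i _; rewrite mxE.
Qed.

Lemma sqr_le_sqnorm (u : 'cV[R]_d) i : u i 0 ^+ 2 <= sqnorm u.
Proof. by rewrite /sqnorm (bigD1 i)//= lerDl sumr_ge0// => j _; exact: sqr_ge0. Qed.

Definition entry_sum (G : 'M[R]_d) : R := \sum_i \sum_j `|G i j|.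

Lemma entry_sum_ge0 G : 0 <= entry_sum G.
Proof. by apply: sumr_ge0 => i _; apply: sumr_ge0 => j _. Qed.

Lemma qform_le (G : 'M[R]_d) u : `|qform G u| <= entry_sum G * sqnorm u.
Proof.
rewrite qformE (le_trans (ler_norm_sum _ _ _))// /entry_sum mulr_suml; apply: ler_sum => i _.
rewrite (le_trans (ler_norm_sum _ _ _))// mulr_suml; apply: ler_sum => j _.
rewrite mulrAC [leLHS]normrM mulrC ler_wpM2l// normrM.
have := sqr_le_sqnorm u i; have := sqr_le_sqnorm u j.
have := sqr_ge0 (`|u i 0| - `|u j 0|); rewrite sqrrB !real_normK ?num_real//; lra.
Qed.

Lemma cqform_csmall (G : 'M[R]_d) (x : R) z : csmall x z -> cabs (cqform G z) <= entry_sum G * x ^+ 2.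
Proof.
move=> hz; rewrite /cqform qformE (le_trans (ler_cabs_sum _ _ _))// /entry_sum mulr_suml.
apply: ler_sum => i _; rewrite (le_trans (ler_cabs_sum _ _ _))// mulr_suml; apply: ler_sum => j _.
rewrite mulrAC cabsM mulrC mxE cabs_real ler_wpM2l// cabsM expr2.
by apply: ler_pM; rewrite ?cabs_ge0.
Qed.

Lemma dotv_csmall (m : 'cV[R]_d) (x : R) z : csmall x z ->
  cabs (dotv (rvec m) z) <= norm1 m * x.
Proof.
move=> hz; rewrite dotvE (le_trans (ler_cabs_sum _ _ _))// /norm1 mulr_suml; apply: ler_sum => i _.
by rewrite cabsM mxE cabs_real ler_wpM2l.
Qed.

Lemma cqform_cvec_Re (G : 'M[R]_d) u v :
  complex.Re (cqform G (cvec u v)) = qform G u - qform G v.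
Proof.
rewrite /cqform !qformE raddf_sum -sumrB; apply: eq_bigr => i _.
rewrite raddf_sum -sumrB; apply: eq_bigr => j _; rewrite !mxE /=; ring.
Qed.

Lemma cqform_imag (G : 'M[R]_d) v : cqform G (cvec 0 v) = (- qform G v)%:C.
Proof.
rewrite /cqform !qformE -sumrN rmorph_sum; apply: eq_bigr => i _ /=.
rewrite -sumrN rmorph_sum; apply: eq_bigr => j _; rewrite !mxE.
by apply/eqP; rewrite eq_complex /=; apply/andP; split; apply/eqP; ring.
Qed.

Lemma dotv_cvec_Re (m u v : 'cV[R]_d) : complex.Re (dotv (rvec m) (cvec u v)) = dotv m u.
Proof. by rewrite !dotvE raddf_sum; apply: eq_bigr => i _; rewrite !mxE /=; ring. Qed.

Lemma dotv_imag (m v : 'cV[R]_d) : dotv (rvec m) (cvec 0 v) = 0 +i* dotv m v.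
Proof.
rewrite !dotvE; apply/eqP; rewrite eq_complex !raddf_sum /=; apply/andP; split; apply/eqP.
  by rewrite big1// => i _; rewrite !mxE /=; ring.
by apply: eq_bigr => i _; rewrite !mxE /=; ring.
Qed.

Lemma sqr_sum_le (a : 'I_d -> R) : (\sum_i a i) ^+ 2 <= d%:R * \sum_i a i ^+ 2.
Proof.
rewrite expr2 mulr_suml.
apply: (@le_trans _ _ (\sum_i \sum_j (a i ^+ 2 / 2 + a j ^+ 2 / 2))).
  apply: ler_sum => i _; rewrite mulr_sumr; apply: ler_sum => j _.
  by have := sqr_ge0 (a i - a j); rewrite sqrrB; lra.
rewrite (eq_bigr (fun i => d%:R * (a i ^+ 2 / 2) + \sum_j a j ^+ 2 / 2)); last first.
  by move=> i _; rewrite big_split /= sumr_const card_ord mulr_natl.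
rewrite big_split /= -mulr_sumr sumr_const card_ord -[X in _ + X]mulr_natl -mulr_suml.
lra.
Qed.

Lemma cnorm1_cvec_le (u v : 'cV[R]_d) :
  cnorm1 (cvec u v) ^+ 2 <= d%:R * (sqnorm u + sqnorm v).
Proof.
rewrite /cnorm1 (le_trans (sqr_sum_le _))// ler_wpM2l// /sqnorm -big_split /=.
by apply: ler_sum => i _; rewrite cabs_sqr mxE.
Qed.

Variables (rho : 'cV[R[i]]_d -> R[i]) (m : 'cV[R]_d) (Gamma : 'M[R]_d).
Hypothesis h5 : S5 rho m Gamma.

Definition quad (z : 'cV[R[i]]_d) : R[i] := dotv (rvec m) z + 2^-1 * cqform Gamma z.

Lemma cnorm1_csmall (x : R) (z : 'cV[R[i]]_d) : csmall x z -> cnorm1 z <= d%:R * x.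
Proof.
move=> hz; rewrite /cnorm1 (le_trans (ler_sum _ (fun i _ => hz i)))//.
by rewrite sumr_const card_ord mulr_natl.
Qed.

Lemma cnorm1_ge0 (z : 'cV[R[i]]_d) : 0 <= cnorm1 z.
Proof. by apply: sumr_ge0 => i _; exact: cabs_ge0. Qed.

Lemma spd_Gamma : spd Gamma.
Proof. by have [_ _ _ GT Gp] := h5; split. Qed.

Lemma clog_rho_quad (e : R) : 0 < e -> exists2 x : R, 0 < x & forall z, csmall x z ->
  cabs (clog (rho z) - quad z) <= e * cnorm1 z ^+ 2.
Proof.
move=> e0; have [_ /eqoP h _ _ _] := h5.
have e0' : 0 < e%:C by rewrite ltcR.
have [x x0 hx] := nbhs0_csmall (h _ e0'); exists x => // z /hx /=.
rewrite (rnormE (_ : R[i]^o)) ger0_norm ?lecR ?sqr_ge0// -rmorphM lecR rnorm_cabs.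
by [].
Qed.

Lemma quad_csmall (x : R) z : 0 <= x -> x <= 1 -> csmall x z ->
  cabs (quad z) <= (norm1 m + entry_sum Gamma) * x.
Proof.
move=> x0 x1 hz; rewrite (le_trans (ler_cabsD _ _))// cabsM.
have -> : cabs (2^-1 : R[i]) = 2^-1 by rewrite cabsV cabs_nat.
have h1 := dotv_csmall m hz; have h2 := cqform_csmall Gamma hz.
have h3 : entry_sum Gamma * x ^+ 2 <= entry_sum Gamma * x.
  by rewrite ler_wpM2l ?entry_sum_ge0// expr2; nra.
have := cabs_ge0 (cqform Gamma z); lra.
Qed.

Lemma clog_rho_small (y : R) : 0 < y -> exists2 x : R, 0 < x & forall z, csmall x z ->
  cabs (clog (rho z)) <= y.
Proof.
move=> y0; have [x1 x10 hx1] := clog_rho_quad (@ltr01 R).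
pose W := norm1 m + entry_sum Gamma + d%:R ^+ 2 + 1.
have n0 : 0 <= norm1 m by apply: sumr_ge0.
have d0 : (0 : R) <= d%:R ^+ 2 by rewrite exprn_ge0.
have s0 := entry_sum_ge0 Gamma.
have W0 : 0 < W by rewrite /W; lra.
exists (Num.min x1 (Num.min 1 (y / W))); first by rewrite !lt_min x10 ltr01 /=; pos.
set x := Num.min _ _ => z hz.
have x0 : 0 < x by rewrite !lt_min x10 ltr01 /=; pos.
have xx1 : x <= x1 by rewrite ge_min lexx.
have x1' : x <= 1 by rewrite !ge_min lexx !orbT.
have xy : x * W <= y by rewrite -ler_pdivlMr// !ge_min lexx !orbT.
have h1 := hx1 z (fun i => le_trans (hz i) xx1).
have h2 := quad_csmall (ltW x0) x1' hz.
have h3 : cnorm1 z ^+ 2 <= d%:R ^+ 2 * x.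
  apply: (@le_trans _ _ ((d%:R * x) ^+ 2)).
    by rewrite lerXn2r ?nnegrE ?cnorm1_ge0 ?mulr_ge0 ?(ltW x0)//; exact: cnorm1_csmall.
  by rewrite exprMn ler_wpM2l// expr2; nra.
have := ler_cabsD (clog (rho z) - quad z) (quad z); rewrite subrK.
by move: xy; rewrite /W; lra.
Qed.

Lemma rho_clog : exists2 x : R, 0 < x & forall z, csmall x z -> rho z = cexp (clog (rho z)).
Proof.
have h2 : (0 : R) < 2^-1 by lra.
have [x x0 hx] := clog_rho_small h2; exists x => // z /hx hz.
rewrite cexp_clog//; apply/eqP => rz; move: hz; rewrite rz.
have := cabs_clog0 R; lra.
Qed.

Lemma rho_continuous0 (y : R) : 0 < y -> exists2 x : R, 0 < x & forall z, csmall x z ->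
  cabs (rho z - 1) <= y.
Proof.
move=> y0; have y1 : 0 < Num.min 2^-1 (y / 12) by rewrite lt_min; apply/andP; split; pos.
have [x1 x10 hx1] := clog_rho_small y1; have [x2 x20 hx2] := rho_clog.
exists (Num.min x1 x2); first by rewrite lt_min x10.
move=> z hz; have xx1 : Num.min x1 x2 <= x1 by rewrite ge_min lexx.
have xx2 : Num.min x1 x2 <= x2 by rewrite ge_min lexx orbT.
rewrite (hx2 z (fun i => le_trans (hz i) xx2)).
have := hx1 z (fun i => le_trans (hz i) xx1); rewrite le_min.
set w := clog _ => /andP[w2 wy]; rewrite (le_trans (cexp_sub1_le _))//.
have h1 : expR (complex.Re w) <= 3.
  have h : complex.Re w <= 2^-1 by have := cabs_Re w; have := ler_norm (complex.Re w); lra.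
  have e1 := expR_ge1Dx (- complex.Re w); have e2 := expRxMexpNx_1 (complex.Re w).
  have e3 := expR_gt0 (complex.Re w).
  have : expR (complex.Re w) * 2^-1 <= expR (complex.Re w) * expR (- complex.Re w).
    by rewrite ler_pM2l//; lra.
  lra.
have := cabs_ge0 w; nra.
Qed.

(** The real part of the quadratic approximation at u + i v is m.u + (Gamma(u) - Gamma(v)) / 2.
    Positive definiteness in [v] absorbs the remainder, so the Gaussian decay in [v] survives every
    small tilt. *)
Lemma cabs_rho_le : exists x c C : R, [/\ 0 < x, 0 < c, 0 <= C & forall u v : 'cV[R]_d,
  vsmall x u -> vsmall x v ->
  cabs (rho (cvec u v)) <= expR (dotv m u + C * sqnorm u - c * sqnorm v)].
Proof.
have [l l0 hl] := spd_lower spd_Gamma.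
pose D : R := d%:R + 1; have D0 : 0 < D by rewrite /D; have : (0 : R) <= d%:R by []; lra.
(* The remainder then takes at most l / 4 of the available decay l / 2 in [v]. *)
pose e := l / (4 * D); have e0 : 0 < e by rewrite /e; pos.
have eD : e * d%:R <= l / 4.
  have -> : l / 4 = e * D by rewrite /e; field; rewrite gt_eqF.
  by rewrite ler_pM2l// /D; lra.
have [x1 x10 hx1] := clog_rho_quad e0; have [x2 x20 hx2] := rho_clog.
exists (Num.min x1 x2 / 2), (l / 4), (entry_sum Gamma + l); split.
- by rewrite divr_gt0// lt_min x10.
- by pos.
- by have := entry_sum_ge0 Gamma; lra.
move=> u v /csmall_cvec su /su hz.
have xx1 : Num.min x1 x2 <= x1 by rewrite ge_min lexx.
have xx2 : Num.min x1 x2 <= x2 by rewrite ge_min lexx orbT.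
rewrite (hx2 _ (fun i => le_trans (hz i) xx2)) cabs_cexp ler_expR.
have := hx1 _ (fun i => le_trans (hz i) xx1).
set w := clog _ => h1.
have h2 : complex.Re (quad (cvec u v)) = dotv m u + 2^-1 * (qform Gamma u - qform Gamma v).
  rewrite /quad raddfD /= dotv_cvec_Re -cqform_cvec_Re; congr (_ + _).
  rewrite -(rmorph_nat (real_complex R)) -fmorphV; case: (cqform _ _) => a b /=; ring.
have h3 := cabs_Re (w - quad (cvec u v)); rewrite raddfB /= h2 in h3.
have h4 := ler_wpM2l (ltW e0) (cnorm1_cvec_le u v).
have h5' := ler_norm (complex.Re w - (dotv m u + 2^-1 * (qform Gamma u - qform Gamma v))).
have h6 := hl v; have h7 := qform_le Gamma u; have h8 := ler_norm (qform Gamma u).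
have h9 := ler_wpM2r (addr_ge0 (sqnorm_ge0 u) (sqnorm_ge0 v)) eD.
have h10 := sqnorm_ge0 u; have h11 := mulr_ge0 (entry_sum_ge0 Gamma) h10.
have h12 := mulr_ge0 (ltW l0) h10.
lra.
Qed.

End Quadratic.


(** * Local limit theorem and tilted bounds *)

Section PolynomialGeometric.
Variable R : realType.

Lemma poly_geometric_bounded (s : R) d : 0 <= s -> s < 1 ->
  exists2 C : R, 0 <= C & forall n, n.+1%:R ^+ d * s ^+ n <= C.
Proof.
move=> s0 s1; pose a : R := (1 - s) / d.+1%:R.
have a0 : 0 < a by rewrite /a divr_gt0 ?ltr0n//; lra.
exists (a^-1 ^+ d.+1 * expR (1 - s)).
  by rewrite mulr_ge0 ?expR_ge0// exprn_ge0// invr_ge0 ltW.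
move=> n.
have h1 : s ^+ n <= expR (- ((1 - s) * n%:R)).
  rewrite mulrC -mulrN expRM_natl lerXn2r ?nnegrE ?expR_ge0//.
  by have := expR_ge1Dx (- (1 - s)); lra.
have h2 : (a * n.+1%:R) ^+ d.+1 <= expR ((1 - s) * n.+1%:R).
  have -> : (1 - s) * n.+1%:R = d.+1%:R * (a * n.+1%:R).
    by rewrite /a mulrA [d.+1%:R * _]mulrC divfK ?pnatr_eq0.
  have h2 : a * n.+1%:R <= expR (a * n.+1%:R) by have := expR_ge1Dx (a * n.+1%:R); lra.
  by rewrite expRM_natl lerXn2r// nnegrE ?expR_ge0// mulr_ge0// ltW.
have h3 : n.+1%:R ^+ d.+1 <= a^-1 ^+ d.+1 * expR ((1 - s) * n.+1%:R).
  rewrite exprVn mulrC ler_pdivlMr ?exprn_gt0//.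
  by rewrite -exprMn [n.+1%:R * a]mulrC.
apply: (@le_trans _ _ (n.+1%:R ^+ d.+1 * s ^+ n)).
  rewrite ler_wpM2r ?exprn_ge0// ler_weXn2l//.
  by rewrite ler1n.
apply: (@le_trans _ _ (a^-1 ^+ d.+1 * expR ((1 - s) * n.+1%:R) * expR (- ((1 - s) * n%:R)))).
  by apply: ler_pM; rewrite ?exprn_ge0.
rewrite -mulrA -expRD ler_wpM2l ?exprn_ge0 ?invr_ge0 ?(ltW a0)// ler_expR -natr1; lra.
Qed.

(** Write s = t^2: one factor t^n compensates the polynomial, the other tends to 0. *)
Lemma poly_geometric_small (s C e : R) d : 0 <= s -> s < 1 -> 0 <= C -> 0 < e ->
  exists n0, forall n, (n0 <= n)%N -> n.+1%:R ^+ d * (C * s ^+ n) <= e.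
Proof.
move=> s0 s1 C0 e0; pose t := Num.sqrt s.
have t0 : 0 <= t by exact: sqrtr_ge0.
have t1 : t < 1 by rewrite -sqrtr1 ltr_sqrt.
have [D D0 hD] := poly_geometric_bounded d t0 t1.
have [n0 hn0] := geometric_small (C * D) t0 t1 e0.
exists n0 => n /hn0; apply: le_trans.
have -> : s = t * t by rewrite -expr2 sqr_sqrtr.
rewrite exprMn [leLHS](_ : _ = C * (n.+1%:R ^+ d * t ^+ n) * t ^+ n); last by ring.
by rewrite ler_wpM2r ?exprn_ge0// ler_wpM2l.
Qed.

Lemma sqrt_succ_le n : Num.sqrt n.+1%:R <= n.+1%:R :> R.
Proof.
have s0 : 0 <= Num.sqrt n.+1%:R :> R by exact: sqrtr_ge0.
have s2 : Num.sqrt n.+1%:R ^+ 2 = n.+1%:R :> R by rewrite sqr_sqrtr.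
have : (1 : R) <= n.+1%:R by rewrite ler1n.
rewrite -{1 3}s2 => h.
have : 1 <= Num.sqrt n.+1%:R :> R by rewrite -(@ler_pXn2r _ 2) ?nnegrE// expr1n.
by move: s0 => _; rewrite expr2; nra.
Qed.

End PolynomialGeometric.

(** * Local limit theorem, where [a n z] stands for alpha (Q_z^n f), [c n k] for its coefficient and
    [A] for alpha(1) pi(f) *)

Section LocalLimit.
Variables (R : realType) (d : nat).
Variables (a : nat -> 'cV[R[i]]_d -> R[i]) (c : nat -> multi d -> R[i]) (A : R[i]).
Variables (rho : 'cV[R[i]]_d -> R[i]) (m : 'cV[R]_d) (Gamma : 'M[R]_d).
Hypothesis h5 : S5 rho m Gamma.
Hypothesis fourier : exists2 x : R, 0 < x & forall z : 'cV[R]_d, vsmall x z -> forall n k,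
  @tends_to R R[i]^o (fun N => gavg N (fun u =>
     cexp (- cdot (cvec z u) k) * a n (cvec z u) : R[i]^o)) (c n k).
Hypothesis near0 : exists C r : R, [/\ 0 <= C, 0 <= r, r < 1 &
  forall y : R, 0 < y -> exists2 x : R, 0 < x & forall h, csmall x h -> forall n,
    cabs (a n h - rho h ^+ n * A) <= y * cabs (rho h) ^+ n + C * r ^+ n].
Hypothesis away : forall delta : R, 0 < delta -> exists C r : R, [/\ 0 <= C, 0 <= r, r < 1 &
  exists2 x : R, 0 < x & forall z : 'cV[R]_d, vsmall x z -> forall u, cube u -> delta <= norm1 u ->
    forall n, cabs (a n (cvec z u)) <= C * r ^+ n * cabs (rho (rvec z)) ^+ n].

Lemma rvec_cvec (z : 'cV[R]_d) : rvec z = cvec z 0.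
Proof. by apply/colP => i; rewrite !mxE. Qed.

Lemma norm1_vsmall (u : 'cV[R]_d) (x : R) : norm1 u <= x -> vsmall x u.
Proof. by move=> h i; rewrite (le_trans _ h)// /norm1 (bigD1 i)//= lerDl sumr_ge0. Qed.

Lemma cdot_cvec_Re (z u : 'cV[R]_d) k : complex.Re (cdot (cvec z u) k) = rdot z k.
Proof.
rewrite /cdot /rdot raddf_sum; apply: eq_bigr => i _.
by rewrite mxE -(rmorph_nat (real_complex R)) /=; ring.
Qed.

Lemma cabs_cexpN_cdot (z u : 'cV[R]_d) k : cabs (cexp (- cdot (cvec z u) k)) = expR (- rdot z k).
Proof. by rewrite cabs_cexp raddfN /= cdot_cvec_Re. Qed.

Lemma sqnorm0 : sqnorm (0 : 'cV[R]_d) = 0.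
Proof. by rewrite /sqnorm big1// => i _; rewrite mxE expr0n. Qed.

(** Rescaling by sqrt (n + 1) gives a product of one-dimensional Gaussian sums of mesh at most 1,
    bounded independently of n. The factor exp (b pi^2) replaces n by n + 1 on the cube and so
    includes n = 0. *)
Lemma gavg_gauss_le (b : R) n : 0 < b -> exists N0, (0 < N0)%N /\ forall N, (N0 <= N)%N ->
  Num.sqrt n.+1%:R ^+ d * ((N + N)%:R^-1 ^+ d *
    gridsum (grid (pi / N%:R) N) (fun u : 'cV[R]_d => expR (- (b * (n%:R * sqnorm u))))) <=
  (expR (b * pi ^+ 2) * gauss_bound b) ^+ d.
Proof.
move=> b0; pose s : R := Num.sqrt n.+1%:R.
have s0 : 0 < s by rewrite sqrtr_gt0 ltr0n.
have s2 : s ^+ 2 = n.+1%:R by rewrite sqr_sqrtr.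
exists (Num.truncn (s * pi)).+1; split=> // N hN.
have N0 : 0 < N%:R :> R by rewrite ltr0n (leq_trans _ hN).
have hN1 : s * pi / N%:R <= 1.
  rewrite ler_pdivrMr// mul1r (le_trans (ltW (truncnS_gt _)))// ler_nat//.
pose g (t : R) := expR (b * pi ^+ 2) * expR (- (b * (s * t) ^+ 2)).
have -> : s ^+ d * ((N + N)%:R^-1 ^+ d *
    gridsum (grid (pi / N%:R) N) (fun u : 'cV[R]_d => expR (- (b * (n%:R * sqnorm u))))) =
  (s / (N + N)%:R) ^+ d * gridsum (grid (pi / N%:R) N) (fun u : 'cV[R]_d => expR (- (b * (n%:R * sqnorm u)))).
  by rewrite mulrA -exprMn.
have q0 : 0 <= s / (N + N)%:R by rewrite divr_ge0// ltW.
apply: (@le_trans _ _ ((s / (N + N)%:R) ^+ d * gridsum (grid (pi / N%:R) N)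
    (fun u : 'cV[R]_d => \prod_i g (u i 0)))).
  rewrite ler_wpM2l ?exprn_ge0//; apply: ler_gridsum => u hu.
  rewrite /g (eq_bigr (fun i => expR (b * pi ^+ 2 - b * (s * u i 0) ^+ 2))); last first.
    by move=> i _; rewrite expRD.
  rewrite -expR_sum ler_expR /sqnorm mulr_sumr mulr_sumr -sumrN; apply: ler_sum => i _.
  have := grid_cube (hu i) => ui.
  have ui2 : u i 0 ^+ 2 <= pi ^+ 2 by rewrite -real_normK ?num_real// lerXn2r ?nnegrE ?pi_ge0.
  rewrite exprMn s2 -natr1; have := ler_wpM2l (ltW b0) ui2; lra.
rewrite (gridsum_prod _ (fun _ => g)) prodr_const card_ord -exprMn; apply: lerXn2r; rewrite ?nnegrE; last first.
- rewrite /g -mulr_sumr mulrCA ler_wpM2l ?expR_ge0//.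
  have -> : \sum_(t <- grid (pi / N%:R) N) expR (- (b * (s * t) ^+ 2)) =
     \sum_(t <- grid (s * pi / N%:R) N) expR (- (b * (t + 0) ^+ 2)).
    rewrite -mulrA -(grid_scale s (pi / N%:R)) [RHS]big_map; apply: eq_bigr => t _; rewrite addr0//.
  have h0 : 0 < s * pi / N%:R by rewrite divr_gt0// mulr_gt0// pi_gt0.
  have := sum_grid_gauss_le N 0 b0 h0 hN1.
  set S := \sum_(t <- _) _ => h; apply: le_trans h.
  rewrite ler_wpM2r//; first by apply: sumr_ge0 => t _; exact: expR_ge0.
  rewrite natrD -mulrA ler_pM2l// ler_pdivlMr// mulrC ler_pdivrMr ?addr_gt0//.
  have := @pi_ge2 R; nra.
- by rewrite mulr_ge0 ?expR_ge0// /gauss_bound; pos.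
- by rewrite mulr_ge0 ?sumr_ge0// => t _; rewrite mulr_ge0 ?expR_ge0.
Qed.

Lemma gavg_ge0_le (F : 'cV[R]_d -> R[i]) N (b : R) (g : 'cV[R]_d -> R) :
  (forall u, cube u -> cabs (F u) <= g u) ->
  (N + N)%:R^-1 ^+ d * gridsum (grid (pi / N%:R) N) g <= b ->
  cabs (@gavg R R[i]^o d N F) <= b.
Proof.
move=> Fg; apply: le_trans; rewrite (le_trans (@rnorm_gavg _ R[i]^o _ _ _))//.
rewrite ler_wpM2l ?exprn_ge0 ?invr_ge0//; apply: ler_gridsum => u hu.
by apply: Fg => i; exact: grid_cube.
Qed.

Lemma sqrtn_pow_le (x : R) n : 0 <= x -> Num.sqrt n.+1%:R ^+ d * x <= n.+1%:R ^+ d * x.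
Proof.
by move=> x0; rewrite ler_wpM2r// lerXn2r ?nnegrE ?sqrtr_ge0// sqrt_succ_le.
Qed.

Lemma gavg_gauss_geom (b K s C : R) : 0 < b -> 0 <= K -> 0 <= C -> forall n,
  exists N0, (0 < N0)%N /\ forall N, (N0 <= N)%N ->
  forall F : 'cV[R]_d -> R[i],
  (forall u, cube u -> cabs (F u) <= K * expR (- (b * (n%:R * sqnorm u))) + C * s ^+ n) ->
  Num.sqrt n.+1%:R ^+ d * cabs (@gavg R R[i]^o d N F) <=
  K * (expR (b * pi ^+ 2) * gauss_bound b) ^+ d + Num.sqrt n.+1%:R ^+ d * (C * s ^+ n).
Proof.
move=> b0 K0 C0 n; have [N0 [N00 hN0]] := gavg_gauss_le n b0.
exists N0; split=> // N hN F hF.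
have Np : (0 < N)%N := leq_trans N00 hN.
have s0 : (0 : R) <= Num.sqrt n.+1%:R ^+ d by rewrite exprn_ge0 ?sqrtr_ge0.
have := hN0 N hN; set E := _ * gridsum _ _ => hE.
have : cabs (@gavg R R[i]^o d N F) <= K * E + C * s ^+ n.
  apply: (gavg_ge0_le hF); rewrite gridsumD gridsumMl gridsum_const size_grid mulrDr.
  rewrite mulrCA lerD2l mulrA -exprMn mulVf ?expr1n ?mul1r//.
  by rewrite pnatr_eq0 -lt0n addn_gt0 Np.
move=> h; rewrite (le_trans (ler_wpM2l s0 h))// mulrDr lerD2r mulrCA.
by rewrite ler_wpM2l.
Qed.

(** An exponential tilt that retains the factor n^(d/2): near theta = 0 the Gaussian decay of the
    eigenvalue is averaged, elsewhere geometric decay beats any power of n. *)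
Lemma tilt_bound : exists C x : R, [/\ 0 <= C, 0 < x & forall z : 'cV[R]_d, vsmall x z ->
  forall n k, Num.sqrt n.+1%:R ^+ d * cabs (c n k) <=
    C * expR (n%:R * (dotv m z + C * sqnorm z) - rdot z k)].
Proof.
have [x1 [b [C1 [x10 b0 C10 hrho]]]] := cabs_rho_le h5.
have [C2 [r [C20 r0 r1 hnear]]] := near0.
have [x2 x20 hx2] := hnear _ (@ltr01 R).
have [x3 x30 hx3] := fourier.
pose delta := Num.min x1 (x2 / 2).
have delta0 : 0 < delta by rewrite lt_min x10; pos.
have [C4 [r4 [C40 r40 r41 [x4 x40 hx4]]]] := away delta0.
pose nm := norm1 m + 1.
have n0 : 0 <= norm1 m by apply: sumr_ge0.
have nm1 : 0 < nm by rewrite /nm; lra.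
pose s := Num.max ((1 + r) / 2) r4.
have s0 : 0 <= s by rewrite le_max r40 orbT.
have s1 : s < 1 by rewrite gt_max r41 andbT; lra.
have [D D0 hD] := poly_geometric_bounded d s0 s1.
pose K := cabs A + 1; have K0 : 0 <= K by rewrite /K; have := cabs_ge0 A; lra.
pose Q := K * (expR (b * pi ^+ 2) * gauss_bound b) ^+ d + (C2 + C4) * D.
have Q0 : 0 <= Q.
  have g0 : 0 <= gauss_bound b by rewrite /gauss_bound; pos.
  rewrite /Q addr_ge0//; last by rewrite mulr_ge0// addr_ge0.
  by rewrite mulr_ge0// exprn_ge0// mulr_ge0// expR_ge0.
exists (Q + C1), (Num.min (Num.min delta x3) (Num.min x4 ((1 - r) / 2 / nm))); split.
- by rewrite addr_ge0.
- by rewrite !lt_min x10 x30 x40 /=; apply/andP; split; [pos|rewrite divr_gt0//; lra].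
set x := Num.min _ _ => z hz n k.
have sm (y : R) : x <= y -> vsmall y z by move=> xy i; exact: le_trans (hz i) xy.
have zx1 : vsmall x1 z by apply: sm; rewrite !ge_min lexx.
have zx2 : vsmall (x2 / 2) z by apply: sm; rewrite !ge_min lexx !orbT.
have zx3 : vsmall x3 z by apply: sm; rewrite !ge_min lexx !orbT.
have zx4 : vsmall x4 z by apply: sm; rewrite !ge_min lexx !orbT.
pose beta := dotv m z + C1 * sqnorm z.
(* The tilt is so small that exp beta >= (1 + r) / 2, and ((1 + r) / 2)^2 >= r. *)
have zm : r <= (1 + r) / 2 * expR beta.
  have xt : nm * x <= (1 - r) / 2 by rewrite mulrC -ler_pdivlMr// !ge_min lexx !orbT.
  have h1 : - ((1 - r) / 2) <= beta.
    have : `|dotv m z| <= norm1 m * x.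
      rewrite dotvE (le_trans (ler_norm_sum _ _ _))// /norm1 mulr_suml.
      by apply: ler_sum => i _; rewrite normrM ler_wpM2l.
    rewrite ler_norml => /andP[h _].
    have x0 : 0 <= x by rewrite !le_min ?(ltW delta0) ?(ltW x30) ?(ltW x40) ?(ltW x10)//=; rewrite !divr_ge0 ?(ltW nm1)//; lra.
    have := mulr_ge0 C10 (sqnorm_ge0 z); move: xt; rewrite /beta /nm; lra.
  have h2 := expR_ge1Dx beta.
  apply: (@le_trans _ _ ((1 + r) / 2 * (1 - (1 - r) / 2))); last by rewrite ler_wpM2l//; lra.
  by have := sqr_ge0 (1 - r); rewrite sqrrB; lra.
have rs : r ^+ n <= s ^+ n * expR (n%:R * beta).
  rewrite expRM_natl -exprMn lerXn2r ?nnegrE ?mulr_ge0 ?expR_ge0// (le_trans zm)//.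
  by rewrite ler_wpM2r ?expR_ge0// le_max lexx.
have rho_n u : vsmall x1 u -> cabs (rho (cvec z u)) ^+ n <= expR (n%:R * beta) * expR (- (b * (n%:R * sqnorm u))).
  move=> hu; rewrite -expRD.
  have -> : n%:R * beta - b * (n%:R * sqnorm u) = n%:R * (beta - b * sqnorm u) by ring.
  by rewrite expRM_natl lerXn2r ?nnegrE ?cabs_ge0 ?expR_ge0//; exact: hrho.
have E0 := expR_ge0 (n%:R * beta).
have bound u : cube u -> cabs (a n (cvec z u)) <=
    expR (n%:R * beta) * (K * expR (- (b * (n%:R * sqnorm u))) + (C2 + C4) * s ^+ n).
  move=> cu; have sn : 0 <= s ^+ n by rewrite exprn_ge0.
  have g0 := expR_ge0 (- (b * (n%:R * sqnorm u))).
  case: (lerP delta (norm1 u)) => du.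
    rewrite (le_trans (hx4 z zx4 u cu du n))// rvec_cvec.
    have h0 : vsmall x1 (0 : 'cV[R]_d) by move=> i; rewrite mxE normr0 ltW.
    have := rho_n 0 h0; rewrite sqnorm0 !mulr0 oppr0 expR0 mulr1.
    move=> h1.
    have h2 : r4 ^+ n <= s ^+ n by rewrite lerXn2r ?nnegrE// le_max lexx orbT.
    have h3 : C4 * r4 ^+ n * cabs (rho (cvec z 0)) ^+ n <= C4 * s ^+ n * expR (n%:R * beta).
      by apply: ler_pM; rewrite ?mulr_ge0 ?exprn_ge0 ?cabs_ge0// ler_wpM2l.
    rewrite (le_trans h3)// mulrC ler_wpM2l//.
    have := mulr_ge0 K0 g0; have := mulr_ge0 C20 sn; lra.
  have u1 : vsmall x1 u by apply: norm1_vsmall; rewrite (le_trans (ltW du))// ge_min lexx.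
  have u2 : vsmall (x2 / 2) u by apply: norm1_vsmall; rewrite (le_trans (ltW du))// ge_min lexx orbT.
  have h1 := hx2 _ (csmall_cvec zx2 u2) n; rewrite mul1r in h1.
  have h2 := ler_cabsD (a n (cvec z u) - rho (cvec z u) ^+ n * A) (rho (cvec z u) ^+ n * A).
  rewrite subrK cabsM cabsX in h2.
  have h3 := ler_wpM2r K0 (rho_n u u1).
  have h4 := ler_wpM2l C20 rs.
  have h5' := mulr_ge0 (mulr_ge0 C40 sn) E0.
  move: h3; rewrite {1}/K; lra.
have [N0 [N00 hN0]] := gavg_gauss_geom s b0 K0 (addr_ge0 C20 C40) n.
pose W := expR (n%:R * beta - rdot z k).
have W0 : 0 < W by exact: expR_gt0.
have : Num.sqrt n.+1%:R ^+ d * cabs (c n k) <= Q * W.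
  have s0n : (0 : R) < Num.sqrt n.+1%:R ^+ d by rewrite exprn_gt0// sqrtr_gt0.
  rewrite mulrC -ler_pdivlMr//.
  apply: (@tends_to_norm_le R R[i]^o _ _ _ _ (hx3 z zx3 n k)); exists N0 => N hN.
  rewrite ler_pdivlMr// mulrC -ler_pdivrMr//.
  have -> : Num.sqrt n.+1%:R ^+ d * rnorm (@gavg R R[i]^o d N (fun u =>
      cexp (- cdot (cvec z u) k) * a n (cvec z u))) / W =
    Num.sqrt n.+1%:R ^+ d * cabs (@gavg R R[i]^o d N (fun u => (W^-1)%:C *
      (cexp (- cdot (cvec z u) k) * a n (cvec z u)))).
    rewrite -(@gavg_lin R R[i]^o R[i]^o d N (fun t => (W^-1)%:C * t)); last first.
      by move=> v t1 t2; rewrite /GRing.scale /=; ring.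
    by rewrite cabsM cabs_real ger0_norm ?invr_ge0 ?(ltW W0)// rnorm_cabs; ring.
  rewrite (le_trans (hN0 N hN _ _))//.
    move=> u cu; rewrite cabsM cabs_real ger0_norm ?invr_ge0 ?(ltW W0)// cabsM cabs_cexpN_cdot.
    rewrite mulrC ler_pdivrMr// [W]expRD.
    rewrite [leRHS](_ : _ = expR (- rdot z k) * (expR (n%:R * beta) * (K * expR (- (b * (n%:R * sqnorm u))) + (C2 + C4) * s ^+ n))); last by ring.
    by rewrite ler_wpM2l ?expR_ge0// bound.
  rewrite /Q lerD2l mulrCA ler_wpM2l ?addr_ge0//.
  by rewrite (le_trans (sqrtn_pow_le _ _)) ?exprn_ge0.
move=> h; rewrite (le_trans h)//; apply: ler_pM => //; first exact: ltW.
  by rewrite lerDl.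
rewrite ler_expR lerD2r ler_wpM2l// lerD2l ler_wpM2r ?sqnorm_ge0//.
by rewrite lerDr.
Qed.

Definition gauss_model (n : nat) (k : multi d) (u : 'cV[R]_d) : R[i] :=
  A * (cexp (- cdot (cvec 0 u) k) * cexp (n%:R * quad m Gamma (cvec 0 u))).

Lemma norm1_sqr_le (u : 'cV[R]_d) : norm1 u ^+ 2 <= d.+1%:R * sqnorm u.
Proof.
rewrite (le_trans (sqr_sum_le _))// -(eq_bigr _ (fun i _ => esym (real_normK (num_real (u i 0))))).
by rewrite ler_wpM2r ?sqnorm_ge0// ler_nat.
Qed.

Lemma quad_imag_Re (u : 'cV[R]_d) : complex.Re (quad m Gamma (cvec 0 u)) = - (2^-1 * qform Gamma u).
Proof.
rewrite /quad dotv_imag cqform_imag -(rmorph_nat (real_complex R)) -fmorphV -rmorphM /=.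
by rewrite add0r mulrN.
Qed.

(** The error of the logarithm is n times a small multiple of |u|^2. As x exp (- x) <= 1, half of
    the Gaussian decay absorbs the factor n |u|^2 and the other half remains for averaging. The rate
    [b] does not depend on [e]. *)
Lemma gauss_model_near : exists2 b : R, 0 < b & forall e : R, 0 < e ->
  exists C s : R, [/\ 0 <= C, 0 <= s, s < 1 & forall n k u, cube u ->
    cabs (cexp (- cdot (cvec 0 u) k) * a n (cvec 0 u) - gauss_model n k u) <=
    e * expR (- (b * (n%:R * sqnorm u))) + C * s ^+ n].
Proof.
have [x1 [c0 [C1 [x10 c00 C10 hrho]]]] := cabs_rho_le h5.
have [l l0 hl] := spd_lower (spd_Gamma h5).
have [C2 [r [C20 r0 r1 hnear]]] := near0.
(* Both rho^n and the model decay like exp (- 2 b n |u|^2), so one [b] can be spent. *)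
pose b := Num.min (c0 / 2) (l / 4).
have b0 : 0 < b by rewrite lt_min; apply/andP; split; pos.
have b1 : b <= c0 / 2 by rewrite ge_min lexx.
have bc : 2 * b <= c0 by lra.
have b2 : b <= l / 4 by rewrite ge_min lexx orbT.
have bl : 2 * b <= l / 2 by lra.
exists b => // e e0.
have e2 : 0 < e / 2 by pos.
have [x2 x20 hx2] := hnear _ e2.
(* The 6 is the constant 3 of [cexp_dist] times its two moduli; [d.+1] comes from comparing the
   1-norm with the Euclidean norm. *)
pose W := 6 * d.+1%:R * (cabs A + 1) / b.
have A0 := cabs_ge0 A; have d0 : (0 : R) < d.+1%:R by rewrite ltr0n.
have W0 : 0 < W by rewrite /W; pos.
have [x3 x30 hx3] := clog_rho_quad h5 (divr_gt0 e2 W0).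
have [x4 x40 hx4] := rho_clog h5.
pose delta := Num.min (Num.min x1 (x2 / 2)) (Num.min (x3 / 2) (x4 / 2)).
have delta0 : 0 < delta by rewrite !lt_min x10 /= !divr_gt0.
have [C4 [r4 [C40 r40 r41 [x5 x50 hx5]]]] := away delta0.
(* Away from 0 the model itself is geometrically small, since |u|_1 >= delta bounds the Euclidean
   norm from below. *)
pose r5 := expR (- (b * (delta ^+ 2 / d.+1%:R))).
have r50 : 0 <= r5 by exact: expR_ge0.
have r51 : r5 < 1 by rewrite expR_lt1 oppr_lt0 mulr_gt0// divr_gt0// exprn_gt0.
pose s := Num.max r (Num.max r4 r5).
have s0 : 0 <= s by rewrite le_max r0.
have s1 : s < 1 by rewrite !gt_max r1 r41.
have h0 (x : R) : 0 < x -> vsmall x (0 : 'cV[R]_d) by move=> x0 i; rewrite mxE normr0 ltW.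
exists (C2 + C4 + cabs A), s; split=> //; first by rewrite !addr_ge0.
move=> n k u cu.
have sn : 0 <= s ^+ n by rewrite exprn_ge0.
have U0 := sqnorm_ge0 u; have nU0 : 0 <= n%:R * sqnorm u by rewrite mulr_ge0.
have ph : cabs (cexp (- cdot (cvec 0 u) k)) = 1.
  by rewrite cabs_cexpN_cdot /rdot big1 ?oppr0 ?expR0// => i _; rewrite mxE mul0r.
have E2 : cabs (cexp (n%:R * quad m Gamma (cvec 0 u))) <= expR (- (2 * b * (n%:R * sqnorm u))).
  rewrite cabs_cexp -(rmorph_nat (real_complex R)).
  have -> : complex.Re (real_complex R n%:R * quad m Gamma (cvec 0 u)) = n%:R * complex.Re (quad m Gamma (cvec 0 u)).
    by case: (quad _ _ _) => y1 y2 /=; ring.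
  rewrite quad_imag_Re ler_expR mulrN lerN2 mulrCA ler_wpM2l//.
  have := hl u; have := ler_wpM2r U0 bl; lra.
have dd : expR (- (2 * b * (n%:R * sqnorm u))) <= expR (- (b * (n%:R * sqnorm u))).
  by rewrite ler_expR lerN2 ler_wpM2r//; lra.
have -> : cexp (- cdot (cvec 0 u) k) * a n (cvec 0 u) - gauss_model n k u =
   cexp (- cdot (cvec 0 u) k) * (a n (cvec 0 u) - A * cexp (n%:R * quad m Gamma (cvec 0 u))).
  by rewrite /gauss_model mulrBr [A * _]mulrCA.
rewrite cabsM ph mul1r.
have g0 := expR_ge0 (- (b * (n%:R * sqnorm u))).
have sr : r ^+ n <= s ^+ n by rewrite lerXn2r ?nnegrE// le_max lexx.
have sr4 : r4 ^+ n <= s ^+ n by rewrite lerXn2r ?nnegrE// !le_max lexx orbT.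
have sr5 : r5 ^+ n <= s ^+ n by rewrite lerXn2r ?nnegrE// !le_max lexx !orbT.
case: (lerP delta (norm1 u)) => du.
  have t1 := hx5 0 (h0 _ x50) u cu du n.
  have rho1 : cabs (rho (rvec 0)) ^+ n <= 1.
    rewrite exprn_ile1 ?cabs_ge0// rvec_cvec (le_trans (hrho 0 0 (h0 _ x10) (h0 _ x10)))//.
    by rewrite sqnorm0 dotvE big1 ?mulr0 ?addr0 ?subr0 ?expR0// => i _; rewrite [(0 : 'cV[R]_d) _ _]mxE mulr0.
  have t2 : C4 * r4 ^+ n * cabs (rho (rvec 0)) ^+ n <= C4 * s ^+ n.
    rewrite -[leRHS]mulr1; apply: ler_pM; rewrite ?mulr_ge0 ?exprn_ge0 ?cabs_ge0//.
    by rewrite ler_wpM2l.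
  have t3 : expR (- (b * (n%:R * sqnorm u))) <= r5 ^+ n.
    rewrite /r5 -expRM_natl ler_expR mulrN lerN2 mulrCA ler_wpM2l ?(ltW b0)// ler_wpM2l//.
    rewrite ler_pdivrMr// mulrC (le_trans _ (norm1_sqr_le u))// lerXn2r ?nnegrE ?(ltW delta0)//.
    exact: sumr_ge0.
  have t4 := ler_cabsB (a n (cvec 0 u)) (A * cexp (n%:R * quad m Gamma (cvec 0 u))).
  rewrite cabsM in t4.
  have t5 := ler_wpM2l A0 (le_trans E2 (le_trans dd (le_trans t3 sr5))).
  have := mulr_ge0 C20 sn; have := mulr_ge0 (ltW e0) g0; lra.
have sm (y : R) : delta <= y -> vsmall y u.
  by move=> dy; apply: norm1_vsmall; rewrite (le_trans (ltW du)).
have u1 : vsmall x1 u by apply: sm; rewrite !ge_min lexx.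
have u2 : vsmall (x2 / 2) u by apply: sm; rewrite !ge_min lexx !orbT.
have u3 : vsmall (x3 / 2) u by apply: sm; rewrite !ge_min lexx !orbT.
have u4 : vsmall (x4 / 2) u by apply: sm; rewrite !ge_min lexx !orbT.
have t1 := hx2 _ (csmall_cvec (h0 _ (divr_gt0 x20 (ltr0n R 2))) u2) n.
have t2 := hx3 _ (csmall_cvec (h0 _ (divr_gt0 x30 (ltr0n R 2))) u3).
have t3 := hx4 _ (csmall_cvec (h0 _ (divr_gt0 x40 (ltr0n R 2))) u4).
have E1 : cabs (rho (cvec 0 u)) ^+ n <= expR (- (2 * b * (n%:R * sqnorm u))).
  rewrite mulrCA -mulrN expRM_natl lerXn2r ?nnegrE ?cabs_ge0 ?expR_ge0//.
  rewrite (le_trans (hrho 0 u (h0 _ x10) u1))// sqnorm0 mulr0 addr0 dotvE big1 ?sub0r.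
    by rewrite ler_expR lerN2 ler_wpM2r.
  by move=> i _; rewrite [(0 : 'cV[R]_d) _ _]mxE mulr0.
have E3 : cabs (rho (cvec 0 u) ^+ n - cexp (n%:R * quad m Gamma (cvec 0 u))) * cabs A <=
   e / 2 * expR (- (b * (n%:R * sqnorm u))).
  set w := clog (rho (cvec 0 u)) in t2 t3 *.
  have ew : rho (cvec 0 u) ^+ n = cexp (n%:R * w) by rewrite t3 -cexpMn mulr_natl.
  have t4 := cexp_dist (n%:R * w) (n%:R * quad m Gamma (cvec 0 u)).
  rewrite -ew -mulrBr cabsM cabs_nat cabsX in t4.
  have t5 : cabs (w - quad m Gamma (cvec 0 u)) <= e / 2 / W * (d.+1%:R * sqnorm u).
    rewrite (le_trans t2)// ler_wpM2l ?(ltW (divr_gt0 e2 W0))//.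
    rewrite (le_trans (cnorm1_cvec_le _ _))// sqnorm0 add0r ler_wpM2r// ler_nat//.
  have t6 : b * (n%:R * sqnorm u) * expR (- (2 * b * (n%:R * sqnorm u))) <= expR (- (b * (n%:R * sqnorm u))).
    have -> : - (2 * b * (n%:R * sqnorm u)) = - (b * (n%:R * sqnorm u)) - b * (n%:R * sqnorm u) by ring.
    rewrite expRD mulrCA -[leRHS]mulr1 ler_wpM2l// expRN ler_pdivrMr ?expR_gt0// mul1r.
    by have := expR_ge1Dx (b * (n%:R * sqnorm u)); lra.
  have E0 := expR_ge0 (- (2 * b * (n%:R * sqnorm u))).
  have t7 : cabs (rho (cvec 0 u) ^+ n - cexp (n%:R * quad m Gamma (cvec 0 u))) <=
     3 * (n%:R * (e / 2 / W * (d.+1%:R * sqnorm u))) * (expR (- (2 * b * (n%:R * sqnorm u))) + expR (- (2 * b * (n%:R * sqnorm u)))).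
    rewrite (le_trans t4)//; apply: ler_pM; rewrite ?mulr_ge0 ?addr_ge0 ?exprn_ge0 ?cabs_ge0//.
      by rewrite ler_pM2l// ler_wpM2l.
    exact: lerD.
  have t8 : 3 * (n%:R * (e / 2 / W * (d.+1%:R * sqnorm u))) * (expR (- (2 * b * (n%:R * sqnorm u))) + expR (- (2 * b * (n%:R * sqnorm u)))) * (cabs A + 1) =
     e / 2 * (b * (n%:R * sqnorm u) * expR (- (2 * b * (n%:R * sqnorm u)))).
    have gen (b' D a' E U e' n' : R) : 0 < b' -> 0 < D -> 0 < a' ->
        3 * (n' * (e' / 2 / (6 * D * a' / b') * (D * U))) * (E + E) * a' = e' / 2 * (b' * (n' * U) * E).
      by move=> p1 p2 p3; field; rewrite !gt_eqF.
    by rewrite /W gen// ltr_wpDl.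
  have t9 := ler_wpM2r (ltW (ltr_wpDl A0 ltr01)) t7; rewrite t8 in t9.
  have t10 := ler_wpM2l (ltW e2) t6.
  have := cabs_ge0 (rho (cvec 0 u) ^+ n - cexp (n%:R * quad m Gamma (cvec 0 u))); lra.
have t4 := ler_cabsD (a n (cvec 0 u) - rho (cvec 0 u) ^+ n * A)
   ((rho (cvec 0 u) ^+ n - cexp (n%:R * quad m Gamma (cvec 0 u))) * A).
rewrite [in X in cabs X <= _]mulrBl addrA subrK [cexp (_ * quad _ _ _) * A]mulrC cabsM in t4.
have t5 := ler_wpM2l (ltW e2) (le_trans E1 dd).
have t6 := ler_wpM2l C20 sr.
have := mulr_ge0 C40 sn; have := mulr_ge0 A0 sn; lra.
Qed.

(** The centred Gaussian density with covariance Gamma: (2 pi)^-d normalises the torus average, and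
    [gauss_const] is the Gaussian integral in the Fourier variable. *)
Definition gauss_density (y : 'cV[R]_d) : R :=
  (2 * pi)^-1 ^+ d * gauss_const Gamma * expR (- (2^-1 * qform (invmx Gamma) y)).

Definition centered (n : nat) (k : multi d) : 'cV[R]_d :=
  \col_i (((k i)%:R - n%:R * m i 0) / Num.sqrt n%:R).

Lemma qform_inv (y : 'cV[R]_d) : qform (invmx Gamma) y = qform Gamma (invmx Gamma *m y).
Proof.
have [_ _ _ GT _] := h5; have Gu := spd_unit (spd_Gamma h5).
by rewrite /qform trmx_mul trmx_inv GT -!mulmxA mulKVmx// mulmxA.
Qed.

Lemma qform_inv_ge0 (y : 'cV[R]_d) : 0 <= qform (invmx Gamma) y.
Proof.
have [l l0 hl] := spd_lower (spd_Gamma h5).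
by rewrite qform_inv (le_trans _ (hl _))// mulr_ge0 ?sqnorm_ge0// ltW.
Qed.

(** Completing the square in the Fourier variable shifts [u] by i times the vector v with Gamma v =
    y, where y is the centred position. This imaginary shift is the reason for Gaussian sums with
    complex arguments. *)
Lemma gauss_model_scaled n k (u : 'cV[R]_d) : (0 < n)%N ->
  gauss_model n k ((Num.sqrt n%:R)^-1 *: u) =
  A * ((expR (- (2^-1 * qform (invmx Gamma) (centered n k))))%:C *
    gaussker Gamma (rvec u + cvec 0 (invmx Gamma *m centered n k))).
Proof.
move=> n0; pose r : R := Num.sqrt n%:R.
have r0 : 0 < r by rewrite sqrtr_gt0 ltr0n.
have r2 : r ^+ 2 = n%:R by rewrite sqr_sqrtr.
have Gu := spd_unit (spd_Gamma h5).
have [_ _ _ GT _] := h5.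
rewrite /gauss_model /gaussker -cexp_real -!cexpD; congr (_ * cexp _).
set y := centered n k; set v := invmx Gamma *m y.
have Gv : Gamma *m v = y by rewrite /v mulKVmx.
have -> : rvec u + cvec 0 v = cvec u v.
  by apply/colP => i; rewrite !mxE; apply/eqP; rewrite eq_complex /= addr0 add0r !eqxx.
have cq : cqform Gamma (cvec u v) = (qform Gamma u - qform Gamma v) +i* (2 * dotv u y).
  apply/eqP; rewrite eq_complex cqform_cvec_Re eqxx /=; apply/eqP.
  have e1 : dotv u y = \sum_i \sum_j u i 0 * Gamma i j * v j 0.
    rewrite dotvE -Gv; apply: eq_bigr => i _; rewrite mxE mulr_sumr.
    by apply: eq_bigr => j _; rewrite mulrA.
  have e2 : dotv u y = \sum_i \sum_j v i 0 * Gamma i j * u j 0.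
    rewrite e1 exchange_big /=; apply: eq_bigr => i _; apply: eq_bigr => j _.
    by rewrite -{1}GT mxE; ring.
  rewrite mulr_natl mulr2n {1}e1 e2 /cqform qformE raddf_sum -big_split; apply: eq_bigr => i _.
  rewrite raddf_sum -big_split; apply: eq_bigr => j _; rewrite !mxE /=; ring.
rewrite cq qform_inv -/v /quad dotv_imag cqform_imag.
have e3 : cdot (cvec 0 (r^-1 *: u)) k = 0 +i* (r^-1 * \sum_i u i 0 * (k i)%:R).
  rewrite /cdot mulr_sumr; apply/eqP; rewrite eq_complex !raddf_sum /=; apply/andP; split; apply/eqP.
    by rewrite big1// => i _; rewrite !mxE -(rmorph_nat (real_complex R)) /=; ring.
  by apply: eq_bigr => i _; rewrite !mxE -(rmorph_nat (real_complex R)) /=; ring.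
have e4 : qform Gamma (r^-1 *: u) = n%:R^-1 * qform Gamma u.
  rewrite -r2 !qformE mulr_sumr; apply: eq_bigr => i _; rewrite mulr_sumr; apply: eq_bigr => j _.
  by rewrite !mxE; field; rewrite gt_eqF.
have e5 : dotv u y = r^-1 * \sum_i u i 0 * (k i)%:R - r * dotv m u.
  rewrite !dotvE !mulr_sumr -sumrB; apply: eq_bigr => i _; rewrite !mxE -/r -r2.
  by field; rewrite gt_eqF.
have e6 : n%:R * dotv m (r^-1 *: u) = r * dotv m u.
  rewrite !dotvE !mulr_sumr -r2; apply: eq_bigr => i _; rewrite !mxE.
  by field; rewrite gt_eqF.
rewrite -/r e3 e4 e5 -!(rmorph_nat (real_complex R)) -!fmorphV.
apply/eqP; rewrite eq_complex /=; apply/andP; split; apply/eqP.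
  by rewrite -r2; field; rewrite gt_eqF.
rewrite !(mul0r, mulr0, addr0, subr0, add0r) e6; field.
by rewrite gt_eqF.
Qed.

(** In the variable sqrt n u the grid has half-width sqrt n pi and mesh sqrt n pi / N. A large n
    provides the half-width, and for fixed n a large N the mesh; only [N0] depends on n. *)
Lemma gavg_gauss_model (e S : R) : 0 < e -> 0 <= S -> exists2 n0, (0 < n0)%N & forall n, (n0 <= n)%N ->
  exists N0, forall N k, (N0 <= N)%N -> (forall i, `|centered n k i 0| <= S) ->
  cabs ((Num.sqrt n%:R ^+ d)%:C * @gavg R R[i]^o d N (gauss_model n k) -
    A * (gauss_density (centered n k))%:C) <= e.
Proof.
move=> e0 S0; have A0 := cabs_ge0 A.
have e1 : 0 < e / (cabs A + 1) by rewrite divr_gt0//; lra.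
pose S1 := entry_sum (invmx Gamma) * S.
have S10 : 0 <= S1 by rewrite mulr_ge0 ?entry_sum_ge0.
have [H0 H00 hH] := gaussker_grid (spd_Gamma h5) e1 S10.
have pi0 := pi_gt0 R; have pi2 := @pi_ge2 R.
exists (Num.truncn (H0 ^+ 2)).+1 => // n hn.
have n0 : (0 < n)%N := leq_trans (ltn0Sn _) hn.
pose r : R := Num.sqrt n%:R.
have r0 : 0 < r by rewrite sqrtr_gt0 ltr0n.
have rH : H0 <= r * pi.
  have h : H0 <= r.
    rewrite -(@ler_pXn2r _ 2) ?nnegrE ?(ltW r0) ?(ltW H00)// sqr_sqrtr//.
    by rewrite (le_trans (ltW (truncnS_gt _)))// ler_nat.
  by nra.
have [x x0 hx] := hH (r * pi).
exists (Num.truncn (r * pi / x)).+1 => N k hN hk.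
have N0 : 0 < N%:R :> R by rewrite ltr0n (leq_trans _ hN).
have Nx : r * pi / N%:R < x.
  rewrite ltr_pdivrMr// [x * _]mulrC -ltr_pdivrMr// (lt_le_trans (truncnS_gt _))// ler_nat//.
have hN' : r * pi / N%:R * N%:R = r * pi by rewrite divfK// gt_eqF.
have rN0 : 0 < r * pi / N%:R by rewrite divr_gt0// mulr_gt0.
set y := centered n k.
pose w := cvec 0 (invmx Gamma *m y).
have wS i : cabs (w i 0) <= S1.
  rewrite mxE cabs_normE /= [(0 : 'cV[R]_d) _ _]mxE expr0n /= add0r sqrtr_sqr mxE.
  rewrite (le_trans (ler_norm_sum _ _ _))// /S1 /entry_sum mulr_suml [leRHS](bigD1 i)//= ler_wpDr//.
    by apply: sumr_ge0 => j _; rewrite mulr_ge0// sumr_ge0.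
  by rewrite mulr_suml; apply: ler_sum => j _; rewrite normrM ler_wpM2l.
have := hx (r * pi / N%:R) N rN0 Nx; rewrite hN' => /(_ rH (lexx _) w wS).
set I := _ * gridsum _ _ => hI.
pose E := expR (- (2^-1 * qform (invmx Gamma) y)).
have E0 : 0 <= E by exact: expR_ge0.
have E1 : E <= 1 by rewrite -expR0 ler_expR oppr_le0 mulr_ge0// qform_inv_ge0.
pose P : R := (2 * pi)^-1 ^+ d.
have P0 : 0 <= P by rewrite exprn_ge0// invr_ge0; lra.
have P1 : P <= 1 by rewrite exprn_ile1 ?invr_ge0//; [lra|rewrite invf_le1; lra].
have -> : (r ^+ d)%:C * @gavg R R[i]^o d N (gauss_model n k) = (P * E)%:C * (A * I).
  rewrite /gavg.
  have -> : gridsum (grid (pi / N%:R) N) (gauss_model n k : 'cV[R]_d -> R[i]^o) =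
     gridsum (grid (r * pi / N%:R) N) (fun u => gauss_model n k (r^-1 *: u) : R[i]^o).
    have -> : grid (pi / N%:R) N = [seq r^-1 * t | t <- grid (r * pi / N%:R) N].
      by rewrite grid_scale !mulrA mulVf ?mul1r// gt_eqF.
    exact: (gridsum_map r^-1 _ (gauss_model n k : _ -> R[i]^o)).
  rewrite (eq_gridsum (G := fun u => (A * E%:C) * gaussker Gamma (rvec u + w) : R[i]^o)); last first.
    by move=> u _; rewrite gauss_model_scaled// mulrA.
  rewrite (@gridsumMl _ R[i]) /I /GRing.scale /=.
  have -> : (N + N)%:R^-1 ^+ d = ((N + N)%:R^-1 ^+ d : R)%:C by rewrite rmorphXn fmorphV rmorph_nat.
  set Z := gridsum _ _.
  have -> : ((r * pi / N%:R) ^+ d)%:C = ((r ^+ d)%:C * ((N + N)%:R^-1 ^+ d : R)%:C) * ((2 * pi) ^+ d)%:C :> R[i].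
    rewrite -!rmorphM -!exprMn; congr (_ ^+ _)%:C; rewrite natrD; field; rewrite gt_eqF//=; lra.
  have PP : P%:C * ((2 * pi) ^+ d)%:C = 1 :> R[i].
    by rewrite -rmorphM /P -exprMn mulVf ?expr1n// gt_eqF//; lra.
  rewrite [RHS](_ : _ = (P%:C * ((2 * pi) ^+ d)%:C) * ((r ^+ d)%:C * (((N + N)%:R^-1 ^+ d : R)%:C * (A * E%:C * Z)))); last by rewrite rmorphM; ring.
  by rewrite PP mul1r.
have -> : A * (gauss_density y)%:C = (P * E)%:C * (A * (gauss_const Gamma)%:C).
  by rewrite /gauss_density -/P -/E !rmorphM; ring.
rewrite -mulrBr -mulrBr !cabsM cabs_real ger0_norm ?mulr_ge0//.
have PE : P * E <= 1 by rewrite mulr_ile1.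
have t1 : cabs A * cabs (I - (gauss_const Gamma)%:C) <= (cabs A + 1) * (e / (cabs A + 1)).
  by apply: ler_pM; rewrite ?cabs_ge0//; lra.
rewrite [X in _ <= X](_ : _ = e) in t1; last by field; rewrite gt_eqF//; lra.
rewrite -[leRHS]mul1r; apply: ler_pM => //; first exact: mulr_ge0.
by rewrite mulr_ge0 ?cabs_ge0.
Qed.

Lemma local_limit (e S : R) : 0 < e -> 0 <= S -> exists2 n0, (0 < n0)%N & forall n, (n0 <= n)%N ->
  forall k, (forall i, `|centered n k i 0| <= S) ->
  cabs ((Num.sqrt n%:R ^+ d)%:C * c n k - A * (gauss_density (centered n k))%:C) <= e.
Proof.
move=> e0 S0; have [b b0 hb] := gauss_model_near.
pose G := (expR (b * pi ^+ 2) * gauss_bound b) ^+ d.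
have G0 : 0 <= G.
  have g0 : 0 <= gauss_bound b by rewrite /gauss_bound; pos.
  by rewrite exprn_ge0// mulr_ge0// expR_ge0.
have e3 : 0 < e / 3 by pos.
have e1 : 0 < e / 3 / (G + 1) by rewrite divr_gt0//; lra.
have [C [s [C0 s0 s1 hs]]] := hb _ e1.
have [n1 hn1] := poly_geometric_small d s0 s1 C0 e3.
have [n2 n20 hn2] := gavg_gauss_model e3 S0.
have [x x0 hx] := fourier.
exists (maxn n1 n2); first by rewrite leq_max n20 orbT.
move=> n; rewrite geq_max => /andP[/hn1 hn1' /hn2[N1 hN1]] k hk.
have [N2 [N20 hN2]] := gavg_gauss_geom s b0 (ltW e1) C0 n.
have h0 : vsmall x (0 : 'cV[R]_d) by move=> i; rewrite mxE normr0 ltW.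
set L := A * _.
have := @tends_to_lin R R[i]^o R[i]^o (fun t => (Num.sqrt n%:R ^+ d)%:C * t) (Num.sqrt n%:R ^+ d) _ _ _ _ (hx 0 h0 n k).
move=> /(_ _ _) h; have {}h := tends_toD (h _ _) (tends_to_cst (- L : R[i]^o)).
apply: (@tends_to_norm_le R R[i]^o _ _ _ _ (h _ _)).
- exists (maxn N1 N2) => N; rewrite geq_max => /andP[hN1' hN2'].
  have t1 := hN1 N k hN1' hk.
  have t2 := hN2 N hN2' _ (fun u cu => hs n k u cu).
  rewrite gavgB in t2; rewrite rnorm_cabs.
  set F := gavg N _ in t2 *; set M := gavg N (gauss_model n k) in t1 t2.
  have t3 : cabs ((Num.sqrt n%:R ^+ d)%:C * (F - M)) <= 2 * (e / 3).
    rewrite cabsM cabs_real ger0_norm ?exprn_ge0 ?sqrtr_ge0//.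
    have t4 : Num.sqrt n%:R ^+ d * cabs (F - M) <= Num.sqrt n.+1%:R ^+ d * cabs (F - M).
      by rewrite ler_wpM2r ?cabs_ge0// lerXn2r ?nnegrE ?sqrtr_ge0// ler_sqrt ?ler_nat.
    have t5 := le_trans (sqrtn_pow_le n (mulr_ge0 C0 (exprn_ge0 n s0))) hn1'.
    have t6 : e / 3 / (G + 1) * G <= e / 3.
      by rewrite mulrAC ler_pdivrMr; [nra|lra].
    rewrite -/G in t2; lra.
  have -> : (Num.sqrt n%:R ^+ d)%:C * F - L =
      (Num.sqrt n%:R ^+ d)%:C * (F - M) + ((Num.sqrt n%:R ^+ d)%:C * M - L).
    by rewrite mulrBr addrA subrK.
  by rewrite (le_trans (ler_cabsD _ _))//; lra.
- by move=> t1 t2; rewrite mulrBr.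
- by move=> t; rewrite !rnorm_cabs cabsM cabs_real ger0_norm// exprn_ge0 ?sqrtr_ge0.
Qed.

End LocalLimit.


(** * Green function *)

Section Assembly.
Variable R : realType.

Lemma geometric_cvg (u : nat -> R) (K s : R) : 0 <= s -> s < 1 ->
  (forall n, `|u n| <= K * s ^+ n) -> cvgn (series u).
Proof.
move=> s0 s1 hu; apply: normed_cvg; apply: (@series_le_cvg _ _ (geometric K s)) => //=.
- by move=> n; exact: le_trans (hu n).
- by apply: is_cvg_geometric_series; rewrite ger0_norm.
Qed.

Lemma cgeometric_tends_to (u : nat -> R[i]) (K s : R) : 0 <= s -> s < 1 ->
  (forall n, cabs (u n) <= K * s ^+ n) -> exists l : R[i], @tends_to R R[i]^o (series u) l.
Proof.
move=> s0 s1 hu.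
have cr : cvgn (series (fun n => complex.Re (u n))).
  by apply: (geometric_cvg s0 s1) => n; exact: le_trans (cabs_Re _) (hu n).
have ci : cvgn (series (fun n => complex.Im (u n))).
  by apply: (geometric_cvg s0 s1) => n; exact: le_trans (cabs_Im _) (hu n).
exists (limn (series (fun n => complex.Re (u n))) +i* limn (series (fun n => complex.Im (u n)))).
move=> e e0; have e2 : 0 < e / 2 by pos.
have /cvgrPdist_le /(_ _ e2)[N1 _ h1] := cr.
have /cvgrPdist_le /(_ _ e2)[N2 _ h2] := ci.
exists (maxn N1 N2) => N; rewrite geq_max => /andP[/h1 /= g1 /h2 /= g2].
rewrite rnorm_cabs (le_trans (cabs_le_ReIm _))// !raddfB /= /series /= !raddf_sum.
move: g1 g2; rewrite /series /= => g1 g2.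
rewrite distrC [X in _ + X]distrC; lra.
Qed.

Lemma poly_exp_le (b : R) D : 0 < b -> exists2 C : R, 0 <= C &
  forall t, 0 <= t -> (1 + t) ^+ D <= C * expR (b * t).
Proof.
move=> b0; pose g := Num.min 1 (b / D.+1%:R).
have g0 : 0 < g by rewrite lt_min ltr01 divr_gt0// ltr0n.
exists (g^-1 ^+ D); first by rewrite exprn_ge0// invr_ge0 ltW.
move=> t t0.
have h : 1 + t <= g^-1 * expR (b / D.+1%:R * t).
  have g1 : g <= 1 by rewrite ge_min lexx.
  have g2 : g <= b / D.+1%:R by rewrite ge_min lexx orbT.
  rewrite mulrC ler_pdivlMr//; move: (b / D.+1%:R) g2 => q g2.
  have := expR_ge1Dx (q * t); have := ler_wpM2r t0 g2; lra.
apply: (@le_trans _ _ ((g^-1 * expR (b / D.+1%:R * t)) ^+ D)).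
  apply: lerXn2r => //; rewrite nnegrE; first by lra.
  by rewrite mulr_ge0 ?expR_ge0// invr_ge0 ltW.
rewrite exprMn ler_wpM2l ?exprn_ge0 ?invr_ge0 ?(ltW g0)// -expRM_natl ler_expR.
rewrite mulrA ler_wpM2r// mulrA ler_pdivrMr ?ltr0n// mulrC ler_wpM2l ?(ltW b0)//.
by rewrite ler_nat.
Qed.

Variables (d : nat) (c : nat -> multi d -> R[i]) (A : R[i]).
Variables (rho : 'cV[R[i]]_d -> R[i]) (m : 'cV[R]_d) (Gamma : 'M[R]_d).
Hypothesis hd : (0 < d)%N.
Hypothesis h5 : S5 rho m Gamma.
Hypothesis tilt : exists C x : R, [/\ 0 <= C, 0 < x & forall z : 'cV[R]_d, vsmall x z ->
  forall n k, Num.sqrt n.+1%:R ^+ d * cabs (c n k) <=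
    C * expR (n%:R * (dotv m z + C * sqnorm z) - rdot z k)].
Hypothesis local : forall e S : R, 0 < e -> 0 <= S ->
  exists2 n0, (0 < n0)%N & forall n, (n0 <= n)%N ->
  forall k, (forall i, `|centered m n k i 0| <= S) ->
  cabs ((Num.sqrt n%:R ^+ d)%:C * c n k - A * (gauss_density Gamma (centered m n k))%:C) <= e.

Let mu : R := \sum_i m i 0.

Lemma mu_gt0 : 0 < mu.
Proof.
have [_ _ m0 _ _] := h5; rewrite /mu; case: d hd m m0 => // d' _ m' m0.
by rewrite big_ord_recl ltr_pwDl// sumr_ge0// => i _; exact: ltW.
Qed.

Lemma dotv_const (t : R) : dotv m (const_mx t) = t * mu.
Proof. by rewrite dotvE /mu mulr_sumr; apply: eq_bigr => i _; rewrite mxE mulrC. Qed.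

Lemma sqnorm_const (t : R) : sqnorm (const_mx t : 'cV[R]_d) = d%:R * t ^+ 2.
Proof.
rewrite /sqnorm (eq_bigr (fun=> t ^+ 2)); last by move=> i _; rewrite mxE.
by rewrite sumr_const card_ord mulr_natl.
Qed.

(** A fixed tilt by - t in every coordinate gives decay exp (- t mu n) up to the quadratic cost,
    because the drift m is positive. For [k] fixed the tilt of k is a constant. *)
Lemma series_tends_to k : exists l : R[i], @tends_to R R[i]^o (series (c^~ k)) l.
Proof.
have [C [x [C0 x0 h]]] := tilt; have mu0 := mu_gt0.
(* Chosen so that the quadratic cost C d t^2 takes at most half of t mu. *)
pose t := Num.min x (mu / (2 * (C * d%:R + 1))).
have D0 : 0 < 2 * (C * d%:R + 1) by have := mulr_ge0 C0 (ler0n R d); lra.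
have t0 : 0 < t by rewrite lt_min x0 divr_gt0.
have t1 : t * (2 * (C * d%:R + 1)) <= mu by rewrite -ler_pdivlMr// ge_min lexx orbT.
apply: (@cgeometric_tends_to _ (C * expR (- rdot (const_mx (- t)) k)) (expR (- (t * (mu / 2))))).
- exact: expR_ge0.
- by rewrite expR_lt1 oppr_lt0 mulr_gt0// divr_gt0.
move=> n; have hs : vsmall x (const_mx (- t) : 'cV[R]_d).
  by move=> i; rewrite mxE normrN ger0_norm ?(ltW t0)// ge_min lexx.
have := h _ hs n k; rewrite dotv_const sqnorm_const sqrrN.
have s1 : 1 <= Num.sqrt n.+1%:R ^+ d :> R.
  by rewrite exprn_ege1// -[leLHS]sqrtr1 ler_sqrt ?ler1n.
move=> h1; apply: (@le_trans _ _ (Num.sqrt n.+1%:R ^+ d * cabs (c n k))).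
  by rewrite ler_peMl ?cabs_ge0.
rewrite (le_trans h1)// -mulrA ler_wpM2l// -expRM_natl -expRD ler_expR [leRHS]addrC lerD2r.
rewrite ler_wpM2l//.
have : t * (t * (2 * (C * d%:R + 1))) <= t * mu by rewrite ler_wpM2l// ltW.
have := sqr_ge0 t; lra.
Qed.

Lemma series_cvg k : cvgn (series (c^~ k)).
Proof. by have [l /tends_to_cvg hl] := series_tends_to k; apply/cvg_ex; exists l. Qed.

Lemma series_lim k : @tends_to R R[i]^o (series (c^~ k)) (limn (series (c^~ k))).
Proof. apply/tends_to_cvg; exact: series_cvg. Qed.

Lemma rdot_const (t a : R) k : 0 < a ->
  rdot (const_mx t) k = t * (a * mu + Num.sqrt a * \sum_i rescaled m a k i 0).
Proof.
move=> a0; have s0 : Num.sqrt a != 0 by rewrite gt_eqF// sqrtr_gt0.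
rewrite /rdot /mu !mulr_sumr -big_split mulr_sumr /=; apply: eq_bigr => i _; rewrite !mxE.
by field.
Qed.

(* Tilt by -/+ 1 / sqrt a in every direction, with the sign of n - a.  The comparison of
   sqrt a with sqrt (n + 1) costs a polynomial in |n - a| / sqrt a. *)
Lemma term_bound (S : R) : exists kap C a0 : R, [/\ 0 < kap, 0 <= C, 1 <= a0 &
  forall a k, a0 <= a -> (forall i, `|rescaled m a k i 0| <= S) -> forall n,
    Num.sqrt a ^+ d * cabs (c n k) <= C * expR (- (kap * `|(n%:R - a) / Num.sqrt a|))].
Proof.
have [C [x [C0 x0 h]]] := tilt; have mu0 := mu_gt0.
have b0 : 0 < mu / 4 by pos.
have [P P0 hP] := poly_exp_le d b0.
have Cd0 : 0 <= C * d%:R by rewrite mulr_ge0.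
(* For sqrt a >= r0 the tilt 1 / sqrt a is admissible, and the part of the quadratic cost that grows
   with |n - a| takes at most half of the linear gain. *)
pose r0 := 1 + x^-1 + 2 * (C * d%:R) / mu.
have x1 : 0 < x^-1 by rewrite invr_gt0.
have q0 : 0 <= 2 * (C * d%:R) / mu by rewrite divr_ge0 ?(ltW mu0)// mulr_ge0.
have r1 : 1 <= r0 by rewrite /r0; lra.
exists (mu / 4), (2 ^+ d * P * (C * expR (C * d%:R + d%:R * S))), (r0 ^+ 2); split=> //.
- by rewrite !mulr_ge0 ?expR_ge0// exprn_ge0.
- by rewrite exprn_ege1.
move=> a k ha hk n.
have a0 : 0 < a by rewrite (lt_le_trans _ ha)// exprn_gt0//; lra.
pose r := Num.sqrt a; have rr0 : 0 < r by rewrite sqrtr_gt0.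
have rr : r ^+ 2 = a by rewrite sqr_sqrtr// ltW.
have r0r : r0 <= r by rewrite -(@ler_pXn2r _ 2) ?nnegrE ?(ltW rr0)//; [rewrite rr|lra].
have rge1 : 1 <= r by lra.
have rx : r^-1 <= x by rewrite invf_ple ?posrE//; move: r0r; rewrite /r0; lra.
pose t := (n%:R - a) / r; set T := `|t|.
have T0 : 0 <= T by exact: normr_ge0.
have nE : n%:R = a + t * r by rewrite /t divfK ?gt_eqF// addrCA subrr addr0.
have ratio : r <= Num.sqrt n.+1%:R * (2 * (1 + T)).
  have p0 : 0 <= Num.sqrt n.+1%:R * (2 * (1 + T)) by rewrite !mulr_ge0 ?sqrtr_ge0//; lra.
  rewrite -(@ler_pXn2r _ 2) ?nnegrE ?(ltW rr0)// rr exprMn sqr_sqrtr//.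
  have n1 : (1 : R) <= n.+1%:R by rewrite ler1n.
  have n2 : n.+1%:R = a + t * r + 1 by rewrite -natr1 nE.
  have tT : - T <= t by rewrite /T lerNnormlW.
  (* Either n + 1 is comparable with a, or n is so far below a that |n - a| / sqrt a exceeds sqrt a
     / 2. *)
  case: (lerP a (2 * n.+1%:R)) => an.
    have : 1 <= (2 * (1 + T)) ^+ 2 / 4 by rewrite exprMn; have := sqr_ge0 T; rewrite !expr2; nra.
    by nra.
  have : a / 2 < T * r by have := ler_wpM2r (ltW rr0) tT; lra.
  move=> hT; have {}hT : r / 2 < T.
    by rewrite -(ltr_pM2r rr0); have -> : r / 2 * r = a / 2 by rewrite -rr; field.
  have h2 : r ^+ 2 <= (2 * (1 + T)) ^+ 2.
    by apply: lerXn2r; rewrite ?nnegrE; lra.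
  by rewrite -rr (le_trans h2)// ler_peMl ?sqr_ge0.
have ratio_d : r ^+ d <= Num.sqrt n.+1%:R ^+ d * (2 ^+ d * (P * expR (mu / 4 * T))).
  apply: (@le_trans _ _ ((Num.sqrt n.+1%:R * (2 * (1 + T))) ^+ d)).
    by rewrite lerXn2r ?nnegrE ?(ltW rr0)// !mulr_ge0 ?sqrtr_ge0//; lra.
  by rewrite !exprMn ler_wpM2l ?exprn_ge0 ?sqrtr_ge0// ler_wpM2l ?exprn_ge0// hP.
have main : Num.sqrt n.+1%:R ^+ d * cabs (c n k) <=
    C * expR (C * d%:R + d%:R * S) * expR (- (mu / 2 * T)).
  pose s : R := if 0 <= t then - 1 else 1.
  have st : s * t = - T by rewrite /s /T; case: (lerP 0 t) => t0; [rewrite ger0_norm// mulN1r|rewrite ltr0_norm// mul1r opprK].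
  have sn : `|s| = 1 by rewrite /s; case: ifP; rewrite ?normrN normr1.
  have s2 : s ^+ 2 = 1 by rewrite -real_normK ?num_real// sn expr1n.
  have hs : vsmall x (const_mx (s / r) : 'cV[R]_d).
    by move=> i; rewrite mxE normrM sn mul1r normfV ger0_norm// ltW.
  rewrite (le_trans (h _ hs n k))// -mulrA ler_wpM2l// -expRD ler_expR.
  rewrite dotv_const sqnorm_const (rdot_const _ _ a0) -/r exprMn s2 mul1r exprVn rr.
  set W := \sum_i _.
  have W1 : `|W| <= d%:R * S.
    rewrite (le_trans (ler_norm_sum _ _ _))// (le_trans (ler_sum _ (fun i _ => hk i)))//.
    by rewrite sumr_const card_ord mulr_natl.
  have e1 : n%:R * (s / r * mu + C * (d%:R / a)) - s / r * (a * mu + r * W) =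
     - (mu * T) + C * d%:R * (n%:R / a) - s * W.
    have -> : - (mu * T) = mu * (s * t) by rewrite st mulrN.
    by rewrite nE -rr; field; rewrite gt_eqF.
  have e2 : - (s * W) <= d%:R * S.
    by rewrite (le_trans (ler_norm _))// normrN normrM sn mul1r.
  have e3 : C * d%:R * (n%:R / a) <= C * d%:R + mu / 2 * T.
    have f1 : n%:R / a <= 1 + T / r.
      rewrite ler_pdivrMr// nE -rr; have : t <= T := ler_norm t.
      have -> : (1 + T / r) * r ^+ 2 = r ^+ 2 + T * r by field; rewrite gt_eqF.
      by move=> h'; rewrite lerD2l ler_wpM2r// ltW.
    have f2 : C * d%:R * (T / r) <= mu / 2 * T.
      have -> : C * d%:R * (T / r) = C * d%:R / r * T by ring.
      rewrite ler_wpM2r// ler_pdivrMr//.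
      have : 2 * (C * d%:R) / mu <= r by move: r0r; rewrite /r0; lra.
      by rewrite ler_pdivrMr//; lra.
    by rewrite (le_trans (ler_wpM2l Cd0 f1))// mulrDr mulr1 lerD2l.
  by rewrite e1; lra.
have c0 := cabs_ge0 (c n k).
rewrite -/r -/t -/T (le_trans (ler_wpM2r c0 ratio_d))//.
have p0 : 0 <= 2 ^+ d * (P * expR (mu / 4 * T)) by rewrite !mulr_ge0 ?exprn_ge0 ?expR_ge0.
have := ler_wpM2l p0 main.
rewrite [X in X <= _ -> _]mulrCA [in X in X -> _]mulrA => g; rewrite (le_trans g)//.
have ee : expR (mu / 4 * T) * expR (- (mu / 2 * T)) = expR (- (mu / 4 * T)) by rewrite -expRD; congr expR; field.
rewrite -ee le_eqVlt; apply/orP; left; apply/eqP; ring.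
Qed.

Lemma expRN_lipschitz (x y : R) : 0 <= x -> 0 <= y -> `|expR (- x) - expR (- y)| <= `|x - y|.
Proof.
wlog xy : x y / x <= y.
  move=> H x0 y0; case/orP: (le_total x y) => xy; first exact: H.
  by rewrite distrC [leRHS]distrC; exact: H.
move=> x0 y0.
have h1 : expR (- y) = expR (- x) * expR (- (y - x)) by rewrite -expRD; congr expR; ring.
have h2 := expR_ge1Dx (- (y - x)).
have h3 : expR (- x) <= 1 by rewrite -expR0 ler_expR oppr_le0.
have h4 : expR (- y) <= expR (- x) by rewrite ler_expR lerN2.
rewrite ger0_norm ?subr_ge0// ler0_norm ?subr_le0// h1.
have := expR_ge0 (- x); nra.
Qed.

Let phi := gauss_density Gamma.
Let P : R := (2 * pi)^-1 ^+ d * gauss_const Gamma.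

Lemma density_const_ge0 : 0 <= P.
Proof.
by rewrite mulr_ge0 ?gauss_const_ge0// exprn_ge0// invr_ge0 mulr_ge0 ?pi_ge0.
Qed.

(** The local limit theorem is normalised by sqrt n, the theorem by sqrt a. With x = sqrt (a / n)
    this is the cost of the exchange, small because n / a is close to 1 in the window. *)
Lemma phi_scale (x : R) (v : 'cV[R]_d) : 0 <= x -> x <= 2 ->
  `|x ^+ d * phi (x *: v) - phi v| <=
  P * (d%:R * 2 ^+ d + entry_sum (invmx Gamma) * sqnorm v) * `|x ^+ 2 - 1|.
Proof.
move=> x0 x2; have P0 := density_const_ge0.
set Q := qform (invmx Gamma) v.
have Q0 : 0 <= Q := qform_inv_ge0 h5 v.
have Qle : Q <= entry_sum (invmx Gamma) * sqnorm v by rewrite (le_trans (ler_norm _) (qform_le _ _)).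
have Qx : qform (invmx Gamma) (x *: v) = x ^+ 2 * Q.
  rewrite /Q !qformE mulr_sumr; apply: eq_bigr => i _; rewrite mulr_sumr; apply: eq_bigr => j _.
  by rewrite !mxE; ring.
have -> : x ^+ d * phi (x *: v) - phi v =
    P * ((x ^+ d - 1) * expR (- (2^-1 * (x ^+ 2 * Q))) + (expR (- (2^-1 * (x ^+ 2 * Q))) - expR (- (2^-1 * Q)))).
  by rewrite /phi /gauss_density -/P Qx -/Q; ring.
have x22 := sqr_ge0 x; have xQ : 0 <= x ^+ 2 * Q by rewrite mulr_ge0.
rewrite normrM (ger0_norm P0) -[leRHS]mulrA ler_wpM2l// (le_trans (ler_normD _ _))// [leRHS]mulrDl lerD//.
  rewrite normrM (ger0_norm (expR_ge0 _)).
  have x1 : `|x - 1| <= `|x ^+ 2 - 1|.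
    have -> : x ^+ 2 - 1 = (x - 1) * (x + 1) by ring.
    by rewrite normrM ler_peMr// ger0_norm; lra.
  have h1 : `|x ^+ d - 1| <= d%:R * 2 ^+ d * `|x ^+ 2 - 1|.
    have := @iter_sub1 R (x%:C) `|x - 1| d.
    have E1 : x%:C - 1 = (x - 1)%:C :> R[i] by rewrite rmorphB rmorph1.
    have E2 : x%:C ^+ d - 1 = (x ^+ d - 1)%:C :> R[i] by rewrite rmorphB rmorph1 rmorphXn.
    rewrite E1 E2 !cabs_real => h; rewrite (le_trans (h _ _))//.
      by rewrite ler_norml; lra.
    by rewrite ler_wpM2l// mulr_ge0// exprn_ge0.
  have h2 : expR (- (2^-1 * (x ^+ 2 * Q))) <= 1 by rewrite -expR0 ler_expR oppr_le0 mulr_ge0.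
  by rewrite (le_trans _ h1)// ler_piMr.
have e1 : 0 <= 2^-1 * (x ^+ 2 * Q) by rewrite mulr_ge0.
have e2 : 0 <= 2^-1 * Q by rewrite mulr_ge0.
rewrite (le_trans (expRN_lipschitz e1 e2))//.
have -> : 2^-1 * (x ^+ 2 * Q) - 2^-1 * Q = 2^-1 * Q * (x ^+ 2 - 1) by ring.
by rewrite normrM (ger0_norm e2) ler_wpM2r//; lra.
Qed.

(** With t = (n - a) / sqrt a and w the position rescaled at a, the position centred at n is sqrt (a
    / n) (w - t m): varying n moves the Gaussian argument along the drift. *)
Lemma middle_term (S M e : R) : 0 <= S -> 0 <= M -> 0 < e -> exists a0 : R, forall a k, a0 <= a ->
  (forall i, `|rescaled m a k i 0| <= S) -> forall n, `|(n%:R - a) / Num.sqrt a| <= M ->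
  cabs ((Num.sqrt a ^+ d)%:C * c n k -
    A * (phi (rescaled m a k - ((n%:R - a) / Num.sqrt a) *: m))%:C) <= e.
Proof.
move=> S0 M0 e0; have A0 := cabs_ge0 A; have P0 := density_const_ge0.
have nm0 : 0 <= norm1 m by apply: sumr_ge0.
pose V := S + M * norm1 m; have V0 : 0 <= V by rewrite addr_ge0// mulr_ge0.
have V20 : 0 <= 2 * V by rewrite mulr_ge0.
have e1 : 0 < e / 2 / 2 ^+ d by rewrite !divr_gt0// exprn_gt0.
have [n0 n00 hn0] := local e1 V20.
pose W := (cabs A + 1) * (P * (d%:R * 2 ^+ d + entry_sum (invmx Gamma) * (d%:R * V ^+ 2))).
have W0 : 0 <= W.
  have := entry_sum_ge0 (invmx Gamma) => es.
  have : 0 <= d%:R * V ^+ 2 by rewrite mulr_ge0// exprn_ge0.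
  move=> dV; rewrite /W mulr_ge0//; first by lra.
  by rewrite mulr_ge0// addr_ge0 ?mulr_ge0// exprn_ge0.
(* The summand 2 M keeps n above a / 2, 2 n0 then puts n in the range of the local limit theorem,
   and the last summand makes the exchange of normalisations cost at most e / 2. *)
pose r0 := 1 + 2 * M + 2 * n0%:R + 4 * M * W / e.
have q0 : 0 <= 4 * M * W / e by rewrite divr_ge0 ?(ltW e0)// mulr_ge0// mulr_ge0.
have r01 : 1 <= r0 by rewrite /r0; have : (0 : R) <= n0%:R by []; lra.
exists (r0 ^+ 2) => a k ha hk n hn.
have a0 : 0 < a by rewrite (lt_le_trans _ ha)// exprn_gt0//; lra.
move: hn; set r := Num.sqrt a => hn.
have rr0 : 0 < r by rewrite sqrtr_gt0.
have rr : r ^+ 2 = a by rewrite sqr_sqrtr// ltW.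
have r0r : r0 <= r by rewrite -(@ler_pXn2r _ 2) ?nnegrE ?(ltW rr0)//; [rewrite rr|lra].
have nn0 : (0 : R) <= n0%:R by [].
have r1 : 1 <= r by lra.
have rM : 2 * M <= r by move: r0r; rewrite /r0; lra.
have rn0 : 2 * n0%:R <= r by move: r0r; rewrite /r0; lra.
have rW : 4 * M * W <= r * e by rewrite -ler_pdivrMr//; move: r0r; rewrite /r0; lra.
set t := (n%:R - a) / r in hn *; set w := rescaled m a k.
have nE : n%:R = a + t * r by rewrite /t divfK ?gt_eqF// addrCA subrr addr0.
have tr : `|t * r| <= r * r / 2.
  rewrite normrM (ger0_norm (ltW rr0)) mulrAC ler_wpM2r ?(ltW rr0)// ler_pdivlMr//.
  by rewrite mulrC (le_trans _ rM)// ler_wpM2l.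
have na : a / 2 <= n%:R.
  move: tr; rewrite ler_norml => /andP[tr _]; rewrite nE -rr expr2; move: tr; lra.
have npos : (0 : R) < n%:R by rewrite (lt_le_trans _ na)// divr_gt0.
have n1 : (n0 <= n)%N.
  rewrite -(ler_nat R) (le_trans _ na)// -rr expr2.
  have : r * 1 <= r * r by rewrite ler_wpM2l// ltW. lra.
pose sn := Num.sqrt n%:R : R; have sn0 : 0 < sn by rewrite sqrtr_gt0.
have sn2 : sn ^+ 2 = n%:R by rewrite sqr_sqrtr// ltW.
pose x := r / sn; have x0 : 0 <= x by rewrite divr_ge0// ltW.
have x2E : x ^+ 2 = a / n%:R by rewrite /x exprMn exprVn sn2 rr.
have x2 : x <= 2.
  have : x ^+ 2 <= 2 by rewrite x2E ler_pdivrMr//; lra.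
  by move=> h; rewrite -(@ler_pXn2r _ 2) ?nnegrE//; lra.
pose v := w - t *: m.
have cE : centered m n k = x *: v.
  apply/colP => i; rewrite !mxE -/sn -/r nE /x -rr; field; rewrite !gt_eqF//.
have vi i : `|v i 0| <= V.
  rewrite !mxE (le_trans (ler_normB _ _))// /V; apply: lerD; first by have := hk i; rewrite mxE.
  rewrite normrM ler_pM// /norm1 (bigD1 i)//= lerDl; exact: sumr_ge0.
have sv : sqnorm v <= d%:R * V ^+ 2.
  rewrite /sqnorm (le_trans (ler_sum _ (_ : forall i, _ -> _ <= V ^+ 2)))//.
    by move=> i _; rewrite -real_normK ?num_real// lerXn2r ?nnegrE.
  by rewrite sumr_const card_ord mulr_natl.
have cS i : `|centered m n k i 0| <= 2 * V.
  by rewrite cE mxE normrM (ger0_norm x0) ler_pM.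
have L := hn0 n n1 k cS; rewrite -/phi cE -/sn in L.
have E : (r ^+ d)%:C * c n k - A * (phi v)%:C =
    (x ^+ d)%:C * ((sn ^+ d)%:C * c n k - A * (phi (x *: v))%:C) +
    A * (x ^+ d * phi (x *: v) - phi v)%:C.
  have -> : r ^+ d = x ^+ d * sn ^+ d by rewrite -exprMn /x divfK ?gt_eqF.
  have key (X Y p1 p2 : R) (C1 C2 : R[i]) : (X * Y)%:C * C1 - C2 * p1%:C =
      X%:C * (Y%:C * C1 - C2 * p2%:C) + C2 * (X * p2 - p1)%:C.
    by rewrite rmorphM rmorphB rmorphM; ring.
  exact: key.
rewrite -/v E (le_trans (ler_cabsD _ _))// !cabsM !cabs_real (ger0_norm (exprn_ge0 _ x0)).
have t1 : x ^+ d * cabs ((sn ^+ d)%:C * c n k - A * (phi (x *: v))%:C) <= e / 2.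
  apply: (@le_trans _ _ (2 ^+ d * (e / 2 / 2 ^+ d))).
    by apply: ler_pM; rewrite ?exprn_ge0 ?cabs_ge0// lerXn2r ?nnegrE.
  by rewrite mulrC divfK// gt_eqF// exprn_gt0.
have t2 := phi_scale v x0 x2.
have xa : `|x ^+ 2 - 1| <= 2 * M / r.
  have -> : x ^+ 2 - 1 = - (t * r / n%:R) by rewrite x2E nE; field; rewrite -nE gt_eqF.
  rewrite normrN normrM normfV (ger0_norm (ltW npos)) ler_pdivrMr//.
  rewrite normrM (ger0_norm (ltW rr0)).
  apply: (@le_trans _ _ (M * r)); first by rewrite ler_wpM2r// ltW.
  have : 2 * M / r * (a / 2) <= 2 * M / r * n%:R by rewrite ler_wpM2l// divr_ge0 ?(ltW rr0)// mulr_ge0.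
  by have -> : 2 * M / r * (a / 2) = M * r by rewrite -rr; field; rewrite gt_eqF.
have t3 : cabs A * `|x ^+ d * phi (x *: v) - phi v| <= W * (2 * M / r).
  rewrite /W -mulrA; apply: ler_pM => //; first by lra.
  rewrite (le_trans t2)//; apply: ler_pM => //.
    rewrite mulr_ge0// addr_ge0 ?mulr_ge0 ?exprn_ge0 ?entry_sum_ge0 ?sqnorm_ge0//.
  by rewrite ler_wpM2l// lerD2l ler_wpM2l// entry_sum_ge0.
have t4 : W * (2 * M / r) <= e / 2.
  have -> : W * (2 * M / r) = (4 * M * W) / r / 2 by field; rewrite gt_eqF.
  by rewrite ler_pM2r// ler_pdivrMr// [e * r]mulrC.
lra.
Qed.

Let s : R := qform (invmx Gamma) m.

Lemma norming_gt0 : 0 < s.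
Proof.
have [_ _ m0 GT Gp] := h5; have Gu := spd_unit (spd_Gamma h5).
rewrite /s (qform_inv h5); apply: Gp; apply/eqP => g0.
have : m = 0 by rewrite -(mulKVmx Gu m) g0 mulmx0.
move=> /colP/(_ (Ordinal hd)); rewrite mxE => e; have := m0 (Ordinal hd).
by rewrite e ltxx.
Qed.

Let bil (w : 'cV[R]_d) : R := (w^T *m invmx Gamma *m m) 0 0.

Lemma qform_transverse (w : 'cV[R]_d) :
  qform (transverse_form m Gamma) w = qform (invmx Gamma) w - bil w ^+ 2 / s.
Proof.
have [_ _ _ GT _] := h5.
have sym : bil w = (m^T *m invmx Gamma *m w) 0 0.
  rewrite /bil -[in LHS](trmxK (_ *m m)) [in LHS]mxE !trmx_mul trmxK trmx_inv GT mulmxA//.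
rewrite {1}/qform /transverse_form mulmxBr mulmxBl -scalemxAr -scalemxAl mxE [X in _ + X]mxE [in X in _ - X]mxE.
congr (_ - _); rewrite -/(qform (invmx Gamma) m) -/s.
have -> : w^T *m (invmx Gamma *m m *m m^T *m invmx Gamma) *m w =
   (w^T *m invmx Gamma *m m) *m (m^T *m invmx Gamma *m w) by rewrite !mulmxA.
by rewrite mxE big_ord1 -sym -/(bil w) expr2; ring.
Qed.

(** Completing the square in [t]: the minimum over the line w - t m is the transverse form, and what
    remains is a one-dimensional Gaussian exponent. *)
Lemma qform_shift (w : 'cV[R]_d) (t : R) :
  qform (invmx Gamma) (w - t *: m) =
  qform (transverse_form m Gamma) w + s * (t - bil w / s) ^+ 2.
Proof.
have [_ _ _ GT _] := h5; have s0 := norming_gt0.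
have sym : (m^T *m invmx Gamma *m w) 0 0 = bil w.
  rewrite /bil -[in RHS](trmxK (_ *m m)) [in RHS]mxE !trmx_mul trmxK trmx_inv GT mulmxA//.
have -> : qform (invmx Gamma) (w - t *: m) = qform (invmx Gamma) w - 2 * t * bil w + t ^+ 2 * s.
  have -> : qform (invmx Gamma) (w - t *: m) = ((w^T - t *: m^T) *m invmx Gamma *m (w - t *: m)) 0 0.
    by congr ((_ *m _ *m _) 0 0); apply/rowP => i; rewrite !mxE.
  rewrite mulmxBr !mulmxBl -!scalemxAr -!scalemxAl.
  have entry (X1 X2 X3 X4 : 'M[R]_1) : (X1 - t *: X2 - (t *: X3 - t *: (t *: X4))) 0 0 =
      X1 0 0 - t * X2 0 0 - (t * X3 0 0 - t * (t * X4 0 0)) by rewrite !mxE.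
  rewrite entry sym -/(qform (invmx Gamma) w) -/(qform (invmx Gamma) m) -/s -/(bil w); ring.
by rewrite qform_transverse; field; rewrite gt_eqF.
Qed.

(** The last factor is the integral of exp (- s t^2 / 2): the transverse density is the integral of
    the full Gaussian density along the drift direction. *)
Lemma transverse_densityE (w : 'cV[R]_d) :
  transverse_density m Gamma w =
  P * expR (- (2^-1 * qform (transverse_form m Gamma) w)) * (Num.sqrt (2 * pi) / Num.sqrt s).
Proof.
have s0 := norming_gt0; have D0 := spd_det_gt0 (spd_Gamma h5).
have pp : 0 < 2 * pi :> R by rewrite mulr_gt0// pi_gt0.
rewrite /transverse_density -/(qform (invmx Gamma) m) -/s.
rewrite !powRN powR12_sqrt ?(ltW D0)// powR12_sqrt ?(ltW s0)//.
rewrite [_.-1%:R / 2]mulrC powRrM powR12_sqrt ?(ltW pp)// powR_mulrn ?sqrtr_ge0//.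
set q := Num.sqrt (2 * pi); have q0 : 0 < q by rewrite sqrtr_gt0.
have q2 : 2 * pi = q ^+ 2 by rewrite sqr_sqrtr// ltW.
rewrite /P /gauss_const -/q q2 mulNr; set E := expR _.
have -> : (q ^+ 2)^-1 ^+ d * (q ^+ d / Num.sqrt (\det Gamma)) = q^-1 ^+ d / Num.sqrt (\det Gamma).
  by rewrite mulrA -exprMn; congr (_ ^+ _ / _); field; rewrite gt_eqF.
have -> : q^-1 ^+ d = (q ^+ d.-1)^-1 * q^-1 by rewrite -{1}(prednK hd) exprSr exprVn.
by field; rewrite !gt_eqF ?exprn_gt0 ?sqrtr_gt0.
Qed.

Lemma phi_shift (w : 'cV[R]_d) (t : R) : phi (w - t *: m) =
  P * (expR (- (2^-1 * qform (transverse_form m Gamma) w)) * expR (- (2^-1 * (s * (t - bil w / s) ^+ 2)))).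
Proof. by rewrite /phi /gauss_density -/P qform_shift mulrDr opprD expRD. Qed.

(** The Riemann sum along the drift. The offset [c0] allows for the integers n not being centred at
    a, and is merged with the minimiser of the square into one bounded shift [c1]. *)
Lemma phi_sum (S e : R) : 0 <= S -> 0 < e -> exists2 H0 : R, 0 < H0 &
  forall H1 : R, exists2 h0 : R, 0 < h0 &
  forall (h : R) N, 0 < h -> h < h0 -> H0 <= h * N%:R -> h * N%:R <= H1 ->
  forall (w : 'cV[R]_d) (c0 : R), (forall i, `|w i 0| <= S) -> `|c0| <= 1 ->
  `|h * \sum_(t <- grid h N) phi (w - (t + c0) *: m) - transverse_density m Gamma w| <= e.
Proof.
move=> S0 e0; have s0 := norming_gt0; have P0 := density_const_ge0.
have nm0 : 0 <= norm1 m by apply: sumr_ge0.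
pose S1 := 1 + entry_sum (invmx Gamma) * (S * norm1 m) / s.
have S10 : 0 <= S1 by rewrite addr_ge0// divr_ge0 ?(ltW s0)// !mulr_ge0// entry_sum_ge0.
have e1 : 0 < e / (P + 1) by rewrite divr_gt0//; lra.
have [H0 H00 hH] := gauss1_grid s0 e1 S10.
exists H0 => // H1; have [h0 h00 hh] := hH H1; exists h0 => // h N hp hlt hN1 hN2 w c0 wS c01.
pose c1 := c0 - bil w / s.
have c1S : cabs (c1%:C : R[i]) <= S1.
  rewrite cabs_real (le_trans (ler_normB _ _))// /S1 lerD//.
  rewrite normrM normfV (ger0_norm (ltW s0)) ler_wpM2r ?invr_ge0 ?(ltW s0)//.
  have -> : bil w = \sum_i \sum_j w i 0 * invmx Gamma i j * m j 0.
    rewrite /bil mxE exchange_big /=; apply: eq_bigr => j _; rewrite mxE mulr_suml.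
    by apply: eq_bigr => i _; rewrite mxE.
  rewrite (le_trans (ler_norm_sum _ _ _))// /entry_sum mulr_suml; apply: ler_sum => i _.
  rewrite (le_trans (ler_norm_sum _ _ _))// mulr_suml; apply: ler_sum => j _.
  rewrite !normrM [X in X * _ <= _]mulrC -mulrA ler_wpM2l//; apply: ler_pM => //.
  by rewrite /norm1 (bigD1 j)//= lerDl sumr_ge0.
have := hh h N hp hlt hN1 hN2 _ c1S.
have -> : h%:C * \sum_(t <- grid h N) cexp (- (2^-1 * s%:C * (t%:C + c1%:C) ^+ 2)) -
   (Num.sqrt (2 * pi) / Num.sqrt s)%:C =
   (h * \sum_(t <- grid h N) expR (- (2^-1 * (s * (t + c1) ^+ 2))) - Num.sqrt (2 * pi) / Num.sqrt s)%:C :> R[i].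
  rewrite [RHS]rmorphB [X in _ = X - _]rmorphM rmorph_sum; congr (_ * _ - _); apply: eq_bigr => t _.
  rewrite /= -cexp_real; congr cexp.
  have key (u v v' : R) : - (2^-1 * u%:C * (v%:C + v'%:C) ^+ 2) = (- (2^-1 * (u * (v + v') ^+ 2)))%:C :> R[i].
    by rewrite rmorphN rmorphM fmorphV rmorph_nat rmorphM rmorphXn rmorphD mulrA.
  exact: key.
rewrite cabs_real => hG.
pose E := expR (- (2^-1 * qform (transverse_form m Gamma) w)).
have E0 : 0 <= E by exact: expR_ge0.
have E1 : E <= 1.
  rewrite -expR0 ler_expR oppr_le0 mulr_ge0//.
  have := qform_shift w (bil w / s); rewrite subrr expr0n mulr0 addr0 => <-.
  exact: (qform_inv_ge0 h5).
have -> : h * \sum_(t <- grid h N) phi (w - (t + c0) *: m) - transverse_density m Gamma w =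
   P * E * (h * \sum_(t <- grid h N) expR (- (2^-1 * (s * (t + c1) ^+ 2))) - Num.sqrt (2 * pi) / Num.sqrt s).
  rewrite transverse_densityE -/E mulrBr; congr (_ - _).
  rewrite mulrCA; congr (_ * _); rewrite mulr_sumr; apply: eq_bigr => t _.
  rewrite phi_shift; have -> : t + c0 - bil w / s = t + c1 by rewrite /c1 addrA.
  exact: mulrA.
rewrite normrM (ger0_norm (mulr_ge0 P0 E0)).
have PE : P * E <= P + 1 by rewrite (le_trans (ler_wpM2l P0 E1))//; lra.
apply: (@le_trans _ _ ((P + 1) * (e / (P + 1)))).
  by apply: ler_pM => //; exact: mulr_ge0.
by rewrite mulrC divfK// gt_eqF//; lra.
Qed.

Lemma sum_expRN_window (k h r D : R) (g : nat -> R[i]) p q : 0 < k -> 0 < h -> h <= 1 -> 0 <= D ->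
  (forall n, (p <= n < q)%N -> cabs (g n) <= D * expR (- (k * `|h * n%:R + r|))) ->
  h * cabs (\sum_(p <= n < q) g n) <= D * (2 * expR k / k).
Proof.
move=> k0 h0 h1 D0 hg.
apply: (@le_trans _ _ (D * (h * \sum_(j < q) expR (- (k * `|h * j%:R + r|))))); last first.
  by rewrite ler_wpM2l//; exact: sum_expRN_le.
rewrite mulrCA ler_wpM2l ?(ltW h0)// (le_trans (ler_cabs_sum _ _ _))//.
rewrite mulr_sumr -(big_mkord xpredT (fun j => D * expR (- (k * `|h * j%:R + r|)))).
have E0 n : 0 <= D * expR (- (k * `|h * n%:R + r|)) by rewrite mulr_ge0 ?expR_ge0.
have S0 x y : 0 <= \sum_(x <= n < y) D * expR (- (k * `|h * n%:R + r|)).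
  by apply: sumr_ge0 => n _; exact: E0.
case: (leqP p q) => pq; last by rewrite [leLHS]big_geq ?S0// ltnW.
rewrite [leRHS](big_cat_nat (leq0n p) pq) /= ler_wpDl ?sumr_ge0//.
rewrite [leLHS]big_nat_cond [leRHS]big_nat_cond; apply: ler_sum => n; rewrite andbT; exact: hg.
Qed.

(* [lra] reads the whole context and fails when a section variable is cleared. *)
Ltac light_lra := clear - hd h5 tilt local mu phi P s bil; lra.

(** The sum over n is cut at distance about H sqrt a from a. Outside, [term_bound] is summed;
    inside, there are O(H sqrt a) terms, so a uniform error in [middle_term] is multiplied only by
    O(H) after applying the mesh. *)
Lemma green_estimate (S e : R) : 0 <= S -> 0 < e -> exists a0 : R, forall a k, a0 <= a ->
  (forall i, `|rescaled m a k i 0| <= S) ->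
  cabs ((Num.sqrt a ^+ d.-1)%:C * limn (series (c^~ k)) -
    A * (transverse_density m Gamma (rescaled m a k))%:C) <= e.
Proof.
move=> S0 e0; have A0 := cabs_ge0 A.
have e3 : 0 < e / 3 by pos.
have [kap [C [a1 [kap0 C0 a11 hterm]]]] := term_bound S.
have k20 : 0 < kap / 2 by pos.
pose G := 2 * expR (kap / 2) / (kap / 2).
have G0 : 0 <= G by rewrite /G divr_ge0 ?(ltW k20)// mulr_ge0 ?expR_ge0.
have e4 : 0 < e / 3 / (cabs A + 1) by rewrite divr_gt0//; lra.
have [H0 H00 hH] := phi_sum S0 e4.
(* [H] is chosen so that kap / 2 * (H - 1) >= X; then exp y >= y makes the two tails together at
   most e / 3. The other half of [kap] is left for summing. *)
pose X := C * (2 * G) / (e / 3).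
have X0 : 0 <= X by rewrite /X divr_ge0 ?(ltW e3)// mulr_ge0// mulr_ge0.
pose H := H0 + 1 + X / (kap / 2).
have Xk : 0 <= X / (kap / 2) by rewrite divr_ge0// ltW.
have HH0 : H0 <= H by rewrite /H; lra.
have Hpos : 0 <= H by lra.
have [h0 h00 hh] := hH (H + 1).
have H20 : 0 <= H + 2 by lra.
have e5 : 0 < e / 3 / (2 * (H + 1)) by rewrite divr_gt0//; lra.
have [a2 ha2] := middle_term S0 H20 e5.
pose r0 := 1 + h0^-1 + (H + 2).
have ih0 : 0 < h0^-1 by rewrite invr_gt0.
have r01 : 1 <= r0 by rewrite /r0; lra.
exists (Num.max a1 (Num.max a2 (r0 ^+ 2))) => a k; rewrite !ge_max => /andP[aa1 /andP[aa2 aa3]] hk.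
have a0 : 0 < a by lra.
pose r := Num.sqrt a; have rr0 : 0 < r by rewrite sqrtr_gt0.
have rr : r ^+ 2 = a by rewrite sqr_sqrtr// ltW.
have r0r : r0 <= r by rewrite -(@ler_pXn2r _ 2) ?nnegrE ?(ltW rr0)//; [rewrite rr|lra].
have rH : H + 2 <= r by move: r0r; rewrite /r0; lra.
have rh : h0^-1 < r by move: r0r; rewrite /r0; lra.
pose h := r^-1; have hp : 0 < h by rewrite invr_gt0.
have h1 : h <= 1 by rewrite invf_le1//; lra.
have hh0 : h < h0 by rewrite /h invf_plt ?posrE.
have hr : h * r = 1 by rewrite mulVf// gt_eqF.
(* The window is symmetric around the integer part of a, so that its n form a translate of
   [grid h N1]. *)
pose N0 := Num.truncn a; pose N1 := (Num.truncn (H * r)).+1.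
have /andP[N0a N0b] := truncn_itv (ltW a0); rewrite -/N0 in N0a N0b.
have /andP[N1a N1b] := truncn_itv (mulr_ge0 Hpos (ltW rr0)); rewrite -/N1 in N1b.
have N1c : N1%:R <= H * r + 1 by rewrite /N1 -natr1; lra.
have N0c : a < N0%:R + 1 by rewrite natr1.
(* Makes the truncated subtraction N0 - N1, the lower end of the window, a true one. *)
have N10 : (N1 <= N0)%N.
  rewrite -ltnS -(ltr_nat R) (le_lt_trans N1c)// (le_lt_trans _ N0b)// -rr expr2.
  have : (H + 2) * r <= r * r by rewrite ler_wpM2r// ltW. lra.
have hN1a : H <= h * N1%:R.
  have := ler_wpM2l (ltW hp) (ltW N1b); rewrite mulrCA hr mulr1//.
have hN1b : h * N1%:R <= H + 1.
  by have := ler_wpM2l (ltW hp) N1c; rewrite mulrDr mulrCA hr mulr1; move: h1; light_lra.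
set w := rescaled m a k.
pose t n : R := (n%:R - a) / r.
have tE n : t n = h * n%:R - r.
  by rewrite /t /h mulrBl -rr expr2 -mulrA divff ?gt_eqF// mulr1 mulrC.
pose g n := (r ^+ d)%:C * c n k.
have gb n : cabs (g n) <= C * expR (- (kap * `|t n|)).
  rewrite /g cabsM cabs_real ger0_norm ?exprn_ge0 ?(ltW rr0)//; exact: hterm.
pose D := C * expR (- (kap / 2 * (H - 1))).
have D0 : 0 <= D by rewrite mulr_ge0 ?expR_ge0.
have tail p q : (forall n, (p <= n < q)%N -> H - 1 <= `|t n|) ->
    h * cabs (\sum_(p <= n < q) g n) <= D * G.
  move=> pq; apply: (@sum_expRN_window (kap / 2) h (- r)) => // n npq.
  rewrite (le_trans (gb n))// /D -mulrA ler_wpM2l// -expRD ler_expR -tE.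
  by have := ler_wpM2l (ltW k20) (pq n npq); light_lra.
have DG : D * G + D * G <= e / 3.
  pose y := kap / 2 * (H - 1).
  have x1 : X <= y.
    rewrite /y; have -> : H - 1 = H0 + X / (kap / 2) by rewrite /H; ring.
    by rewrite mulrDr [X in _ <= _ + X]mulrC divfK ?gt_eqF// lerDr mulr_ge0 ?(ltW k20)// ltW.
  have E := expR_ge1Dx y.
  have CX : C * (2 * G) <= e / 3 * expR y.
    have : X * (e / 3) <= expR y * (e / 3) by rewrite ler_wpM2r ?(ltW e3)//; move: x1 E; light_lra.
    have -> : X * (e / 3) = C * (2 * G) by rewrite /X divfK// gt_eqF.
    by rewrite [expR y * _]mulrC.
  have -> : D * G + D * G = C * (2 * G) / expR y by rewrite /D -/y expRN; ring.
  by rewrite ler_pdivrMr ?expR_gt0.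
pose L := (N0 - N1)%N; pose U := (N0 + N1)%N.
have LN0 : L%:R = N0%:R - N1%:R :> R by rewrite natrB.
(* The rescaled distance from a to its integer part; being at most 1, it is why the tails are
   estimated with H - 1. *)
pose c0 := h * N0%:R - r.
have c01 : `|c0| <= 1.
  have -> : c0 = h * (N0%:R - a) by rewrite mulrBr /c0 -rr expr2 mulrA hr mul1r.
  rewrite normrM (ger0_norm (ltW hp)) mulr_ile1// ?(ltW hp)//.
  by move: N0a N0c; rewrite ler_norml; light_lra.
have midt j : t (j + L)%N = h * (j%:R - N1%:R) + c0.
  by rewrite tE natrD LN0 /c0; ring.
have mid : cabs (h%:C * \sum_(L <= n < U) g n - A * (transverse_density m Gamma w)%:C) <= e / 3 + e / 3.
  have -> : \sum_(L <= n < U) g n = \sum_(j < N1 + N1) g (j + L)%N.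
    rewrite -{1}[L]add0n big_addn big_mkord /U /L.
    by have -> : (N0 + N1 - (N0 - N1) = N1 + N1)%N by rewrite subnBA// -addnA addKn.
  pose Phi := \sum_(x <- grid h N1) phi (w - (x + c0) *: m).
  have PhiE : Phi = \sum_(j < N1 + N1) phi (w - t (j + L)%N *: m).
    by rewrite /Phi sum_grid; apply: eq_bigr => j _; rewrite midt.
  have -> : h%:C * (\sum_(j < N1 + N1) g (j + L)%N) - A * (transverse_density m Gamma w)%:C =
     h%:C * \sum_(j < N1 + N1) (g (j + L)%N - A * (phi (w - t (j + L)%N *: m))%:C) +
     A * (h * Phi - transverse_density m Gamma w)%:C.
    have PhiC : \sum_(j < N1 + N1) A * (phi (w - t (j + L)%N *: m))%:C = A * Phi%:C.
      by rewrite PhiE rmorph_sum mulr_sumr.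
    have key (h' p q : R) (C1 C2 : R[i]) : h'%:C * C1 - C2 * q%:C =
        h'%:C * (C1 - C2 * p%:C) + C2 * (h' * p - q)%:C by rewrite rmorphB rmorphM; ring.
    by rewrite sumrB PhiC; exact: key.
  rewrite (le_trans (ler_cabsD _ _))// !cabsM !cabs_real (ger0_norm (ltW hp)) lerD//.
    have tj (j : 'I_(N1 + N1)) : `|t (j + L)%N| <= H + 2.
      rewrite midt (le_trans (ler_normD _ _))//.
      have : `|h * (j%:R - N1%:R)| <= h * N1%:R.
        rewrite normrM (ger0_norm (ltW hp)) ler_wpM2l ?(ltW hp)// ler_norml.
        have : j%:R <= (N1 + N1)%:R :> R by rewrite ler_nat ltnW.
        have : (0 : R) <= j%:R by [].
        by rewrite natrD; light_lra.
      by move: hN1b c01; light_lra.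
    rewrite (le_trans (ler_wpM2l (ltW hp) (ler_cabs_sum _ _ _)))//.
    apply: (@le_trans _ _ (h * \sum_(j < N1 + N1) (e / 3 / (2 * (H + 1))))).
      rewrite ler_wpM2l ?(ltW hp)//; apply: ler_sum => j _; exact: (ha2 a k aa2 hk (j + L)%N (tj j)).
    rewrite sumr_const card_ord -[_ *+ (N1 + N1)]mulr_natl natrD [leLHS]mulrA.
    have b1 : h * (N1%:R + N1%:R) <= 2 * (H + 1) by move: hN1b; light_lra.
    apply: (@le_trans _ _ (2 * (H + 1) * (e / 3 / (2 * (H + 1))))).
      by rewrite ler_wpM2r// ltW.
    by rewrite mulrC divfK// gt_eqF//; move: Hpos; light_lra.
  have b2 := hh h N1 hp hh0 (le_trans HH0 hN1a) hN1b w c0 hk c01.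
  apply: (@le_trans _ _ ((cabs A + 1) * (e / 3 / (cabs A + 1)))).
    by apply: ler_pM => //; move: A0; light_lra.
  by rewrite mulrC divfK// gt_eqF//; move: A0; light_lra.
(* One factor sqrt a of the local limit normalisation is traded for the mesh of the Riemann sum. *)
have rd : r ^+ d.-1 = h * r ^+ d.
  by rewrite -{2}(prednK hd) exprS mulrA hr mul1r.
have lim := series_lim k.
have := @tends_to_lin R R[i]^o R[i]^o (fun y => (r ^+ d.-1)%:C * y) (r ^+ d.-1) _ _ _ _ lim.
move=> /(_ _ _) T; have {}T := tends_toD (T _ _) (tends_to_cst (- (A * (transverse_density m Gamma w)%:C) : R[i]^o)).
rewrite -rnorm_cabs; apply: (@tends_to_norm_le R R[i]^o _ _ _ _ (T _ _)).
- exists U => N UN.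
  have LU : (L <= U)%N by rewrite /L /U (leq_trans (leq_subr _ _))// leq_addr.
  have sE : (r ^+ d.-1)%:C * series (c^~ k) N = h%:C * \sum_(0 <= n < L) g n + h%:C * \sum_(L <= n < U) g n + h%:C * \sum_(U <= n < N) g n.
    rewrite -!mulrDr -(big_cat_nat (leq0n _) LU) -(big_cat_nat (leq0n _) UN) /= rd rmorphM -mulrA; congr (_ * _).
    by rewrite /series /= mulr_sumr.
  rewrite rnorm_cabs sE.
  have -> : h%:C * \sum_(0 <= n < L) g n + h%:C * \sum_(L <= n < U) g n + h%:C * \sum_(U <= n < N) g n -
      A * (transverse_density m Gamma w)%:C =
      (h%:C * \sum_(L <= n < U) g n - A * (transverse_density m Gamma w)%:C) +
      (h%:C * \sum_(0 <= n < L) g n + h%:C * \sum_(U <= n < N) g n) by ring.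
  rewrite (le_trans (ler_cabsD _ _))//.
  have p1 : cabs (h%:C * \sum_(0 <= n < L) g n) <= D * G.
    rewrite cabsM cabs_real (ger0_norm (ltW hp)); apply: tail => n /andP[_ nL].
    have nL' : n%:R <= N0%:R - N1%:R :> R by rewrite -LN0 ler_nat ltnW.
    have : h * n%:R <= h * (N0%:R - N1%:R) by rewrite ler_wpM2l// ltW.
    move: c01; rewrite tE /c0 ler_norml mulrBr => /andP[q1 q2] q3.
    have q4 : h * n%:R - r <= 1 - H by move: q1 q2 q3 hN1a; light_lra.
    by have := ler_norm (- (h * n%:R - r)); rewrite normrN; move: q4; light_lra.
  have p2 : cabs (h%:C * \sum_(U <= n < N) g n) <= D * G.
    rewrite cabsM cabs_real (ger0_norm (ltW hp)); apply: tail => n /andP[nU _].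
    have nU' : N0%:R + N1%:R <= n%:R :> R by rewrite -natrD ler_nat.
    have : h * (N0%:R + N1%:R) <= h * n%:R by rewrite ler_wpM2l// ltW.
    move: c01; rewrite tE /c0 ler_norml mulrDr => /andP[q1 q2] q3.
    by rewrite (le_trans _ (ler_norm _))//; move: q1 q2 q3 hN1a; light_lra.
  have := ler_cabsD (h%:C * \sum_(0 <= n < L) g n) (h%:C * \sum_(U <= n < N) g n).
  by move: p1 p2 mid DG; light_lra.
- by move=> y1 y2; rewrite mulrBr.
- by move=> y; rewrite !rnorm_cabs cabsM cabs_real ger0_norm// exprn_ge0// ltW.
Qed.

Lemma compact_coordinates_bounded (K : set 'cV[R]_d) : compact K ->
  exists2 S : R, 0 <= S & forall v, K v -> forall i, `|v i 0| <= S.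
Proof.
move=> cK; have [M [Mr hM]] := compact_bounded cK.
exists (`|M| + 1); first by rewrite addr_ge0.
move=> v Kv i; have Mlt : M < `|M| + 1 by have := ler_norm M; lra.
rewrite (le_trans _ (hM _ Mlt v Kv))//.
by rewrite [leRHS]mx_normrE; exact: (le_bigmax _ _ (i, 0)).
Qed.

Lemma green_limit (K : set 'cV[R]_d) : compact K ->
  sup [set cabs ((a `^ (d.-1%:R / 2))%:C * limn (series (c^~ k)) -
                 A * (transverse_density m Gamma (rescaled m a k))%:C)
      | k in window m K a] @[a --> +oo] --> (0 : R).
Proof.
move=> cK; have [S S0 hS] := compact_coordinates_bounded cK.
apply/cvgrPdist_le => e e0; have [a0 ha0] := green_estimate S0 e0.
near=> a; rewrite sub0r normrN.
have a0a : a0 <= a by near: a; apply: nbhs_pinfty_ge; exact: num_real.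
have ap : 0 <= a by near: a; apply: nbhs_pinfty_ge; exact: num_real.
have pw : a `^ (d.-1%:R / 2) = Num.sqrt a ^+ d.-1.
  by rewrite mulrC powRrM powR12_sqrt// powR_mulrn ?sqrtr_ge0.
rewrite pw; set E := [set _ | _ in _].
have ub : ubound E e.
  by move=> _ [k hk <-]; apply: ha0 => // i; exact: hS.
(* The window may contain no lattice point; the supremum of the empty set is 0. *)
have [[y Ey]|/set0P/negP/negPn/eqP E0] := pselect (E !=set0); last by rewrite E0 sup0 normr0 ltW.
have y0 : 0 <= y by case: Ey => k _ <-; exact: cabs_ge0.
rewrite ger0_norm; first by apply: ge_sup => //; exists y.
by rewrite (le_trans y0)//; apply: ub_le_sup => //; exists e.
Unshelve. all: by end_near.
Qed.

End Assembly.


(** * From the spectral hypotheses to the limit of the Green function *)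

Lemma cintegral_linear (R : realType) (disp : measure_display) (X : measurableType disp)
    (mu : {measure set X -> \bar R}) (a : R[i]) (u v : X -> R[i]) :
  cintegrable mu u -> cintegrable mu v ->
  cintegral mu (fun x => a * u x + v x) = a * cintegral mu u + cintegral mu v.
Proof.
move=> [ur ui] [vr vi]; case: a => a b; rewrite /cintegral.
have lin (p q : R) (f g h : X -> R) : mu.-integrable setT (fun x => (f x)%:E) ->
    mu.-integrable setT (fun x => (g x)%:E) -> mu.-integrable setT (fun x => (h x)%:E) ->
    fine (\int[mu]_x (p * f x + q * g x + h x)%:E) =
    p * fine (\int[mu]_x (f x)%:E) + q * fine (\int[mu]_x (g x)%:E) + fine (\int[mu]_x (h x)%:E).
  move=> fi gi hi.
  have pf : mu.-integrable setT (fun x => p%:E * (f x)%:E)%E by exact: integrableZl.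
  have qg : mu.-integrable setT (fun x => q%:E * (g x)%:E)%E by exact: integrableZl.
  have fF := integrable_fin_num measurableT fi; have gF := integrable_fin_num measurableT gi.
  have hF := integrable_fin_num measurableT hi.
  under eq_integral do rewrite !EFinD !EFinM.
  rewrite integralD//; last exact: integrableD.
  rewrite integralD// !integralZl// -(fineK fF) -(fineK gF) -(fineK hF).
  by rewrite -!EFinM -!EFinD /=.
apply/eqP; rewrite eq_complex /=; apply/andP; split; apply/eqP.
- rewrite -mulNr; apply: etrans (lin a (- b) _ _ _ ur ui vr); congr fine; apply: eq_integral => x _.
  by case: (u x) (v x) => u1 u2 [v1 v2] /=; congr EFin; ring.
- apply: etrans (lin a b _ _ _ ui ur vi); congr fine; apply: eq_integral => x _.
  by case: (u x) (v x) => u1 u2 [v1 v2] /=; congr EFin; ring.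
Qed.

Theorem theorem6p5 (R : realType) (d : nat) (hd : (1 <= d)%N)
  (disp : measure_display) (X : measurableType disp)
  (hX : standard_borel R X)
  (q : multi d -> R.-ker X ~> X)
  (hq : forall x, (\esum_(k in [set: multi d]) q k x setT = 1)%E)
  (B : completeNormedModType R[i]) (ev : B -> X -> R[i])
  (hB : function_space ev)
  (nu : probability X R) (hnu : invariant_probability q nu)
  (rho : 'cV[R[i]]_d -> R[i]) (hrho : eigenvalue_continuation ev q rho)
  (m : 'cV[R]_d) (Gamma : 'M[R]_d)
  (h1 : S1 ev q nu) (h2 : S2 ev q nu) (h3 : S3 ev q)
  (h4 : S4 ev q rho) (h5 : S5 rho m Gamma)
  (alpha : {scalar B}) (halpha : continuous alpha) (f : B)
  (K : set 'cV[R]_d) (hK : compact K) :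
  [/\ forall n k, belongs ev (conv_apply q n k (ev f)),
      forall k, cvgn (series (green_term ev q alpha f k)) &
      sup [set cabs ((a `^ (d.-1%:R / 2))%:C * green ev q alpha f k -
                     alpha (elt ev (cst 1)) * cintegral nu (ev f) *
                     (transverse_density m Gamma (rescaled m a k))%:C)
          | k in window m K a] @[a --> +oo] --> (0 : R)].
Proof.
have [ev_lin ev_inj ev_meas] := hB.
have [one_in acts Q0] := h1; have [eta eta0 hS3] := h3.
have ev_int n k x g : cintegrable (convpow q n k x) (ev g).
  by apply: (acts _ _).1; right; exists n, k, x.
(* Dirac masses are the case n = 0, k = 0 of the considered measures. *)
have ev_cont x : continuous (fun g : B => cintegral (convpow q 0 multi0 x) (ev g)).
  by apply: (acts _ _).2; right; exists 0%N, multi0, x.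
have [nu_int nu_cont] := acts nu (or_introl erefl).
have alpha_lin (a : R[i]) g g' : alpha (a *: g + g') = a * alpha g + alpha g' by rewrite linearP.
have alphaB g g' : alpha (g - g') = alpha g - alpha g' by exact: linearB.
have alphaZ (a : R[i]) g : alpha (a *: g) = a * alpha g by exact: linearZ.
have [Ca Ca0 hCa] := continuous_scalar_bounded alpha_lin halpha.
pose p (g : B) := cintegral nu (ev g); pose e := elt ev (cst 1).
have p_linear (a : R[i]) g g' : p (a *: g + g') = a * p g + p g'.
  rewrite /p -cintegral_linear; [|exact: nu_int|exact: nu_int].
  by congr cintegral; apply/funext => x; rewrite ev_lin.
have p_bounded := continuous_scalar_bounded p_linear nu_cont.
have pZ (a : R[i]) g : p (a *: g) = a * p g.
  have p0 : p 0 = 0 by have := p_linear (-1) 0 0; rewrite scaler0 addr0 mulN1r addNr.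
  by have := p_linear a g 0; rewrite addr0 p0 addr0.
have pe : p e = 1.
  rewrite /p /e (elt_spec one_in) /cintegral /= !integral_cst//= probability_setT !mule1 /=.
  by [].
have [_ _ T0] := Q0; have [N0 [[N0_linear _] T0E pN0 N0_power]] := h2.
have T_lip : exists s C : R, [/\ 0 < s, 0 <= C & forall (h : 'cV[R[i]]_d) x, x <= s ->
    (forall i, cabs (h i 0) <= x) -> 0 <= x ->
    forall g, rnorm (Qop ev q h g - Qop ev q 0 g) <= C * x * rnorm g].
  have strip0 : strip eta (0 : 'cV[R[i]]_d).
    by rewrite /strip /= big1// => i _; rewrite mxE normr0.
  have [_ /op_analytic_lipschitz[s [C [s0 C0 hsC]]]] := hS3 0 strip0.
  exists s, C; split=> // h x xs hx x0 g.
  by have := hsC h x xs hx x0 g; rewrite add0r.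
have T_dom : exists2 s : R, 0 < s & forall h : 'cV[R[i]]_d, (forall i, cabs (h i 0) <= s) ->
    simple_dominant_eigenvalue (Qop ev q h) (rho h).
  by have [_ _ hdom] := hrho; exact: nbhs0_csmall hdom.
have [C [r [C0 r0 r1 hnear]]] := spectral_approx pZ p_bounded pe N0_linear p_linear
  T0.1 T0.2 T0E pN0 N0_power T_lip (rho_continuous0 h5) T_dom.
pose a n (z : 'cV[R[i]]_d) := alpha (iter n (Qop ev q z) f).
pose c n k := green_term ev q alpha f k n.
pose A := alpha e * p f.
have F0 := rnorm_ge0 f.
have fourier : exists2 x : R, 0 < x & forall z : 'cV[R]_d, vsmall x z -> forall n k,
    @tends_to R R[i]^o (fun N => gavg N (fun u =>
      cexp (- cdot (cvec z u) k) * a n (cvec z u) : R[i]^o)) (c n k).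
  exists (tilt_radius d eta / 2); first by rewrite divr_gt0// tilt_radius_gt0.
  move=> z hz n k.
  exact: (fourier_conv_apply hq ev_lin ev_inj ev_meas ev_int ev_cont eta0 hS3 n k f alpha_lin hCa hz).
have near0 : exists C r : R, [/\ 0 <= C, 0 <= r, r < 1 &
    forall y : R, 0 < y -> exists2 x : R, 0 < x & forall h, csmall x h -> forall n,
      cabs (a n h - rho h ^+ n * A) <= y * cabs (rho h) ^+ n + C * r ^+ n].
  exists (Ca * C * rnorm f), r; split=> //; first by rewrite !mulr_ge0.
  move=> y y0; pose W := Ca * rnorm f + 1.
  have W0 : 0 < W by rewrite /W; have := mulr_ge0 Ca0 F0; lra.
  have [x x0 hx] := hnear _ (divr_gt0 y0 W0); exists x => // h hh n.
  have -> : rho h ^+ n * A = alpha ((rho h ^+ n * p f) *: e).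
    by rewrite alphaZ /A; ring.
  rewrite /a -alphaB.
  rewrite (le_trans (hCa _))// (le_trans (ler_wpM2l Ca0 (hx h hh n f)))//.
  have l0 : 0 <= cabs (rho h) ^+ n by rewrite exprn_ge0// cabs_ge0.
  have -> : Ca * ((y / W * cabs (rho h) ^+ n + C * r ^+ n) * rnorm f) =
      Ca * rnorm f / W * (y * cabs (rho h) ^+ n) + Ca * C * rnorm f * r ^+ n by ring.
  rewrite lerD2r ler_piMl ?mulr_ge0 ?(ltW y0)// ler_pdivrMr// mul1r /W; lra.
have away : forall delta : R, 0 < delta -> exists C r : R, [/\ 0 <= C, 0 <= r, r < 1 &
    exists2 x : R, 0 < x & forall z : 'cV[R]_d, vsmall x z -> forall u, cube u ->
      delta <= norm1 u -> forall n,
      cabs (a n (cvec z u)) <= C * r ^+ n * cabs (rho (rvec z)) ^+ n].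
  move=> delta /h4[C' [r' [/andP[r'0 r'1] /nbhs0_vsmall[x x0 hx]]]].
  exists (Ca * `|C'| * rnorm f), r'; split=> //; first by rewrite !mulr_ge0.
  exists x => // z hz u cu du n.
  have cu' i : - pi <= u i 0 <= pi by rewrite -ler_norml; exact: cu.
  have /op_leP/(_ f) h := hx z hz u cu' du n.
  have l0 : 0 <= r' ^+ n * cabs (rho (rvec z)) ^+ n by rewrite mulr_ge0 ?exprn_ge0 ?cabs_ge0.
  rewrite (le_trans (hCa _))// (le_trans (ler_wpM2l Ca0 h))//.
  have -> : Ca * `|C'| * rnorm f * r' ^+ n * cabs (rho (rvec z)) ^+ n =
    Ca * (`|C'| * (r' ^+ n * cabs (rho (rvec z)) ^+ n) * rnorm f) by ring.
  by rewrite ler_wpM2l// ler_wpM2r// -mulrA ler_wpM2r// ler_norm.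
have tilt := tilt_bound h5 fourier near0 away.
have local (e' S : R) := @local_limit R d a c A rho m Gamma h5 fourier near0 away e' S.
split.
- move=> n k.
  exact: (conv_apply_belongs hq ev_lin ev_meas ev_int ev_cont eta0 hS3 n k f).
- by move=> k; exact: (series_cvg hd h5 tilt).
- exact: (green_limit hd h5 tilt local hK).
Qed.
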